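(* Let $\varphi\colon\mathcal{E}\to\mathcal{F}$ be a morphism of positive rank $r$ between vector bundles on a scheme $S$. Assume that its degeneration scheme is a Cartier divisor $D$ on $S$ and that $\bigwedge^{r-1}\varphi_s$ does not vanish for any geometric point $s$ of $S$. There is a unique factorization $$\varphi\colon\mathcal{E}\twoheadrightarrow\mathcal{E}_1\xrightarrow{\ \varphi_1\ }\mathcal{F}_1\hookrightarrow\mathcal{F}$$ such that - $\mathcal{E}_1$ and $\mathcal{F}_1$ are vector bundles of rank $r$, - the map $\mathcal{E}\twoheadrightarrow\mathcal{E}_1$ is an epimorphism, - the map $\mathcal{F}_1\hookrightarrow\mathcal{F}$ is a fiberwise monomorphism, - the map $\varphi_1$ is a monomorphism and its cokernel is a line bundle on $D$.
   Context: All schemes are over a fixed field $\mathbf{k}$. A vector bundle is a locally free sheaf of constant finite rank. The rank of a morphism $\varphi$ of vector bundles is the smallest integer $r$ such that $\bigwedge^{r+1}\varphi=0$ identically on $S$. The degeneration scheme of a morphism $\varphi$ of positive rank $r$ is the zero locus of $\bigwedge^r\varphi$ (the subscheme locally defined by the $r\times r$ minors). An effective Cartier divisor on a scheme is a subscheme locally defined by one regular function which is not a zero divisor. For a geometric point $s$, $\varphi_s\colon\mathcal{E}_s\to\mathcal{F}_s$ is the induced map on fibers. A morphism of vector bundles is a fiberwise monomorphism if it is injective on fibers at every geometric point. ''Line bundle on $D$'' means the pushforward to $S$ of a line bundle on $D$. *)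

(* Defs.v *)
From HB Require Import structures.
From mathcomp Require Import all_boot all_algebra.
From mathcomp Require Import boolp classical_sets topology.

Set Implicit Arguments.
Unset Strict Implicit.
Unset Printing Implicit Defensive.

Import GRing.Theory.
Local Open Scope classical_set_scope.
Local Open Scope ring_scope.
Local Open Scope quotient_scope.

(* A formal sum [:: (a1, g1); ...; (an, gn)] stands for a1 g1 + ... + an gn;
   [pres_eq] is equality in the quotient of the free module on G by the
   submodule generated by the formal sums satisfying Rel. *)
Section Presented.
Variables (R : comPzRingType) (G : Type).

Definition fscale (a : R) (u : seq (R * {classic G})) :=
  [seq (a * x.1, x.2) | x <- u].

Variable Rel : seq (R * {classic G}) -> Prop.

Inductive pres_eq :
    seq (R * {classic G}) -> seq (R * {classic G}) -> Prop :=
| pres_refl u : pres_eq u u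
| pres_sym u v : pres_eq u v -> pres_eq v u
| pres_trans u v w : pres_eq u v -> pres_eq v w -> pres_eq u w
| pres_cat u u' v v' : pres_eq u u' -> pres_eq v v' ->
    pres_eq (u ++ v) (u' ++ v')
| pres_catC u v : pres_eq (u ++ v) (v ++ u)
| pres_collect a b g : pres_eq [:: (a, g); (b, g)] [:: (a + b, g)]
| pres_zero g : pres_eq [:: (0, g)] [::]
| pres_scale a u v : pres_eq u v -> pres_eq (fscale a u) (fscale a v)
| pres_rel u : Rel u -> pres_eq u [::].

Definition pres_eqb : rel (seq (R * {classic G})) := fun u v => `[< pres_eq u v >].

Lemma pres_eqb_refl : reflexive pres_eqb.
Proof. by move=> u; apply/asboolP; exact: pres_refl. Qed.
Lemma pres_eqb_sym : symmetric pres_eqb.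
Proof. by move=> u v; apply/asboolP/asboolP => /pres_sym. Qed.
Lemma pres_eqb_trans : transitive pres_eqb.
Proof.
by move=> v u w /asboolP uv /asboolP vw; apply/asboolP; exact: pres_trans vw.
Qed.

Canonical pres_equiv :=
  EquivRel pres_eqb pres_eqb_refl pres_eqb_sym pres_eqb_trans.

Definition pres := {eq_quot pres_equiv}.
HB.instance Definition _ := Choice.on pres.
HB.instance Definition _ := EqQuotient.on pres.

Lemma pres_eqP u v : reflect (pres_eq u v) (\pi_pres u == \pi_pres v).
Proof. by rewrite piE; exact: asboolP. Qed.

Lemma pres_repr u : pres_eq (repr (\pi_pres u)) u.
Proof. by apply/pres_eqP; rewrite reprK. Qed.

Definition pres_add (p q : pres) : pres := \pi_pres (repr p ++ repr q).
Definition pres_opp (p : pres) : pres := \pi_pres (fscale (-1) (repr p)).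
Definition pres_scal (a : R) (p : pres) : pres := \pi_pres (fscale a (repr p)).
Definition pres0 : pres := \pi_pres [::].

Lemma pres_addE u v : pres_add (\pi_pres u) (\pi_pres v) = \pi_pres (u ++ v).
Proof. by apply/eqP/pres_eqP; apply: pres_cat; exact: pres_repr. Qed.

Lemma pres_scalE a u : pres_scal a (\pi_pres u) = \pi_pres (fscale a u).
Proof. by apply/eqP/pres_eqP; apply: pres_scale; exact: pres_repr. Qed.

Lemma pres_scalDl_subproof a b u :
  pres_eq (fscale (a + b) u) (fscale a u ++ fscale b u).
Proof.
elim: u => [|[c g] u IH]; first exact: pres_refl.
apply: (@pres_trans _ ([:: (a * c, g); (b * c, g)] ++ (fscale a u ++ fscale b u))).
  rewrite /= mulrDl; apply: (@pres_cat [:: _] [:: _; _] _ _ _ IH).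
  by apply: pres_sym; exact: pres_collect.
have swap x y s t : pres_eq ([:: x; y] ++ (s ++ t)) ((x :: s) ++ (y :: t)).
  apply: (@pres_cat [:: x] [:: x] (y :: (s ++ t))); first exact: pres_refl.
  have := pres_cat (pres_catC [:: y] s) (pres_refl t); by rewrite -!catA.
exact: swap.
Qed.

Lemma pres_scal0_subproof u : pres_eq (fscale 0 u) [::].
Proof.
elim: u => [|[c g] u IH] /=; first exact: pres_refl.
rewrite mul0r; apply: (@pres_cat [:: _] [::] _ [::] _ IH); exact: pres_zero.
Qed.

Lemma pres_addA : associative pres_add.
Proof.
elim/quotW=> u; elim/quotW=> v; elim/quotW=> w.
by rewrite (pres_addE v w) (pres_addE u (v ++ w)) (pres_addE u v) (pres_addE (u ++ v) w) catA.
Qed.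

Lemma pres_addC : commutative pres_add.
Proof.
elim/quotW=> u; elim/quotW=> v; rewrite (pres_addE u v) (pres_addE v u).
by apply/eqP/pres_eqP; exact: pres_catC.
Qed.

Lemma pres_add0 : left_id pres0 pres_add.
Proof. by elim/quotW=> u; rewrite /pres0 pres_addE. Qed.

Lemma fscale1 u : fscale 1 u = u.
Proof. by rewrite /fscale -[RHS]map_id; apply: eq_map => -[a g] /=; rewrite mul1r. Qed.

Lemma pres_addN : left_inverse pres0 pres_opp pres_add.
Proof.
elim/quotW=> u; rewrite -[pres_opp _]/(pres_scal _ _) pres_scalE (pres_addE (fscale (-1) u) u).
apply/eqP/pres_eqP; rewrite -[X in _ ++ X]fscale1.
apply: pres_trans (pres_scal0_subproof u).
by rewrite -[0](addNr 1); apply: pres_sym; exact: pres_scalDl_subproof.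
Qed.

HB.instance Definition _ :=
  GRing.isZmodule.Build pres pres_addA pres_addC pres_add0 pres_addN.

Lemma pres_scalA a b p : pres_scal a (pres_scal b p) = pres_scal (a * b) p.
Proof.
elim/quotW: p => u; rewrite (pres_scalE b u) (pres_scalE a (fscale b u)) pres_scalE /fscale -map_comp.
by congr (\pi_pres _); apply: eq_map => -[c g] /=; rewrite mulrA.
Qed.

Lemma pres_scal1 : left_id 1 pres_scal.
Proof. by elim/quotW=> u; rewrite pres_scalE fscale1. Qed.

Lemma pres_scalDr : right_distributive pres_scal +%R.
Proof.
move=> a; elim/quotW=> u; elim/quotW=> v.
rewrite -[LHS]/(pres_scal a (pres_add _ _)) -[RHS]/(pres_add _ _).
rewrite (pres_addE u v) (pres_scalE a (u ++ v)) (pres_scalE a u) (pres_scalE a v).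
by rewrite (pres_addE (fscale a u) (fscale a v)) /fscale map_cat.
Qed.

Lemma pres_scalDl p : {morph pres_scal^~ p : a b / a + b}.
Proof.
move=> a b; elim/quotW: p => u; rewrite -[RHS]/(pres_add _ _).
rewrite (pres_scalE (a + b) u) (pres_scalE a u) (pres_scalE b u).
rewrite (pres_addE (fscale a u) (fscale b u)).
by apply/eqP/pres_eqP; exact: pres_scalDl_subproof.
Qed.

HB.instance Definition _ := GRing.Zmodule_isLmodule.Build R pres
  pres_scalA pres_scal1 pres_scalDr pres_scalDl.

Definition pres_gen (g : G) : pres := \pi_pres [:: (1, g : {classic G})].

End Presented.

Definition fsum (R R' : comPzRingType) (G : Type) (N : lmodType R')
    (sigma : {rmorphism R -> R'}) (f : G -> N) (u : seq (R * {classic G})) : N :=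
  \sum_(x <- u) sigma x.1 *: f x.2.

(* The sigma-semilinear map out of a presented module with prescribed values f
   on the generators; meaningful when f kills the relations ([pres_liftE]). *)
Definition pres_lift (R R' : comPzRingType) (G : Type)
    (Rel : seq (R * {classic G}) -> Prop) (N : lmodType R')
    (sigma : {rmorphism R -> R'}) (f : G -> N) (p : pres Rel) : N :=
  fsum sigma f (repr p).

Section PresLift.
Variables (R R' : comPzRingType) (G : Type).
Variables (Rel : seq (R * {classic G}) -> Prop) (N : lmodType R').
Variables (sigma : {rmorphism R -> R'}) (f : G -> N).

Lemma fsum_cat u v : fsum sigma f (u ++ v) = fsum sigma f u + fsum sigma f v.
Proof. by rewrite /fsum big_cat. Qed.

Lemma fsum_scale a u : fsum sigma f (fscale a u) = sigma a *: fsum sigma f u.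
Proof.
rewrite /fsum big_map scaler_sumr; apply: eq_bigr => x _ /=.
by rewrite rmorphM scalerA.
Qed.

Hypothesis f_rel : forall u, Rel u -> fsum sigma f u = 0.

Lemma fsum_eq u v : pres_eq Rel u v -> fsum sigma f u = fsum sigma f v.
Proof.
elim=> {u v} //.
- by move=> u v w _ -> _ ->.
- by move=> u u' v v' _ Eu _ Ev; rewrite !fsum_cat Eu Ev.
- by move=> u v; rewrite !fsum_cat addrC.
- by move=> a b g; rewrite /fsum !big_cons !big_nil /= !addr0 -scalerDl rmorphD.
- by move=> g; rewrite /fsum big_cons !big_nil /= rmorph0 scale0r addr0.
- by move=> a u v _ E; rewrite !fsum_scale E.
- by move=> u /f_rel ->; rewrite /fsum big_nil.
Qed.

Lemma pres_liftE g : pres_lift sigma f (pres_gen Rel g) = f g.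
Proof.
rewrite /pres_lift (fsum_eq (pres_repr _ _)).
by rewrite /fsum big_seq1 rmorph1 scale1r.
Qed.

Lemma pres_liftD p q :
  pres_lift sigma f (p + q : pres Rel) = pres_lift sigma f p + pres_lift sigma f q.
Proof. by rewrite {1}/pres_lift (fsum_eq (pres_repr _ _)) fsum_cat. Qed.

Lemma pres_liftZ a p :
  pres_lift sigma f (a *: p : pres Rel) = sigma a *: pres_lift sigma f p.
Proof. by rewrite {1}/pres_lift (fsum_eq (pres_repr _ _)) fsum_scale. Qed.

End PresLift.

Section ExteriorPower.
Variables (R : comPzRingType) (k : nat) (M : lmodType R).

Definition upd (v : 'I_k -> M) (i : 'I_k) (x : M) : 'I_k -> M :=
  fun j => if j == i then x else v j.

Inductive ext_rel : seq (R * {classic 'I_k -> M}) -> Prop :=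
| ext_linear (v : 'I_k -> M) i a x y :
    ext_rel [:: (1, upd v i (a *: x + y)); (- a, upd v i x); (- 1, upd v i y)]
| ext_alternate (v : 'I_k -> M) i j : i != j -> v i = v j -> ext_rel [:: (1, v)].

Definition ext := pres ext_rel.
HB.instance Definition _ := GRing.Lmodule.on ext.

Definition wedge (v : 'I_k -> M) : ext := pres_gen ext_rel v.

End ExteriorPower.

(* The k-th exterior power of a sigma-semilinear map f : M -> N; for sigma the
   identity of R this is the usual one of a linear map. *)
Definition ext_map (R R' : comPzRingType) (k : nat) (M : lmodType R)
    (N : lmodType R') (sigma : {rmorphism R -> R'}) (f : M -> N) :
    ext k M -> ext k N :=
  pres_lift sigma (fun v => wedge (f \o v)).

Lemma ext_map_rel (R R' : comPzRingType) (k : nat) (M : lmodType R)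
    (N : lmodType R') (sigma : {rmorphism R -> R'}) (f : M -> N) :
  (forall a x y, f (a *: x + y) = sigma a *: f x + f y) ->
  forall u, @ext_rel R k M u -> fsum sigma (fun v => wedge (f \o v)) u = 0.
Proof.
move=> flin u; have fE (b : R') (w : 'I_k -> N) :
    b *: wedge w = \pi_(pres (@ext_rel R' k N)) [:: (b, w : {classic _})].
  by rewrite -[LHS]/(pres_scal b _) pres_scalE /= mulr1.
have fupd v i z : f \o upd v i z = upd (f \o v) i (f z).
  by apply/funext => j; rewrite /upd /=; case: eqP.
case=> [v i a x y|v i j neq_ij eq_v]; rewrite /fsum !big_cons big_nil addr0 /=.
  rewrite !fE -[X in _ + X]/(pres_add _ _) pres_addE.
  rewrite -[LHS]/(pres_add _ _) pres_addE; apply/eqP/pres_eqP.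
  rewrite !fupd flin !rmorphN !rmorph1; apply: pres_rel; exact: ext_linear.
rewrite fE rmorph1; apply/eqP/pres_eqP; apply: pres_rel.
by apply: (ext_alternate neq_ij); rewrite /= eq_v.
Qed.

Lemma ext_map_wedge (R R' : comPzRingType) (k : nat) (M : lmodType R)
    (N : lmodType R') (sigma : {rmorphism R -> R'}) (f : M -> N) v :
  (forall a x y, f (a *: x + y) = sigma a *: f x + f y) ->
  ext_map sigma f (@wedge R k M v) = wedge (f \o v).
Proof. by move=> flin; apply: pres_liftE; exact: ext_map_rel. Qed.

Record opens (X : topologicalType) :=
  Opens { oset :> set X; oset_open : open oset }.

Definition full_open (X : topologicalType) : opens X := Opens (@openT X).

Definition preim_open (X Y : topologicalType) (f : X -> Y) (fC : continuous f)
    (U : opens Y) : opens X :=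
  Opens ((continuousP f).1 fC U (oset_open U)).

Record is_sheaf (X : topologicalType) (F : opens X -> Type)
    (res : forall U V : opens X, V `<=` U -> F U -> F V) : Prop := IsSheaf {
  sheaf_res_id : forall (U : opens X) (h : U `<=` U) s, res U U h s = s;
  sheaf_res_comp : forall (U V W : opens X) (hUV : V `<=` U) (hVW : W `<=` V)
      (hUW : W `<=` U) s,
    res V W hVW (res U V hUV s) = res U W hUW s;
  sheaf_separated : forall (U : opens X) (s t : F U),
    (forall x, oset U x -> exists (V : opens X) (h : V `<=` U),
       oset V x /\ res U V h s = res U V h t) -> s = t;
  sheaf_glue : forall (U : opens X) (I : Type) (V : I -> opens X)
      (h : forall i, V i `<=` U) (s : forall i, F (V i)),
    (forall x, oset U x -> exists i, oset (V i) x) ->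
    (forall i j (W : opens X) (hi : W `<=` V i) (hj : W `<=` V j),
       res (V i) W hi (s i) = res (V j) W hj (s j)) ->
    exists t : F U, forall i, res U (V i) (h i) t = s i }.

Record ring_sheaf (X : topologicalType) := RingSheaf {
  rsec :> opens X -> comPzRingType;
  rres : forall U V : opens X, V `<=` U -> {rmorphism rsec U -> rsec V};
  ring_sheafP : is_sheaf rres }.
Arguments rres {X} r {U V} h.

Record prime_ideal (A : comPzRingType) (p : set A) : Prop := PrimeIdeal {
  prime0 : p 0;
  primeD : forall a b, p a -> p b -> p (a + b);
  primeMl : forall a b, p b -> p (a * b);
  prime1 : ~ p 1;
  primeP : forall a b, p (a * b) -> p a \/ p b }.

Record Spec (A : comPzRingType) := MkSpec {
  spec_ideal :> set A; spec_prime : prime_ideal spec_ideal }.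

Definition basic_open (A : comPzRingType) (a : A) : set (Spec A) :=
  [set p | ~ spec_ideal p a].

Definition zariski_open (A : comPzRingType) (W : set (Spec A)) : Prop :=
  forall p, W p -> exists a, basic_open a p /\ basic_open a `<=` W.

Lemma zariski_openT (A : comPzRingType) : zariski_open [set: Spec A].
Proof. by move=> p _; exists 1; split => //; exact: prime1 (spec_prime p). Qed.

Lemma zariski_openI (A : comPzRingType) : setI_closed (@zariski_open A).
Proof.
move=> V W oV oW p [/oV[a [pa aV]] /oW[b [pb bW]]]; exists (a * b); split.
  by move/(primeP (spec_prime p)) => [].
move=> q qab; split; [apply: aV|apply: bW] => qI; apply: qab.
  by rewrite mulrC; exact: primeMl (spec_prime q) _ _ qI.
exact: primeMl (spec_prime q) _ _ qI.
Qed.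

Lemma zariski_open_bigU (A : comPzRingType) (I : Type) (f : I -> set (Spec A)) :
  (forall i, zariski_open (f i)) -> zariski_open (\bigcup_i f i).
Proof.
move=> of_ p [i _ /of_[a [pa aU]]]; exists a; split => // q /aU fq; by exists i.
Qed.

HB.instance Definition _ (A : comPzRingType) := gen_eqMixin (Spec A).
HB.instance Definition _ (A : comPzRingType) := gen_choiceMixin (Spec A).
HB.instance Definition _ (A : comPzRingType) := isOpenTopological.Build (Spec A)
  (@zariski_openT A) (@zariski_openI A) (@zariski_open_bigU A).

(* f exhibits B as the localization A[1/a]. *)
Record is_localization (A B : comPzRingType) (a : A) (f : A -> B) : Prop :=
  IsLocalization {
    loc_unit : exists b, f a * b = 1;
    loc_surj : forall b, exists n x, f (a ^+ n) * b = f x;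
    loc_ker : forall x, f x = 0 -> exists n, a ^+ n * x = 0 }.

(* (U, O|_U) is isomorphic to Spec A: a homeomorphism h from U to Spec A, and
   compatible identifications of O(h^-1 (D(a))) with A[1/a], the value of the
   structure sheaf of Spec A on the basic open set D(a). *)
Definition affine_open (X : topologicalType) (O : ring_sheaf X) (U : opens X) :=
  exists (A : comPzRingType) (h : {x : X | oset U x} -> Spec A)
         (theta : {rmorphism A -> O U}),
  [/\ bijective h,
      forall W : set (Spec A),
        open W <-> open [set x | exists ux : oset U x, W (h (exist _ x ux))] &
      forall (a : A) (V : opens X) (hV : V `<=` U),
        (forall x (ux : oset U x), oset V x <-> basic_open a (h (exist _ x ux))) ->
        is_localization a (fun b => rres O hV (theta b))].

Record scheme (k : fieldType) := Scheme {
  space :> topologicalType;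
  str : ring_sheaf space;
  scheme_affine : forall x : space, exists U : opens space, oset U x /\ affine_open str U;
  (* the structure morphism to Spec k *)
  scheme_over : {rmorphism k -> str (full_open space)} }.

Definition invertible_at (X : topologicalType) (O : ring_sheaf X) (U : opens X)
    (x : X) (a : O U) : Prop :=
  exists (V : opens X) (h : V `<=` U), oset V x /\ exists b, rres O h a * b = 1.

Lemma preim_sub (X Y : topologicalType) (f : X -> Y) (fC : continuous f)
  (U V : opens Y) : V `<=` U -> preim_open fC V `<=` preim_open fC U.
Proof. by move=> h x; exact: h. Qed.
Arguments preim_sub {X Y f} fC {U V} h.

Record smorphism (k : fieldType) (T S : scheme k) := SMorphism {
  smap :> T -> S;
  smap_cont : continuous smap;
  comap : forall U : opens S, {rmorphism str S U -> str T (preim_open smap_cont U)};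
  comap_res : forall (U V : opens S) (h : V `<=` U) a,
    comap V (rres (str S) h a) = rres (str T) (preim_sub smap_cont h) (comap U a);
  comap_local : forall (U : opens S) x (a : str S U), oset U (smap x) ->
    invertible_at x (comap U a) -> invertible_at (smap x) a;
  comap_over : forall c (h : preim_open smap_cont (full_open S) `<=` full_open T),
    comap (full_open S) (scheme_over S c) = rres (str T) h (scheme_over T c) }.
Arguments smap_cont {k T S} s.
Arguments comap {k T S} s U.

Record closed_immersion (k : fieldType) (D S : scheme k) (i : smorphism D S) : Prop :=
  ClosedImmersion {
    clim_inj : injective i;
    clim_closed : forall C : set D, closed C -> closed (i @` C);
    clim_epi : forall (U : opens S) (b : str D (preim_open (smap_cont i) U)) x, oset U x ->
      exists (V : opens S) (h : V `<=` U) (a : str S V), oset V x /\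
        comap i V a = rres (str D) (preim_sub (smap_cont i) h) b }.

Definition clim_ideal (k : fieldType) (D S : scheme k) (i : smorphism D S)
    (U : opens S) : set (str S U) := [set a | comap i U a = 0].

Definition effective_cartier (k : fieldType) (D S : scheme k) (i : smorphism D S) :=
  forall x : S, exists (U : opens S) (d : str S U), oset U x /\
    forall (V : opens S) (h : V `<=` U),
      (forall a, a * rres (str S) h d = 0 -> a = 0) /\
      forall b, clim_ideal i b <-> exists a, b = a * rres (str S) h d.

Record omodule (k : fieldType) (S : scheme k) := OModule {
  msec :> forall U : opens S, lmodType (str S U);
  mres : forall U V : opens S, V `<=` U -> {additive msec U -> msec V};
  mresZ : forall (U V : opens S) (h : V `<=` U) (a : str S U) (s : msec U),
    mres h (a *: s) = rres (str S) h a *: mres h s;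
  omodule_sheafP : is_sheaf mres }.
Arguments mres {k S} o {U V} h.

Record omor (k : fieldType) (S : scheme k) (E F : omodule S) := OMor {
  ofun :> forall U : opens S, {linear E U -> F U};
  ofun_res : forall (U V : opens S) (h : V `<=` U) s,
    ofun V (mres E h s) = mres F h (ofun U s) }.

Section Morphisms.
Variables (k : fieldType) (S : scheme k).
Implicit Types E F : omodule S.

Definition omono E F (f : omor E F) := forall U, injective (f U).

Definition in_image E F (f : omor E F) (U : opens S) (t : F U) :=
  forall x, oset U x -> exists (V : opens S) (h : V `<=` U) (s : E V),
    oset V x /\ f V s = mres F h t.

(* Epimorphism of sheaves: locally surjective. *)
Definition oepi E F (f : omor E F) := forall U (t : F U), in_image f t.

(* Exactness of E -> F -> C -> 0 in the category of sheaves of modules. *)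
Definition is_cokernel E F C (f : omor E F) (q : omor F C) :=
  oepi q /\ forall U (t : F U), q U t = 0 <-> in_image f t.

Definition oiso E F (f : omor E F) :=
  exists g : omor F E, (forall U, cancel (f U) (g U)) /\ (forall U, cancel (g U) (f U)).

(* An isomorphism from the restriction of O^n to U to that of E, given by the
   images e of the standard basis. *)
Definition frame E n (U : opens S) (e : 'I_n -> E U) :=
  forall (V : opens S) (h : V `<=` U) (s : E V),
    exists! a : 'rV[str S V]_n, s = \sum_i a 0 i *: mres E h (e i).

Definition locally_free n E :=
  forall x : S, exists (U : opens S) (e : 'I_n -> E U), oset U x /\ frame e.

Definition vector_bundle E := exists n, locally_free n E.

(* The map induced by f on the k-th exterior powers vanishes identically.  The
   exterior power of a sheaf F is the sheaf associated with the presheaf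
   U |-> ext k (F U), so that a section of the latter represents 0 when its
   restrictions to the members of an open covering are 0. *)
Definition ext_zero m E F (f : omor E F) :=
  forall (U : opens S) (t : ext m (E U)) x, oset U x ->
    exists (V : opens S) (h : V `<=` U), oset V x /\
      ext_map (rres (str S) h) (mres F h)
        (ext_map (@idfun (str S U) : {rmorphism _ -> _}) (f U) t) = 0.

Definition has_rank E F (f : omor E F) r :=
  ext_zero r.+1 f /\ forall q, (q < r)%N -> ~ ext_zero q.+1 f.

Definition matrix_of E F (f : omor E F) (U : opens S) m n
    (e : 'I_n -> E U) (e' : 'I_m -> F U) (A : 'M[str S U]_(m, n)) :=
  forall j, f U (e j) = \sum_i A i j *: e' i.

(* The ideal sheaf locally generated by the r x r minors of f. *)
Definition minors_ideal E F (f : omor E F) r (U : opens S) : set (str S U) :=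
  [set a | forall x, oset U x ->
    exists (V : opens S) (h : V `<=` U) m n (e : 'I_n -> E V) (e' : 'I_m -> F V)
           (A : 'M[str S V]_(m, n)),
      [/\ oset V x, frame e, frame e', matrix_of f e e' A &
        exists c : ('I_r -> 'I_m) -> ('I_r -> 'I_n) -> str S V,
          rres (str S) h a =
          \sum_(g : {ffun 'I_r -> 'I_m}) \sum_(g' : {ffun 'I_r -> 'I_n})
            c g g' * \det (mxsub g g' A)]].

Definition degeneration_scheme E F (f : omor E F) r (D : scheme k)
    (i : smorphism D S) :=
  closed_immersion i /\ forall U, @clim_ideal k D S i U = @minors_ideal E F f r U.

End Morphisms.

(* A morphism from the spectrum of an algebraically closed field gfield to S,
   with image gpt; geval is evaluation of functions defined near gpt. *)
Record geometric_point (k : fieldType) (S : scheme k) := GeometricPoint {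
  gfield : closedFieldType;
  gpt : S;
  geval : forall U : opens S, oset U gpt -> {rmorphism str S U -> gfield};
  geval_res : forall (U V : opens S) (h : V `<=` U) (xU : oset U gpt) (xV : oset V gpt) a,
    geval xV (rres (str S) h a) = geval xU a;
  geval_local : forall (U : opens S) (xU : oset U gpt) (a : str S U),
    geval xU a != 0 -> invertible_at gpt a }.

Section Fiber.
Variables (k : fieldType) (S : scheme k) (E : omodule S) (s : geometric_point S).

Record germ := Germ { gopen : opens S; gmem : oset gopen (gpt s); gsec : E gopen }.

(* The fiber: the tensor product over the local ring of S at gpt s of the stalk
   of E and the field of s, generated by the germs of sections of E. *)
Inductive fiber_rel : seq (gfield s * {classic germ}) -> Prop :=
| fiber_linear U (xU : oset U (gpt s)) a (t u : E U) :
    fiber_rel [:: (1, Germ xU (a *: t + u)); (- geval xU a, Germ xU t);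
                  (- 1, Germ xU u)]
| fiber_germ (U V : opens S) (h : V `<=` U) (xU : oset U (gpt s)) (xV : oset V (gpt s)) t :
    fiber_rel [:: (1, Germ xV (mres E h t)); (- 1, Germ xU t)].

Definition fiber := pres fiber_rel.
HB.instance Definition _ := GRing.Lmodule.on fiber.

Definition fiber_value (t : germ) : fiber := pres_gen fiber_rel t.

End Fiber.

Definition fiber_map (k : fieldType) (S : scheme k) (E F : omodule S)
    (f : omor E F) (s : geometric_point S) : fiber E s -> fiber F s :=
  pres_lift (@idfun (gfield s) : {rmorphism _ -> _})
    (fun t : germ E s => fiber_value (Germ (gmem t) (f _ (gsec t)))).
Arguments fiber_map {k S E F} f s p.

Lemma fiber_map_value (k : fieldType) (S : scheme k) (E F : omodule S)
    (f : omor E F) (s : geometric_point S) (t : germ E s) :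
  fiber_map f s (fiber_value t) = fiber_value (Germ (gmem t) (f _ (gsec t))).
Proof.
have gE (b : gfield s) (g : germ F s) :
    b *: fiber_value g = \pi_(pres (@fiber_rel k S F s)) [:: (b, g : {classic _})].
  by rewrite -[LHS]/(pres_scal b _) pres_scalE /= mulr1.
apply: pres_liftE => u [U xU a v w|U V h xU xV v]; rewrite /fsum !big_cons big_nil addr0 /=.
  rewrite !gE -[X in _ + X]/(pres_add _ _) pres_addE.
  rewrite -[LHS]/(pres_add _ _) pres_addE; apply/eqP/pres_eqP.
  rewrite linearP; apply: pres_rel; exact: fiber_linear.
rewrite !gE -[LHS]/(pres_add _ _) pres_addE; apply/eqP/pres_eqP.
rewrite ofun_res; apply: pres_rel; exact: fiber_germ.
Qed.

Definition fiberwise_mono (k : fieldType) (S : scheme k) (E F : omodule S)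
    (f : omor E F) := forall s : geometric_point S, injective (fiber_map f s).

Definition fiber_ext_zero (k : fieldType) (S : scheme k) (E F : omodule S) m
    (f : omor E F) (s : geometric_point S) :=
  forall t : ext m (fiber E s),
    ext_map (@idfun (gfield s) : {rmorphism _ -> _}) (fiber_map f s) t = 0.

Definition restr_scalars (R R' : comPzRingType) (sigma : {rmorphism R -> R'})
  (M : lmodType R') : Type := M.

Section RestrictionOfScalars.
Variables (R R' : comPzRingType) (sigma : {rmorphism R -> R'}) (M : lmodType R').
HB.instance Definition _ := GRing.Zmodule.copy (restr_scalars sigma M) M.

Definition restr_scale (a : R) (v : restr_scalars sigma M) : restr_scalars sigma M :=
  sigma a *: (v : M).

Fact restr_scaleA a b v : restr_scale a (restr_scale b v) = restr_scale (a * b) v.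
Proof. by rewrite /restr_scale rmorphM scalerA. Qed.
Fact restr_scale1 : left_id 1 restr_scale.
Proof. by move=> v; rewrite /restr_scale rmorph1 scale1r. Qed.
Fact restr_scaleDr : right_distributive restr_scale +%R.
Proof. by move=> a u v; rewrite /restr_scale scalerDr. Qed.
Fact restr_scaleDl v : {morph restr_scale^~ v : a b / a + b}.
Proof. by move=> a b; rewrite /restr_scale rmorphD scalerDl. Qed.

HB.instance Definition _ := GRing.Zmodule_isLmodule.Build R (restr_scalars sigma M)
  restr_scaleA restr_scale1 restr_scaleDr restr_scaleDl.
End RestrictionOfScalars.

Section Pushforward.
Variables (k : fieldType) (T S : scheme k) (i : smorphism T S) (L : omodule T).

Definition push_sec (U : opens S) : lmodType (str S U) :=
  restr_scalars (comap i U) (L (preim_open (smap_cont i) U)).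

Definition push_res (U V : opens S) (h : V `<=` U) : {additive push_sec U -> push_sec V} :=
  mres L (preim_sub (smap_cont i) h).

Lemma push_resZ (U V : opens S) (h : V `<=` U) (a : str S U) (s : push_sec U) :
  push_res h (a *: s) = rres (str S) h a *: push_res h s.
Proof.
rewrite -[RHS]/(comap i V (rres (str S) h a) *: mres L _ (s : L _)) comap_res.
exact: mresZ.
Qed.

Lemma push_sheafP : is_sheaf push_res.
Proof.
have LP := omodule_sheafP L; split.
- by move=> U h s; exact: (sheaf_res_id LP).
- by move=> U V W hUV hVW hUW s; exact: (sheaf_res_comp LP).
- move=> U s t st; apply: (sheaf_separated LP) => y /st[V [h [Vy e]]].
  by exists (preim_open (smap_cont i) V), (preim_sub (smap_cont i) h).
- move=> U I V h s cov compat.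
  apply: (sheaf_glue LP (fun j => preim_sub (smap_cont i) (h j)) (s := s)).
    by move=> y /cov.
  move=> j l W hj hl.
  pose VV := Opens (openI (oset_open (V j)) (oset_open (V l))).
  have hWV : W `<=` preim_open (smap_cont i) VV by move=> y Wy; split; [exact: hj|exact: hl].
  have hVj : VV `<=` V j by move=> y [].
  have hVl : VV `<=` V l by move=> y [].
  rewrite -(sheaf_res_comp LP (preim_sub (smap_cont i) hVj) hWV hj).
  rewrite -(sheaf_res_comp LP (preim_sub (smap_cont i) hVl) hWV hl).
  by congr (mres L hWV _); exact: compat.
Qed.

Definition pushforward : omodule S := OModule push_resZ push_sheafP.
End Pushforward.

Definition line_bundle_on (k : fieldType) (S D : scheme k) (i : smorphism D S)
    (C : omodule S) :=
  exists L : omodule D, locally_free 1 L /\ exists f : omor C (pushforward i L), oiso f.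

Record factorization (k : fieldType) (S D : scheme k) (E F : omodule S)
    (phi : omor E F) (r : nat) (i : smorphism D S) := Factorization {
  fac_E1 : omodule S;
  fac_F1 : omodule S;
  fac_proj : omor E fac_E1;
  fac_mid : omor fac_E1 fac_F1;
  fac_incl : omor fac_F1 F;
  fac_comp : forall (U : opens S) (s : E U),
    phi U s = fac_incl U (fac_mid U (fac_proj U s));
  fac_E1_free : locally_free r fac_E1;
  fac_F1_free : locally_free r fac_F1;
  fac_proj_epi : oepi fac_proj;
  fac_incl_mono : fiberwise_mono fac_incl;
  fac_mid_mono : omono fac_mid;
  fac_coker : exists (C : omodule S) (q : omor fac_F1 C),
    is_cokernel fac_mid q /\ line_bundle_on i C }.

Record fac_iso (k : fieldType) (S D : scheme k) (E F : omodule S)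
    (phi : omor E F) (r : nat) (i : smorphism D S)
    (X Y : factorization phi r i)
    (alpha : omor (fac_E1 X) (fac_E1 Y)) (beta : omor (fac_F1 X) (fac_F1 Y)) : Prop :=
  FacIso {
    fac_iso_E1 : oiso alpha;
    fac_iso_F1 : oiso beta;
    fac_iso_proj : forall U s, alpha U (fac_proj X U s) = fac_proj Y U s;
    fac_iso_mid : forall U s, beta U (fac_mid X U s) = fac_mid Y U (alpha U s);
    fac_iso_incl : forall U s, fac_incl Y U (beta U s) = fac_incl X U s }.

Definition fac_uniquely_iso (k : fieldType) (S D : scheme k) (E F : omodule S)
    (phi : omor E F) (r : nat) (i : smorphism D S)
    (X Y : factorization phi r i) :=
  exists alpha beta, fac_iso alpha beta /\
    forall (alpha' : omor (fac_E1 X) (fac_E1 Y)) (beta' : omor (fac_F1 X) (fac_F1 Y)),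
      fac_iso alpha' beta' ->
      (forall U, alpha' U =1 alpha U) /\ (forall U, beta' U =1 beta U).

(* Main.v *)
From HB Require Import structures.
Require Import Defs.
From mathcomp Require Import all_boot all_algebra.
From mathcomp Require Import perm closed_field.
From mathcomp Require Import boolp classical_sets topology.

(** Near a point x of S, row and column operations bring phi to a simple form. Some
   minor of phi of size r - 1 is invertible at x, since the exterior power of order
   r - 1 does not vanish at a geometric point over x; it splits off an identity block.
   The entries of the complementary block are minors of size r up to sign, so they lie
   in the ideal of D, which is generated by a regular function d: the block is d b for
   some matrix b. An entry of b is invertible at x, for otherwise all the minors of size
   r would lie in d times the maximal ideal at x. Pivoting on that entry leaves a block
   whose products with d are minors of size r + 1; these vanish, and d is regular, so the
   block is zero. Hence F has a frame f near x such that f_1, ..., f_(r-1) and d f_r span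
   the image of phi; this is [normal_form_exists].

   Let E_1 be the image sheaf of phi and let F_1 be the sheaf of the sections of F that
   the ideal of D multiplies into E_1. In the frame above they are spanned by
   f_1, ..., f_(r-1), d f_r and by f_1, ..., f_r. So they are locally free of rank r, the
   inclusion of F_1 into F is injective on fibers, and the class of f_r identifies
   F_1 / E_1 with the structure sheaf of D locally; [cokernel_line_bundle] constructs the
   line bundle on D that this gives.

   Conversely, consider any factorization through E_1' and F_1'. As E maps onto E_1', the
   image of E_1' in F is that of phi ([fac_in_image]). As the ideal of D kills the
   cokernel of E_1' in F_1', the image of F_1' lies in F_1. It is all of F_1 because a
   fiberwise monomorphism is locally the inclusion of a direct summand
   ([fiberwise_mono_frames]), so that a section of F which d multiplies into F_1' belongs
   to F_1' ([fac_in_saturated_image]). The two factorizations thus have the same images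
   in F, and the comparison isomorphisms exist and are unique because their terms embed
   into F ([omono_lift]).

   Conditions at geometric points say something at every point of S only if there is a
   geometric point over each of them. [geometric_point_exists] provides it: the functions
   that are not invertible at x form an ideal, and a ring with a proper ideal has a
   morphism to an algebraically closed field that kills the ideal
   ([ideal_to_closed_field]). *)

Set Implicit Arguments.
Unset Strict Implicit.
Unset Printing Implicit Defensive.
Import GRing.Theory.
Local Open Scope classical_set_scope.
Local Open Scope ring_scope.
Local Open Scope quotient_scope.

(** * Quotient fields *)

Section ProductRing.
Variables (I : Type) (T : I -> comPzRingType).

Definition prod_ring := forall i, T i.
HB.instance Definition _ := gen_eqMixin prod_ring.
HB.instance Definition _ := gen_choiceMixin prod_ring.

Implicit Types f g h : prod_ring.
Let add f g : prod_ring := fun i => f i + g i.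
Let opp f : prod_ring := fun i => - f i.
Let mul f g : prod_ring := fun i => f i * g i.
Let zero : prod_ring := fun i => 0.
Let one : prod_ring := fun i => 1.

Fact prod_addA : associative add.
Proof. by move=> f g h; apply: functional_extensionality_dep => i; exact: addrA. Qed.
Fact prod_addC : commutative add.
Proof. by move=> f g; apply: functional_extensionality_dep => i; exact: addrC. Qed.
Fact prod_add0 : left_id zero add.
Proof. by move=> f; apply: functional_extensionality_dep => i; exact: add0r. Qed.
Fact prod_addN : left_inverse zero opp add.
Proof. by move=> f; apply: functional_extensionality_dep => i; exact: addNr. Qed.
HB.instance Definition _ :=
  GRing.isZmodule.Build prod_ring prod_addA prod_addC prod_add0 prod_addN.

Fact prod_mulA : associative mul.
Proof. by move=> f g h; apply: functional_extensionality_dep => i; exact: mulrA. Qed.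
Fact prod_mulC : commutative mul.
Proof. by move=> f g; apply: functional_extensionality_dep => i; exact: mulrC. Qed.
Fact prod_mul1 : left_id one mul.
Proof. by move=> f; apply: functional_extensionality_dep => i; exact: mul1r. Qed.
Fact prod_mulDl : left_distributive mul add.
Proof. by move=> f g h; apply: functional_extensionality_dep => i; exact: mulrDl. Qed.
HB.instance Definition _ := GRing.Zmodule_isComPzRing.Build prod_ring
  prod_mulA prod_mulC prod_mul1 prod_mulDl.

End ProductRing.

Record ideal (R : comPzRingType) (J : set R) : Prop := Ideal {
  ideal0 : J 0;
  idealD : forall a b, J a -> J b -> J (a + b);
  idealMl : forall a b, J b -> J (a * b) }.

Record proper_ideal (R : comPzRingType) (J : set R) : Prop := ProperIdeal {
  proper_ideal_ideal :> ideal J;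
  ideal1 : ~ J 1 }.

(** Invertibility modulo M outside M is the form of maximality that makes the
   quotient a field. *)
Definition maximal_ideal (R : comPzRingType) (M : set R) :=
  proper_ideal M /\ forall a, ~ M a -> exists b, M (a * b - 1).

Lemma maximal_ideal_exists (R : comPzRingType) (J : set R) :
  proper_ideal J -> exists2 M, maximal_ideal M & J `<=` M.
Proof.
move=> hJ.
(* Sets whose union with J is a proper ideal: the empty chain has union set0. *)
pose P := [set A : set R | proper_ideal (A `|` J)].
have [F FP' Ftot|A [PA' Amax]] := @Zorn_bigcup _ P.
  have FP A : F A -> proper_ideal (A `|` J) := FP' A.
  have [->|/set0P[A0 FA0]] := eqVneq F set0.
    by rewrite /P /= bigcup_set0 set0U.
  have up x : ((\bigcup_(X in F) X) `|` J) x -> exists2 A, F A & (A `|` J) x.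
    by case=> [[A FA Ax]|Jx]; [exists A => //; left|exists A0 => //; right].
  have down A x : F A -> (A `|` J) x -> ((\bigcup_(X in F) X) `|` J) x.
    by move=> FA [Ax|Jx]; [left; exists A|right].
  split; first split.
  - by right; exact: ideal0 hJ.
  - move=> a b /up[A FA Aa] /up[B FB Bb].
    have [AB|BA] := Ftot _ _ FA FB.
      by apply: (down B) => //; apply: (idealD (FP _ FB)) => //; move: Aa; apply: setSU.
    by apply: (down A) => //; apply: (idealD (FP _ FA)) => //; move: Bb; apply: setSU.
  - by move=> a b /up[A FA Aa]; apply: (down A) => //; apply: (idealMl (FP _ FA)).
  - by move=> /up[A FA]; exact: (ideal1 (FP _ FA)).
have PA : proper_ideal (A `|` J) := PA'.
have PE (B : set R) : proper_ideal B -> A `|` J `<=` B -> B `<=` A.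
  move=> hB AJB; have AB : A `<=` B by move=> y Ay; apply: AJB; left.
  have JB : J `<=` B by move=> y Jy; apply: AJB; right.
  have PB : P B by rewrite /P /= (setUidl JB).
  by apply: contrapT => nBA; exact: (Amax B).
exists (A `|` J); last by move=> x; right.
split=> // a nMa.
(* The ideal generated by A and a cannot be proper. *)
pose B := [set x | exists y z, (A `|` J) y /\ x = y + a * z].
have AJB : A `|` J `<=` B by move=> x hx; exists x, 0; rewrite mulr0 addr0.
have nB : ~ proper_ideal B.
  move=> hB; case: nMa; left; apply: (PE B hB AJB).
  by exists 0, 1; split; [exact: ideal0 PA|rewrite mulr1 add0r].
have B1 : B 1.
  apply: contrapT => nB1; apply: nB; split => //; split.
  - by apply: AJB; exact: ideal0 PA.
  - move=> _ _ [y [z [Ay ->]]] [y' [z' [Ay' ->]]]; exists (y + y'), (z + z').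
    by split; [exact: idealD PA _ _ Ay Ay'|rewrite mulrDr addrACA].
  - move=> c _ [y [z [Ay ->]]]; exists (c * y), (c * z).
    by split; [exact: idealMl PA _ _ Ay|rewrite mulrDr mulrCA].
have [y [z [Ay e]]] := B1; exists z.
have -> : a * z - 1 = (-1) * y by rewrite [X in _ - X]e opprD addrCA subrr addr0 mulN1r.
exact: idealMl PA _ _ Ay.
Qed.

Section QuotientField.
Variables (R : comPzRingType) (M : set R) (hM : maximal_ideal M).

Definition mod_eq : rel R := fun a b => `[< M (a - b) >].

Fact mod_eq_refl : reflexive mod_eq.
Proof. by move=> a; apply/asboolP; rewrite subrr; exact: ideal0 hM.1. Qed.
Fact mod_eq_sym : symmetric mod_eq.
Proof.
have H a b : M (a - b) -> M (b - a).
  by move=> h; rewrite -opprB -mulN1r; exact: idealMl hM.1 _ _ h.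
by move=> a b; apply/asboolP/asboolP; exact: H.
Qed.
Fact mod_eq_trans : transitive mod_eq.
Proof.
move=> b a c /asboolP ab /asboolP bc; apply/asboolP.
by rewrite -(subrKA b); exact: idealD hM.1 _ _ ab bc.
Qed.

Canonical mod_equiv := EquivRel mod_eq mod_eq_refl mod_eq_sym mod_eq_trans.
Definition quotient_field := {eq_quot mod_equiv}.
HB.instance Definition _ := Choice.on quotient_field.
HB.instance Definition _ := EqQuotient.on quotient_field.

Notation pi := (\pi_quotient_field).

Lemma quotient_eqP a b : reflect (M (a - b)) (pi a == pi b).
Proof. by rewrite piE; exact: asboolP. Qed.

Lemma quotient_repr a : M (repr (pi a) - a).
Proof. by apply/quotient_eqP; rewrite reprK. Qed.

Lemma quotient_surj p : exists a, p = pi a.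
Proof. by exists (repr p); rewrite reprK. Qed.

Let add (p q : quotient_field) := pi (repr p + repr q).
Let opp (p : quotient_field) := pi (- repr p).
Let mul (p q : quotient_field) := pi (repr p * repr q).

Let addE a b : add (pi a) (pi b) = pi (a + b).
Proof.
apply/eqP/quotient_eqP; rewrite opprD addrACA.
by apply: idealD hM.1 _ _ _ _; exact: quotient_repr.
Qed.
Let oppE a : opp (pi a) = pi (- a).
Proof.
apply/eqP/quotient_eqP; rewrite -opprD -mulN1r.
by apply: idealMl hM.1 _ _ _; exact: quotient_repr.
Qed.
Let mulE a b : mul (pi a) (pi b) = pi (a * b).
Proof.
apply/eqP/quotient_eqP.
rewrite -(subrKA (a * repr (pi b))) -mulrBl -mulrBr mulrC.
by apply: idealD hM.1 _ _ _ _; apply: idealMl hM.1 _ _ _; exact: quotient_repr.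
Qed.

Fact quotient_addA : associative add.
Proof. by move=> p q t; have [a ->] := quotient_surj p; have [b ->] := quotient_surj q;
have [c ->] := quotient_surj t; rewrite !addE addrA. Qed.
Fact quotient_addC : commutative add.
Proof.
by move=> p q; have [a ->] := quotient_surj p; have [b ->] := quotient_surj q;
  rewrite !addE addrC.
Qed.
Fact quotient_add0 : left_id (pi 0) add.
Proof. by move=> p; have [a ->] := quotient_surj p; rewrite addE add0r. Qed.
Fact quotient_addN : left_inverse (pi 0) opp add.
Proof. by move=> p; have [a ->] := quotient_surj p; rewrite oppE addE addNr. Qed.
HB.instance Definition _ := GRing.isZmodule.Build quotient_field
  quotient_addA quotient_addC quotient_add0 quotient_addN.

Fact quotient_mulA : associative mul.
Proof. by move=> p q t; have [a ->] := quotient_surj p; have [b ->] := quotient_surj q;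
have [c ->] := quotient_surj t; rewrite !mulE mulrA. Qed.
Fact quotient_mulC : commutative mul.
Proof.
by move=> p q; have [a ->] := quotient_surj p; have [b ->] := quotient_surj q;
  rewrite !mulE mulrC.
Qed.
Fact quotient_mul1 : left_id (pi 1) mul.
Proof. by move=> p; have [a ->] := quotient_surj p; rewrite mulE mul1r. Qed.
Fact quotient_mulDl : left_distributive mul add.
Proof.
by move=> p q t; have [a ->] := quotient_surj p; have [b ->] := quotient_surj q;
have [c ->] := quotient_surj t; rewrite !(mulE, addE) mulrDl.
Qed.
Fact quotient_1neq0 : pi 1 != pi 0.
Proof. by apply/negP => /quotient_eqP; rewrite subr0; exact: ideal1 hM.1. Qed.
HB.instance Definition _ := GRing.Zmodule_isComNzRing.Build quotient_field
  quotient_mulA quotient_mulC quotient_mul1 quotient_mulDl quotient_1neq0.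

Lemma quotient_eq0 a : pi a = 0 <-> M a.
Proof.
rewrite -[0]/(pi 0); split=> [/eqP/quotient_eqP|Ma]; first by rewrite subr0.
by apply/eqP/quotient_eqP; rewrite subr0.
Qed.

Fact quotient_inv_exists (p : quotient_field) :
  exists q, (p != 0 -> q * p = 1) /\ (p = 0 -> q = 0).
Proof.
have [a ->] := quotient_surj p; have [Ma|/hM.2[b ab]] := pselect (M a).
  by rewrite (quotient_eq0 a).2 //; exists 0; rewrite eqxx.
exists (pi b); split=> [_|/quotient_eq0 Ma].
  by rewrite -[LHS]/(mul _ _) mulE; apply/eqP/quotient_eqP; rewrite mulrC.
case: (ideal1 hM.1).
have -> : 1 = b * a + (-1) * (a * b - 1) by rewrite mulN1r opprB mulrC addrC subrK.
by apply: idealD hM.1 _ _ _ _; apply: idealMl hM.1 _ _ _.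
Qed.

Let inv p := sval (cid (quotient_inv_exists p)).
Fact quotient_mulV (p : quotient_field) : p != 0 -> inv p * p = 1.
Proof. exact: (svalP (cid (quotient_inv_exists p))).1. Qed.
Fact quotient_inv0 : inv 0 = 0.
Proof. exact: (svalP (cid (quotient_inv_exists 0))).2. Qed.
HB.instance Definition _ :=
  GRing.ComNzRing_isField.Build quotient_field quotient_mulV quotient_inv0.

Definition to_quotient (a : R) : quotient_field := pi a.
Fact to_quotient_zmod : zmod_morphism to_quotient.
Proof. by move=> a b; rewrite -[RHS]/(add _ (opp _)) oppE addE. Qed.
Fact to_quotient_monoid : monoid_morphism to_quotient.
Proof. by split=> // a b; rewrite -[RHS]/(mul _ _) mulE. Qed.
HB.instance Definition _ :=
  GRing.isZmodMorphism.Build R quotient_field to_quotient to_quotient_zmod.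
HB.instance Definition _ :=
  GRing.isMonoidMorphism.Build R quotient_field to_quotient to_quotient_monoid.

End QuotientField.

Lemma ideal_to_field (R : comPzRingType) (J : set R) : proper_ideal J ->
  exists (K : fieldType) (f : {rmorphism R -> K}), forall a, J a -> f a = 0.
Proof.
move=> /maximal_ideal_exists[M hM JM].
exists (quotient_field hM), (to_quotient hM) => a /JM Ma.
exact/quotient_eq0.
Qed.

(** * Algebraically closed extensions *)

(** The quotient of K[X] by a maximal ideal that contains p, with the class of X as
   the root. *)
Lemma root_extension (K : fieldType) (p : {poly K}) : (1 < size p)%N ->
  exists (L : fieldType) (f : {rmorphism K -> L}) x, root (map_poly f p) x.
Proof.
move=> p_gt1; pose J := [set q | p %| q].
have [|L [g gJ]] := @ideal_to_field _ J.
  split=> [|/=]; first split=> [|a b|a b] /=; [exact: dvdp0|exact: dvdp_add|exact: dvdp_mull|].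
  by rewrite /J /= dvdp1 gtn_eqF.
exists L, (g \o polyC), (g 'X).
rewrite /root map_poly_comp horner_map /= [_.['X]]comp_polyXr.
by rewrite gJ /J //=.
Qed.

Lemma splitting_extension (K : fieldType) (p : {poly K}) : p != 0 ->
  exists (L : fieldType) (f : {rmorphism K -> L}) (rs : seq L),
    map_poly f p %= \prod_(z <- rs) ('X - z%:P).
Proof.
move: {2}(size p) (leqnn (size p)) => n.
elim: n K p => [|n IH] K p; first by rewrite leqn0 size_poly_eq0 => ->.
move=> le_pn nz_p; have [p_le1|p_gt1] := leqP (size p) 1.
  exists K, idfun, [::]; rewrite big_nil map_poly_id // -size_poly_eq1 eqn_leq p_le1.
  by rewrite size_poly_gt0.
have [L [f [x /factor_theorem[q Dp]]]] := root_extension p_gt1.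
have nz_q : q != 0.
  by apply: contraNneq nz_p => q0; rewrite -(map_poly_eq0 f) Dp q0 mul0r.
have [|//|L' [g [rs eq_q]]] := IH L q.
  by rewrite -ltnS (leq_trans _ le_pn) // -(size_map_poly f) Dp size_Mmonic ?monicXsubC //
    size_XsubC addn2.
exists L', (g \o f), (g x :: rs).
rewrite map_poly_comp Dp rmorphM /= map_polyXsubC big_cons mulrC.
exact: eqp_mull.
Qed.

Lemma map_poly_split_diff (K R L : comNzRingType) (rho : {rmorphism K -> R})
    (f : {rmorphism R -> L}) (p : {poly K}) c n (r : nat -> R) :
  map_poly f (map_poly rho p - rho c *: \prod_(i < n) ('X - (r i)%:P)) =
  map_poly (f \o rho) p - f (rho c) *: \prod_(i < n) ('X - (f (r i))%:P).
Proof.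
rewrite rmorphB /= -map_poly_comp map_polyZ rmorph_prod /=.
by congr (_ - _ *: _); apply: eq_bigr => i _; rewrite map_polyXsubC.
Qed.

(** In the product of splitting fields of all the nonzero q, a given p splits in
   every factor whose index is a multiple of p. The families that vanish at all the
   multiples of some nonzero polynomial form a proper ideal, so the splitting of p
   persists in a quotient field of the product. *)
Lemma common_splitting_extension (K : fieldType) :
  exists (L : fieldType) (f : {rmorphism K -> L}), forall p : {poly K}, p != 0 ->
    exists rs : seq L, map_poly f p %= \prod_(z <- rs) ('X - z%:P).
Proof.
have spl (q : {poly K}) : exists (L : fieldType) (f : {rmorphism K -> L}),
    q != 0 -> exists rs : seq L, map_poly f q %= \prod_(z <- rs) ('X - z%:P).
  have [->|nz] := eqVneq q 0; first by exists K, idfun.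
  by have [L [f h]] := splitting_extension nz; exists L, f.
pose Lq q : fieldType := sval (cid (spl q)).
pose fq q : {rmorphism K -> Lq q} := sval (cid (svalP (cid (spl q)))).
have fqP q : q != 0 -> exists rs : seq (Lq q),
    map_poly (fq q) q %= \prod_(z <- rs) ('X - z%:P).
  exact: svalP (cid (svalP (cid (spl q)))).
pose R0 := prod_ring Lq.
have R0nz : (1 : R0) != 0.
  by apply/eqP => /(congr1 (fun f : R0 => f 0))/eqP; rewrite oner_eq0.
pose R : comNzRingType := HB.pack R0 (GRing.PzSemiRing_isNonZero.Build R0 R0nz).
pose ev q (f : R) : Lq q := f q.
have evB q : zmod_morphism (ev q) by [].
have evM q : monoid_morphism (ev q) by [].
pose evm q : {rmorphism R -> Lq q} := HB.pack (ev q)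
   (GRing.isZmodMorphism.Build R (Lq q) (ev q) (evB q))
   (GRing.isMonoidMorphism.Build R (Lq q) (ev q) (evM q)).
pose rho (a : K) : R := fun q => fq q a.
have rhoB : zmod_morphism rho.
  by move=> a b; apply: functional_extensionality_dep => q; exact: rmorphB.
have rhoM : monoid_morphism rho.
  split; first by apply: functional_extensionality_dep => q; exact: rmorph1.
  by move=> a b; apply: functional_extensionality_dep => q; exact: rmorphM.
pose rhom : {rmorphism K -> R} := HB.pack rho
   (GRing.isZmodMorphism.Build K R rho rhoB)
   (GRing.isMonoidMorphism.Build K R rho rhoM).
pose J := [set f : R | exists2 p : {poly K}, p != 0 &
  forall q, q != 0 -> p %| q -> ev q f = 0].
have [|L [g gJ]] := @ideal_to_field R J.
  split; first split.
  - by exists 1; rewrite ?oner_neq0.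
  - move=> a b [p nzp pa] [p' nzp' p'b]; exists (p * p'); first by rewrite mulf_neq0.
    move=> q nzq dv; rewrite -[LHS]/(ev q a + ev q b).
    rewrite pa ?p'b ?addr0 //; apply: dvdp_trans dv; [exact: dvdp_mulIr|exact: dvdp_mulIl].
  - move=> a b [p nzp pb]; exists p => // q nzq dv.
    by rewrite -[LHS]/(ev q a * ev q b) pb ?mulr0.
  - by case=> p nzp /(_ p nzp (dvdpp p))/eqP; rewrite oner_eq0.
exists L, (g \o rhom) => p nzp.
have rsq q : exists s : seq (Lq q), q != 0 -> p %| q ->
    map_poly (fq q) p = fq q (lead_coef p) *: \prod_(i < (size p).-1) ('X - (s`_i)%:P).
  have [[nzq dv]|nh] := pselect (q != 0 /\ p %| q); last first.
    by exists [::] => nzq dv; case: nh.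
  have [rs eq_rs] := fqP q nzq.
  have : map_poly (fq q) p %| \prod_(z <- rs) ('X - z%:P).
    by rewrite -(eqp_dvdr _ eq_rs) dvdp_map.
  move/dvdp_prod_XsubC => [m]; set t := mask m rs => /eqpP[[a b] /andP[/= nza nzb] E].
  have mon : \prod_(z <- t) ('X - z%:P) \is monic by rewrite monic_prod_XsubC.
  have sz : size t = (size p).-1.
    have := congr1 (fun p : {poly _} => size p) E.
    by rewrite !size_scale // size_map_poly size_prod_XsubC => ->.
  have lc : a * fq q (lead_coef p) = b.
    have := congr1 lead_coef E.
    by rewrite !lead_coefZ lead_coef_map (monicP mon) mulr1.
  exists t => _ _; rewrite -sz.
  have -> : \prod_(i < size t) ('X - (t`_i)%:P) = \prod_(z <- t) ('X - z%:P).
    by rewrite (big_nth 0) big_mkord.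
  by apply: (scalerI nza); rewrite E scalerA lc.
pose r (i : nat) : R := fun q => (sval (cid (rsq q)))`_i.
exists [seq g (r (i : nat)) | i <- index_iota 0 (size p).-1].
pose P := map_poly rhom p - rhom (lead_coef p) *: \prod_(i < (size p).-1) ('X - (r i)%:P).
have P0 : map_poly g P = 0.
  apply/polyP=> j; rewrite coef_map coef0; apply: gJ; exists p => // q nzq dv.
  rewrite -[ev q _]/(evm q _) -coef_map.
  suff -> : map_poly (evm q) P = 0 by rewrite coef0.
  apply/eqP; rewrite (map_poly_split_diff rhom (evm q)) subr_eq0; apply/eqP.
  exact: svalP (cid (rsq q)) nzq dv.
move/eqP: P0; rewrite (map_poly_split_diff rhom g) subr_eq0 => /eqP ->.
rewrite big_map big_mkord.
by apply: eqp_scale; rewrite (fmorph_eq0 (g \o rhom)) lead_coef_eq0.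
Qed.

Section AlgebraicElements.
Variables (K L : fieldType) (f : {rmorphism K -> L}).
Hypothesis f_split : forall p : {poly K}, p != 0 ->
  exists rs : seq L, map_poly f p %= \prod_(z <- rs) ('X - z%:P).

Definition algebraic_mem : {pred L} := fun x => `[< algebraicOver f x >].

Fact algebraic_divring : divring_closed algebraic_mem.
Proof.
split=> [|x y|x y]; first exact/asboolP/algebraic1.
  by move=> /asboolP hx /asboolP hy; exact/asboolP/algebraic_sub.
by move=> /asboolP hx /asboolP hy; exact/asboolP/algebraic_div.
Qed.
HB.instance Definition _ :=
  GRing.isDivringClosed.Build L algebraic_mem algebraic_divring.

Record algebraics := Algebraics { alg_val :> L; alg_valP : alg_val \in algebraic_mem }.
HB.instance Definition _ := [isSub for alg_val].
HB.instance Definition _ := [Choice of algebraics by <:].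
HB.instance Definition _ := [SubChoice_isSubIntegralDomain of algebraics by <:].
HB.instance Definition _ := [SubIntegralDomain_isSubField of algebraics by <:].

(** A root z of a polynomial over the algebraic elements, in some extension of L, is
   algebraic over K; a polynomial over K that kills z splits in L, hence z is in L. *)
Fact algebraics_closed : GRing.closed_field_axiom algebraics.
Proof.
move=> n P n_gt0; pose p : {poly algebraics} := 'X^n - \poly_(i < n) P i.
have sz_p : size p = n.+1.
  by rewrite size_polyDl size_polyXn // size_polyN ltnS size_poly.
have [|M [g [z /rootP z0]]] := @root_extension _ (map_poly val p).
  by rewrite size_map_poly sz_p.
have z_alg : algebraicOver (g \o f) z.
  apply/integral_algebraic; apply: (@integral_root _ _ _ (map_poly g (map_poly val p))).
  - by rewrite map_poly_eq0 map_poly_eq0 -size_poly_eq0 sz_p.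
  - exact/rootP.
  - move=> _ /(nthP 0)[i _ <-]; rewrite !coef_map /=.
    have /asboolP/integral_algebraic[q mq q0] := alg_valP p`_i.
    by exists q => //; rewrite map_poly_comp rmorph_root.
have [q nzq qz] := z_alg; have [rs eq_rs] := f_split nzq.
have E : map_poly g (map_poly f q) %= map_poly g (\prod_(z <- rs) ('X - z%:P)).
  by rewrite eqp_map.
move: (qz); rewrite map_poly_comp (eqp_root E).
rewrite rmorph_prod /=; under eq_bigr do rewrite map_polyXsubC.
rewrite -(big_map g xpredT (fun y => 'X - y%:P)) root_prod_XsubC => /mapP[y _ zy].
have alg_y : y \in algebraic_mem.
  apply/asboolP; exists q => //.
  by rewrite -(fmorph_root g) -map_poly_comp -zy.
exists (Algebraics alg_y); apply: val_inj.
move: z0; rewrite zy horner_map => /eqP; rewrite fmorph_eq0 => /eqP.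
rewrite -[y]/(val (Algebraics alg_y)) horner_map => e.
have {e} : p.[Algebraics alg_y] = 0 by apply: val_inj; exact: e.
rewrite /p hornerD hornerXn hornerN => /eqP; rewrite subr_eq0 => /eqP ->.
by rewrite horner_poly.
Qed.

Fact algebraic_image a : f a \in algebraic_mem.
Proof. exact/asboolP/algebraic_id. Qed.
Definition to_algebraics a : algebraics := Algebraics (algebraic_image a).
Fact to_algebraics_zmod : zmod_morphism to_algebraics.
Proof. by move=> a b; apply: val_inj; exact: rmorphB. Qed.
Fact to_algebraics_monoid : monoid_morphism to_algebraics.
Proof. by split=> [|a b]; apply: val_inj; [exact: rmorph1|exact: rmorphM]. Qed.
HB.instance Definition _ :=
  GRing.isZmodMorphism.Build K algebraics to_algebraics to_algebraics_zmod.
HB.instance Definition _ :=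
  GRing.isMonoidMorphism.Build K algebraics to_algebraics to_algebraics_monoid.

End AlgebraicElements.

Lemma ideal_to_closed_field (R : comPzRingType) (J : set R) : proper_ideal J ->
  exists (L : closedFieldType) (f : {rmorphism R -> L}), forall a, J a -> f a = 0.
Proof.
move=> /ideal_to_field[K [g gJ]].
have [L [f f_split]] := common_splitting_extension K.
pose A : closedFieldType := HB.pack (algebraics f)
  (Field_isAlgClosed.Build (algebraics f) (algebraics_closed f_split)).
exists A, (to_algebraics f \o g : {rmorphism R -> A}) => a Ja.
by rewrite /= gJ // rmorph0.
Qed.

(** * Local rings and geometric points *)

Section OpenSets.
Variable X : topologicalType.
Implicit Types U V W : opens X.

Definition opensI U V : opens X := Opens (openI (oset_open U) (oset_open V)).

Lemma opensIl U V : opensI U V `<=` U. Proof. by move=> x []. Qed.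
Lemma opensIr U V : opensI U V `<=` V. Proof. by move=> x []. Qed.

Variable O : ring_sheaf X.

Lemma rres_id U (h : U `<=` U) (a : O U) : rres O h a = a.
Proof. exact: (sheaf_res_id (ring_sheafP O)). Qed.

Lemma rres_comp U V W (hUV : V `<=` U) (hVW : W `<=` V) (hUW : W `<=` U) (a : O U) :
  rres O hVW (rres O hUV a) = rres O hUW a.
Proof. exact: (sheaf_res_comp (ring_sheafP O)). Qed.

Lemma rres_irr U V (h h' : V `<=` U) (a : O U) : rres O h a = rres O h' a.
Proof. by rewrite (Prop_irrelevance h h'). Qed.

Lemma invertible_at_res U V (h : V `<=` U) x (a : O U) : oset V x ->
  invertible_at x (rres O h a) <-> invertible_at x a.
Proof.
move=> Vx; split=> -[W [hW [Wx [b ab]]]].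
  exists W, (subset_trans hW h); split => //; exists b.
  by rewrite -(rres_comp h hW).
exists (opensI V W), (@opensIl V W); split; first by split.
exists (rres O (@opensIr V W) b).
rewrite (rres_comp h _ (subset_trans (@opensIr V W) hW)).
by rewrite -(rres_comp hW (@opensIr V W)) -rmorphM ab rmorph1.
Qed.

Lemma invertible_atM U x (a b : O U) :
  invertible_at x (a * b) <-> invertible_at x a /\ invertible_at x b.
Proof.
split=> [[V [h [Vx [c]]]]|[[V [h [Vx [c ac]]]] [W [g [Wx [d bd]]]]]].
  rewrite rmorphM => e; split; exists V, h; split => //.
    by exists (rres O h b * c); rewrite mulrA.
  by exists (rres O h a * c); rewrite mulrA [X in X * c]mulrC.
exists (opensI V W), (subset_trans (@opensIl V W) h); split; first by split.
exists (rres O (@opensIl V W) c * rres O (@opensIr V W) d).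
rewrite rmorphM mulrACA -{1}(rres_comp h (@opensIl V W)) -rmorphM ac.
rewrite (rres_irr _ (subset_trans (@opensIr V W) g)).
by rewrite -(rres_comp g (@opensIr V W)) -rmorphM bd !rmorph1 mulr1.
Qed.

Lemma invertible_at1 U x : oset U x -> invertible_at x (1 : O U).
Proof. by exists U, (@subset_refl _ U); split => //; exists 1; rewrite rmorph1 mulr1. Qed.

Lemma invertible_atX U x (a : O U) n : oset U x ->
  invertible_at x a -> invertible_at x (a ^+ n).
Proof.
move=> Ux ia; elim: n => [|n IH]; first exact: invertible_at1.
by rewrite exprS; apply/invertible_atM.
Qed.

End OpenSets.

Section AffineChart.
Variables (X : topologicalType) (O : ring_sheaf X) (U0 : opens X).
Variables (A : comPzRingType) (h : {x : X | oset U0 x} -> Spec A).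
Variable theta : {rmorphism A -> O U0}.
Hypothesis h_bij : bijective h.
Hypothesis h_open : forall W : set (Spec A),
  open W <-> open [set x | exists ux : oset U0 x, W (h (exist _ x ux))].
Hypothesis theta_loc : forall (a : A) (V : opens X) (hV : V `<=` U0),
  (forall x (ux : oset U0 x), oset V x <-> basic_open a (h (exist _ x ux))) ->
  is_localization a (fun b => rres O hV (theta b)).

Lemma open_basic (a : A) : open (@basic_open A a).
Proof.
rewrite -[open _]/(zariski_open _) => p pa.
by exists a; split.
Qed.

Definition chart_open (a : A) : opens X := Opens ((h_open _).1 (@open_basic a)).

Lemma chart_open_sub a : chart_open a `<=` U0.
Proof. by move=> x []. Qed.

Lemma chart_openE a x (ux : oset U0 x) :
  oset (chart_open a) x <-> basic_open a (h (exist _ x ux)).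
Proof.
split=> [[ux' /=]|]; last by exists ux.
by rewrite (Prop_irrelevance ux ux').
Qed.

Lemma chart_open_basis (U : opens X) x (ux : oset U0 x) : oset U x ->
  exists a, oset (chart_open a) x /\ chart_open a `<=` U.
Proof.
move=> Ux; pose W := [set p | exists y : {x : X | oset U0 x}, oset U (sval y) /\ h y = p].
have oW : open W.
  apply/h_open; rewrite [X in open X](_ : _ = oset (opensI U U0)); first exact: oset_open.
  apply/seteqP; split=> y /=.
    by case=> uy [z [Uz /(bij_inj h_bij) e]]; move: Uz; rewrite e.
  by case=> Uy uy; exists uy, (exist _ y uy).
have /(_ (h (exist _ x ux)))[|a [xa aW]] : zariski_open W := oW.
  by exists (exist _ x ux).
exists a; split; first exact/chart_openE.
by move=> y [uy /aW[z [Uz /(bij_inj h_bij) e]]]; rewrite e in Uz.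
Qed.

(** An inverse of y near x is a fraction over some basic open set D(a); clearing the
   denominators shows that y divides a power of a, and a is not in the prime of x. *)
Lemma theta_invertible x (ux : oset U0 x) (y : A) :
  invertible_at x (theta y) <-> ~ spec_ideal (h (exist _ x ux)) y.
Proof.
have pP := spec_prime (h (exist _ x ux)).
split=> [[V [g [Vx [b yb]]]] py|npy]; last first.
  exists (chart_open y), (@chart_open_sub y); split; first exact/chart_openE.
  exact: loc_unit (theta_loc (@chart_open_sub y) (chart_openE y)).
have [a [xa aV]] := chart_open_basis ux Vx.
have loc := theta_loc (@chart_open_sub a) (chart_openE a).
have npa : ~ spec_ideal (h (exist _ x ux)) a by apply/(chart_openE a ux).
have npaX n : ~ spec_ideal (h (exist _ x ux)) (a ^+ n).
  elim: n => [|n IH]; first exact: prime1.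
  by rewrite exprS => /(Defs.primeP pP)[].
have [n [z e]] := loc_surj loc (rres O aV b).
have : rres O (@chart_open_sub a) (theta (a ^+ n - y * z)) = 0.
  rewrite rmorphB rmorphM rmorphB rmorphM /= -e mulrCA.
  rewrite -(rres_comp g aV _ (theta y)) -(rmorphM (rres O aV)).
  by rewrite yb rmorph1 mulr1 subrr.
move=> /(loc_ker loc)[m am].
have : spec_ideal (h (exist _ x ux)) (a ^+ m * (a ^+ n - y * z)).
  by rewrite am; exact: prime0.
case/(Defs.primeP pP) => [/npaX //|q]; apply: (npaX n).
by rewrite -(subrK (y * z) (a ^+ n)); apply: (primeD pP) => //; rewrite mulrC; exact: primeMl.
Qed.

(** Over a basic open set a and b are fractions, which are invertible at x exactly
   when their numerators avoid the prime of x; that prime is closed under addition. *)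
Lemma chart_invertibleD (U : opens X) x (a b : O U) : oset U0 x -> oset U x ->
  invertible_at x (a + b) -> invertible_at x a \/ invertible_at x b.
Proof.
move=> ux Ux; have [c [xc cU]] := chart_open_basis ux Ux.
have loc := theta_loc (@chart_open_sub c) (chart_openE c).
pose rho t := rres O (@chart_open_sub c) (theta t).
have [n [y ey]] : exists n y, rho (c ^+ n) * rres O cU a = rho y := loc_surj loc _.
have [m [z ez]] : exists n y, rho (c ^+ n) * rres O cU b = rho y := loc_surj loc _.
have rhoP t : invertible_at x (rho t) <-> ~ spec_ideal (h (exist _ x ux)) t.
  by rewrite (invertible_at_res _ _ xc); exact: theta_invertible.
have pP := spec_prime (h (exist _ x ux)).
have rhoX l : invertible_at x (rho (c ^+ l)).
  rewrite /rho !rmorphXn; apply: invertible_atX => //.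
  by apply/rhoP; exact/(chart_openE c ux).
rewrite -!(invertible_at_res cU _ xc) rmorphD => iab.
have E : rho (c ^+ m * y + c ^+ n * z) =
    rho (c ^+ n) * rho (c ^+ m) * (rres O cU a + rres O cU b).
  have -> : rho (c ^+ m * y + c ^+ n * z) = rho (c ^+ m) * rho y + rho (c ^+ n) * rho z.
    by rewrite /rho rmorphD !rmorphM rmorphD !rmorphM.
  by rewrite -ey -ez mulrDr -!mulrA [X in X + _]mulrCA.
have : invertible_at x (rho (c ^+ m * y + c ^+ n * z)).
  by rewrite E !invertible_atM.
move=> /rhoP nyz; apply: contrapT => /not_orP[na nb]; apply: nyz.
have num t w l : ~ invertible_at x w -> rho (c ^+ l) * w = rho t ->
    spec_ideal (h (exist _ x ux)) t.
  by move=> nw e; apply: contrapT => /rhoP; rewrite -e => /invertible_atM[].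
by apply: (primeD pP); apply: (primeMl pP); [exact: num na ey|exact: num nb ez].
Qed.

Lemma chart_invertible0 x : oset U0 x -> ~ invertible_at x (0 : O U0).
Proof.
move=> ux; rewrite -(rmorph0 theta) => /(theta_invertible ux); apply.
exact: prime0 (spec_prime _).
Qed.

End AffineChart.

Section LocalRings.
Variables (k : fieldType) (S : scheme k).
Local Notation O := (str S).

Lemma invertible_atD (U : opens S) x (a b : O U) : oset U x ->
  invertible_at x (a + b) -> invertible_at x a \/ invertible_at x b.
Proof.
move=> Ux; have [U0 [U0x [A [h [theta [hb ho hl]]]]]] := scheme_affine x.
exact: (chart_invertibleD hb ho hl U0x Ux).
Qed.

Lemma invertible_at0 (U : opens S) x : oset U x -> ~ invertible_at x (0 : O U).
Proof.
move=> Ux; have [U0 [U0x [A [h [theta [hb ho hl]]]]]] := scheme_affine x.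
have Vx : oset (opensI U U0) x by [].
move=> /(invertible_at_res (@opensIl _ U U0) _ Vx); rewrite rmorph0.
rewrite -(rmorph0 (rres O (@opensIr _ U U0))) => /(invertible_at_res _ _ Vx).
exact: (chart_invertible0 hb ho hl U0x).
Qed.

(** The functions on all the neighbourhoods of x form a ring, in which the
   families that are eventually not invertible at x are a proper ideal: a field
   over its quotient receives the germs at x, and kills exactly those that are
   not invertible. *)
Lemma geometric_point_exists (x : S) : exists s : geometric_point S, gpt s = x.
Proof.
pose N := {V : opens S | oset V x}.
pose R := prod_ring (fun V : N => O (sval V)).
pose J := [set f : R | exists2 U : opens S, oset U x &
  forall V : N, sval V `<=` U -> ~ invertible_at x (f V)].
have [|L [g gJ]] := @ideal_to_closed_field R J.
  split; first split.
  - exists (full_open S) => // -[V Vx] _; exact: invertible_at0.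
  - move=> a b [U Ux Ha] [U' Ux' Hb]; exists (opensI U U') => // -[V Vx] VU.
    move=> /(invertible_atD Vx)[];
      [apply: (Ha (exist _ V Vx))|apply: (Hb (exist _ V Vx))]; by move=> y /VU[].
  - move=> a b [U Ux Hb]; exists U => // -[V Vx] VU /invertible_atM[_].
    exact: (Hb (exist _ V Vx)).
  - case=> U Ux /(_ (exist _ U Ux))[//|]; exact: invertible_at1.
(* A function on U is extended by 0 to the neighbourhoods that U does not contain. *)
pose extend (U : opens S) (a : O U) : R := fun V =>
  if pselect (sval V `<=` U) is left h then rres O h a else 0.
have extendE (U : opens S) (a : O U) (V : N) (h : sval V `<=` U) : extend U a V = rres O h a.
  by rewrite /extend; case: pselect => // h'; exact: rres_irr.
have gE (U : opens S) (f f' : R) : oset U x ->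
    (forall V : N, sval V `<=` U -> f V = f' V) -> g f = g f'.
  move=> Ux e; apply/eqP; rewrite -subr_eq0 -rmorphB; apply/eqP/gJ.
  exists U => // V VU; rewrite -[(f - f') V]/(f V - f' V) e // subrr.
  exact: invertible_at0 (svalP V).
pose ev (U : opens S) (a : O U) : L := g (extend U a).
have evB (U : opens S) (Ux : oset U x) : zmod_morphism (ev U).
  move=> a b; rewrite /ev -rmorphB; apply: (gE U) => // V VU.
  by rewrite -[RHS]/(extend U a V - extend U b V) !(extendE _ _ _ VU) rmorphB.
have evM (U : opens S) (Ux : oset U x) : monoid_morphism (ev U).
  split=> [|a b]; rewrite /ev -?rmorphM -?(rmorph1 g); apply: (gE U) => // V VU.
    by rewrite (extendE _ _ _ VU) rmorph1.
  by rewrite -[RHS]/(extend U a V * extend U b V) !(extendE _ _ _ VU) rmorphM.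
pose evm (U : opens S) (Ux : oset U x) : {rmorphism O U -> L} := HB.pack (ev U)
   (GRing.isZmodMorphism.Build (O U) L (ev U) (evB U Ux))
   (GRing.isMonoidMorphism.Build (O U) L (ev U) (evM U Ux)).
unshelve eexists; first apply: (@GeometricPoint k S L x evm) => //.
- move=> U V h xU xV a; apply: (gE V) => // W WV.
  by rewrite (extendE _ _ _ WV) (extendE _ _ _ (subset_trans WV h)); exact: rres_comp.
- move=> U Ux a /eqP nz; apply: contrapT => na; apply: nz; apply: gJ.
  exists U => // V VU; rewrite (extendE _ _ _ VU).
  by move=> /(invertible_at_res VU a (svalP V)).
- by [].
Qed.

End LocalRings.

(** * Frames and coordinates *)

Section Sections.
Variables (k : fieldType) (S : scheme k).
Local Notation O := (str S).
Implicit Types (E F : omodule S) (U V W : opens S).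

Lemma mres_id E U (h : U `<=` U) (s : E U) : mres E h s = s.
Proof. exact: (sheaf_res_id (omodule_sheafP E)). Qed.

Lemma mres_comp E U V W (hUV : V `<=` U) (hVW : W `<=` V) (hUW : W `<=` U) (s : E U) :
  mres E hVW (mres E hUV s) = mres E hUW s.
Proof. exact: (sheaf_res_comp (omodule_sheafP E)). Qed.

Definition lincomb E n U (e : 'I_n -> E U) V (h : V `<=` U) (a : 'I_n -> O V) : E V :=
  \sum_i a i *: mres E h (e i).

Lemma lincombP E n U (e : 'I_n -> E U) V (h : V `<=` U) c (a b : 'I_n -> O V) :
  lincomb e h (fun i => c * a i + b i) = c *: lincomb e h a + lincomb e h b.
Proof.
rewrite /lincomb scaler_sumr -big_split /=.
by apply: eq_bigr => i _; rewrite scalerDl scalerA.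
Qed.

Lemma lincomb_res E n U (e : 'I_n -> E U) V W (h : V `<=` U) (g : W `<=` V)
    (hg : W `<=` U) (a : 'I_n -> O V) :
  mres E g (lincomb e h a) = lincomb e hg (fun i => rres O g (a i)).
Proof.
rewrite /lincomb raddf_sum; apply: eq_bigr => i _.
by rewrite mresZ (mres_comp h g hg).
Qed.

Lemma lincomb_of_res E n U (e : 'I_n -> E U) V W (h : V `<=` U) (g : W `<=` V)
    (hg : W `<=` U) (a : 'I_n -> O W) :
  lincomb (fun i => mres E h (e i)) g a = lincomb e hg a.
Proof. by apply: eq_bigr => i _; rewrite (mres_comp h g hg). Qed.

Lemma lincomb1 E n U (e : 'I_n -> E U) V (h : V `<=` U) j :
  lincomb e h (fun i => (i == j)%:R) = mres E h (e j).
Proof.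
rewrite /lincomb (bigD1 j) //= eqxx scale1r big1 ?addr0 // => i /negPf->.
by rewrite scale0r.
Qed.

Lemma lincomb0 E n U (e : 'I_n -> E U) V (h : V `<=` U) :
  lincomb e h (fun=> 0) = 0.
Proof. by rewrite /lincomb big1 // => i _; rewrite scale0r. Qed.

Lemma omor_lincomb E F (f : omor E F) n U (e : 'I_n -> E U) V (h : V `<=` U) a :
  f V (lincomb e h a) = lincomb (fun i => f U (e i)) h a.
Proof.
by rewrite /lincomb linear_sum; apply: eq_bigr => i _; rewrite linearZ ofun_res.
Qed.

Section Frames.
Variables (E : omodule S) (n : nat) (U : opens S) (e : 'I_n -> E U).

(** Coefficients are handled as functions of the index, and the existence part of the
   definition of a frame is separated from uniqueness. *)
Lemma frameP : frame e <-> forall V (h : V `<=` U) s,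
  (exists a, s = lincomb e h a) /\
  (forall a b, lincomb e h a = lincomb e h b -> a =1 b).
Proof.
split=> [fr V h s|H V h s].
  split; first by have [a [sa _]] := fr V h s; exists (a 0).
  move=> a b ab i; have [c [_ uc]] := fr V h (lincomb e h a).
  have Hrow (d : 'I_n -> O V) : lincomb e h a = lincomb e h d -> c = \row_j d j.
    by move=> ad; apply: uc; rewrite ad; apply: eq_bigr => j _; rewrite mxE.
  have := Hrow b ab; rewrite (Hrow a erefl) => /rowP/(_ i).
  by rewrite !mxE.
have [[a sa] _] := H V h s; exists (\row_j a j); split.
  by rewrite sa; apply: eq_bigr => j _; rewrite mxE.
move=> b sb; apply/rowP=> i; rewrite mxE.
by apply: (H V h s).2; rewrite -sa sb.
Qed.

Hypothesis fr : frame e.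

Definition coord V (h : V `<=` U) (s : E V) : 'I_n -> O V :=
  sval (cid ((frameP.1 fr V h s).1)).

Lemma coordK V (h : V `<=` U) (s : E V) : lincomb e h (coord h s) = s.
Proof. by rewrite -(svalP (cid ((frameP.1 fr V h s).1))). Qed.

Lemma lincomb_inj V (h : V `<=` U) a b : lincomb e h a = lincomb e h b -> a =1 b.
Proof. exact: (frameP.1 fr V h 0).2. Qed.

Lemma coord_lincomb V (h : V `<=` U) a : coord h (lincomb e h a) =1 a.
Proof. by apply: (@lincomb_inj _ h); rewrite coordK. Qed.

Lemma coord_inj V (h : V `<=` U) s t : coord h s =1 coord h t -> s = t.
Proof.
by move=> st; rewrite -(coordK h s) -(coordK h t); apply: eq_bigr => i _; rewrite st.
Qed.

Lemma coordP V (h : V `<=` U) c s t i :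
  coord h (c *: s + t) i = c * coord h s i + coord h t i.
Proof.
by rewrite -[in LHS](coordK h s) -[in LHS](coordK h t) -lincombP coord_lincomb.
Qed.

Lemma coord0 V (h : V `<=` U) i : coord h 0 i = 0.
Proof. by rewrite -[in LHS](lincomb0 e h) coord_lincomb. Qed.

Lemma coordD V (h : V `<=` U) s t i : coord h (s + t) i = coord h s i + coord h t i.
Proof. by rewrite -[s]scale1r coordP mul1r scale1r. Qed.

Lemma coordZ V (h : V `<=` U) c s i : coord h (c *: s) i = c * coord h s i.
Proof. by rewrite -[c *: s]addr0 coordP coord0 addr0. Qed.

Lemma coord_sum (I : finType) V (h : V `<=` U) (s : I -> E V) i :
  coord h (\sum_j s j) i = \sum_j coord h (s j) i.
Proof.
apply: (big_morph (fun s => coord h s i)); last exact: coord0.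
by move=> t u; exact: coordD.
Qed.

Lemma coord_res V W (h : V `<=` U) (g : W `<=` V) (hg : W `<=` U) s i :
  coord hg (mres E g s) i = rres O g (coord h s i).
Proof. by rewrite -[in LHS](coordK h s) (lincomb_res _ _ _ hg) coord_lincomb. Qed.

Lemma coord_frame V (h : V `<=` U) j i : coord h (mres E h (e j)) i = (i == j)%:R.
Proof. by rewrite -lincomb1 coord_lincomb. Qed.

End Frames.

Lemma frame_res E n U (e : 'I_n -> E U) V (h : V `<=` U) :
  frame e -> frame (fun i => mres E h (e i)).
Proof.
move=> fr; apply/frameP => W g s; have gh := subset_trans g h; split.
  by exists (coord fr gh s); rewrite (lincomb_of_res _ _ _ gh) coordK.
by move=> a b; rewrite !(lincomb_of_res _ _ _ gh); exact: lincomb_inj.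
Qed.

Lemma coord_frame_res E n U (e : 'I_n -> E U) V (h : V `<=` U) (fr : frame e)
    (fr' : frame (fun i => mres E h (e i))) W (g : W `<=` V) (gh : W `<=` U) s i :
  coord fr' g s i = coord fr gh s i.
Proof.
by rewrite -[in LHS](coordK fr gh s) -(lincomb_of_res _ h g) coord_lincomb.
Qed.

Definition replace_vec E n U (e : 'I_n -> E U) i0 v : 'I_n -> E U :=
  fun i => if i == i0 then v else e i.

Section FrameReplace.
Variables (E : omodule S) (n : nat) (U : opens S) (e : 'I_n -> E U) (fr : frame e).
Variables (i0 : 'I_n) (v : E U) (u : O U).
Hypothesis uv : u * coord fr (@subset_refl _ U) v i0 = 1.

Let a V (h : V `<=` U) i := coord fr h (mres E h v) i.

Let uva V (h : V `<=` U) : rres O h u * a h i0 = 1.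
Proof. by rewrite /a (coord_res fr (@subset_refl _ U)) -rmorphM uv rmorph1. Qed.

Let coord_replace V (h : V `<=` U) b i :
  coord fr h (lincomb (replace_vec e i0 v) h b) i =
  b i0 * a h i + (if i == i0 then 0 else b i).
Proof.
rewrite {1}/lincomb coord_sum (bigD1 i0) //= {1}/replace_vec eqxx coordZ; congr (_ + _).
under eq_bigr => j ji do rewrite /replace_vec (negPf ji) coordZ coord_frame.
have [->|ii0] := eqVneq i i0.
  by rewrite big1 // => j ji; rewrite eq_sym (negPf ji) mulr0.
rewrite (bigD1 i) //= eqxx mulr1 big1 ?addr0 // => j /andP[_ ji].
by rewrite eq_sym (negPf ji) mulr0.
Qed.

(** The component along v must produce the old component c i0, whence the factor u;
   the other components are then corrected for those of v. *)
Let newcoord V (h : V `<=` U) (c : 'I_n -> O V) i :=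
  if i == i0 then c i0 * rres O h u else c i - c i0 * rres O h u * a h i.

Lemma frame_replace : frame (replace_vec e i0 v).
Proof.
apply/frameP => V h s; split.
  exists (newcoord h (coord fr h s)); apply: (coord_inj (fr := fr) (h := h)) => i.
  rewrite coord_replace /newcoord eqxx; have [->|_] := eqVneq i i0.
    by rewrite addr0 -mulrA uva mulr1.
  by rewrite addrC subrK.
move=> b c bc; have E0 i := coord_replace h b i; rewrite bc in E0.
have {}E0 i : b i0 * a h i + (if i == i0 then 0 else b i) =
    c i0 * a h i + (if i == i0 then 0 else c i) by rewrite -E0 coord_replace.
have bc0 : b i0 = c i0.
  have := E0 i0; rewrite eqxx !addr0 => e0.
  by rewrite -[b i0]mulr1 -(uva h) mulrCA e0 mulrCA uva mulr1.
move=> i; have := E0 i; rewrite bc0; have [->//|_] := eqVneq i i0.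
exact: addrI.
Qed.

Lemma coord_frame_replace V (h : V `<=` U) s i :
  coord frame_replace h s i =
  if i == i0 then coord fr h s i0 * rres O h u
  else coord fr h s i - coord fr h s i0 * rres O h u * coord fr h (mres E h v) i.
Proof.
rewrite -[LHS]/(coord frame_replace h s i) -[RHS]/(newcoord h (coord fr h s) i).
apply: (lincomb_inj frame_replace) => {i}; rewrite coordK.
apply: (coord_inj (fr := fr) (h := h)) => i.
rewrite coord_replace /newcoord eqxx; have [->|_] := eqVneq i i0.
  by rewrite addr0 -mulrA uva mulr1.
by rewrite addrC subrK.
Qed.

End FrameReplace.
End Sections.

(** * Minors *)

Section DeterminantsModuloIdeals.
Variable R : comPzRingType.

Lemma ideal_sum (W : set R) (I : finType) (F : I -> R) : ideal W ->
  (forall i, W (F i)) -> W (\sum_i F i).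
Proof.
by move=> hW hF; apply: (big_ind W) => //; [exact: ideal0|exact: idealD].
Qed.

Lemma det_ideal_congr (W : set R) n (A B : 'M[R]_n) : ideal W ->
  (forall i j, W (A i j - B i j)) -> W (\det A - \det B).
Proof.
move=> hW AB; pose K x y := W (x - y).
have KD x1 x2 y1 y2 : K x1 x2 -> K y1 y2 -> K (x1 + y1) (x2 + y2).
  by move=> h1 h2; rewrite /K opprD addrACA; exact: idealD.
have KM x1 x2 y1 y2 : K x1 x2 -> K y1 y2 -> K (x1 * y1) (x2 * y2).
  move=> h1 h2; rewrite /K -(subrKA (x1 * y2)) -mulrBr -mulrBl mulrC.
  by apply: idealD => //; [rewrite mulrC|rewrite mulrC]; exact: idealMl.
have K0 x : K x x by rewrite /K subrr; exact: ideal0.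
apply: (big_ind2 K) => [||s _]; [exact: K0|exact: KD|apply: (KM _ _ _ _ (K0 _))].
by apply: (big_ind2 K) => [||i _]; [exact: K0|exact: KM|exact: AB].
Qed.

(** The Cauchy-Binet formula before terms are grouped: each row of the product is
   expanded by multilinearity, so that g runs over all maps. *)
Lemma det_mulmx_expand k n (C : 'M[R]_(k, n)) (B : 'M[R]_(n, k)) :
  \det (C *m B) =
  \sum_(g : {ffun 'I_k -> 'I_n}) (\prod_b C b (g b)) * \det (rowsub g B).
Proof.
under [RHS]eq_bigr do rewrite big_distrr /=.
rewrite exchange_big; apply: eq_bigr => s _ /=.
rewrite (eq_bigr (fun i => \sum_j C i j * B j (s i))); last by move=> i _; rewrite mxE.
rewrite bigA_distr_bigA big_distrr /=; apply: eq_bigr => g _.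
rewrite mulrCA; congr (_ * _); rewrite big_split; congr (_ * _).
by apply: eq_bigr => i _; rewrite mxE.
Qed.

(** A map from k indices to fewer repeats a row of B. *)
Lemma det_lowrank k n (C : 'M[R]_(k, n)) (B : 'M[R]_(n, k)) :
  (n < k)%N -> \det (C *m B) = 0.
Proof.
move=> lt_nk; rewrite det_mulmx_expand big1 // => g _.
have /injectivePn[i [j ij gij]] : ~~ injectiveb g.
  apply/negP => /injectiveP/leq_card; rewrite !card_ord leqNgt.
  by rewrite lt_nk.
rewrite (determinant_alternate ij) ?mulr0 // => l.
by rewrite !mxE gij.
Qed.

End DeterminantsModuloIdeals.

Section Minors.
Variables (k : fieldType) (S : scheme k).
Local Notation O := (str S).
Implicit Types U V W : opens S.

Section MinorsOfSections.
Variables (F : omodule S) (m : nat) (U : opens S) (f : 'I_m -> F U) (fr : frame f).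

(** The vectors v are the rows, so that the minors of a matrix of a morphism are the
   transposed ones. *)
Definition minor V (h : V `<=` U) q (g : 'I_q -> 'I_m) (v : 'I_q -> F V) : O V :=
  \det (\matrix_(b, a) coord fr h (v b) (g a)).

Lemma minor_res V W (h : V `<=` U) (p : W `<=` V) (hp : W `<=` U) q g (v : 'I_q -> F V) :
  minor hp g (fun b => mres F p (v b)) = rres O p (minor h g v).
Proof.
rewrite /minor -det_map_mx; congr (\det _); apply/matrixP=> b a.
by rewrite !mxE (coord_res fr h).
Qed.

Lemma minor_alternate V (h : V `<=` U) q g (v : 'I_q -> F V) b b' :
  b != b' -> v b = v b' -> minor h g v = 0.
Proof.
by move=> bb' e; apply: (determinant_alternate bb') => a; rewrite !mxE e.
Qed.

Lemma minor_linear V (h : V `<=` U) q g (v : 'I_q -> F V) b c s t :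
  minor h g (upd v b (c *: s + t)) = c * minor h g (upd v b s) + minor h g (upd v b t).
Proof.
rewrite -[minor h g (upd v b t)]mul1r; apply: (@determinant_multilinear _ _ _ _ _ b).
- by apply/rowP=> a; rewrite !mxE /upd eqxx coordP mul1r.
- by apply/matrixP=> i a; rewrite !mxE /upd eq_sym (negPf (neq_lift _ _)).
- by apply/matrixP=> i a; rewrite !mxE /upd eq_sym (negPf (neq_lift _ _)).
Qed.

(** A minor is a linear form on the exterior power. *)
Lemma minor_wedge V (h : V `<=` U) q g (v : 'I_q -> F V) :
  wedge v = 0 -> minor h g v = 0.
Proof.
pose D (w : 'I_q -> F V) : (O V)^o := minor h g w.
have Drel u : ext_rel u -> fsum (@idfun (O V) : {rmorphism _ -> _}) D u = 0.
  case=> [w i a x y|w i j ij wij].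
    rewrite /fsum !big_cons big_nil addr0 /= /D minor_linear.
    by rewrite -![_ *: _]/(_ * _) mul1r !mulNr mul1r -opprD; exact: subrr.
  by rewrite /fsum big_seq1 /= /D (minor_alternate _ _ ij wij) scaler0.
move=> v0; rewrite -[LHS]/(D v) -(pres_liftE Drel v) -[pres_gen _ v]/(wedge v) v0.
by rewrite -(scale0r (wedge v)) (pres_liftZ Drel) /= scale0r.
Qed.

(** Modulo W the vectors v lie in the span of the fewer vectors u. *)
Lemma minor_ideal (W : set (O U)) q p (g : 'I_q -> 'I_m) (v : 'I_q -> F U)
    (c : 'I_q -> 'I_p -> O U) (u : 'I_p -> F U) : ideal W -> (p < q)%N ->
  (forall b i, W (coord fr (@subset_refl _ U) (v b - \sum_a c b a *: u a) i)) ->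
  W (minor (@subset_refl _ U) g v).
Proof.
move=> hW lt_pq vW; rewrite /minor; set M := \matrix_(_, _) _.
pose C := \matrix_(b, a) c b a.
pose B := \matrix_(a, b) coord fr (@subset_refl _ U) (u a) (g b).
rewrite -[\det M]subr0 -(det_lowrank C B lt_pq); apply: det_ideal_congr => // b a.
have := vW b (g a); rewrite -scaleN1r addrC coordP mulN1r addrC coord_sum.
rewrite !mxE; congr (W (_ - _)); apply: eq_bigr => i _.
by rewrite coordZ !mxE.
Qed.

End MinorsOfSections.

Section MinorsIdeal.
Variables (E F : omodule S) (phi : omor E F) (r : nat).

(** The expansion of the sections s in the frame e turns their minor into a
   combination of minors of a matrix of phi. *)
Lemma minor_in_minors_ideal U m n (f : 'I_m -> F U) (e : 'I_n -> E U) (fr : frame f)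
    (s : 'I_r -> E U) g : frame e ->
  minors_ideal phi r (minor fr (@subset_refl _ U) g (fun b => phi U (s b))).
Proof.
move=> fe x Ux; exists U, (@subset_refl _ U), m, n, e, f.
pose cF := coord fr (@subset_refl _ U); pose cE := coord fe (@subset_refl _ U).
exists (\matrix_(i, j) cF (phi U (e j)) i); split => //.
  move=> j; rewrite -{1}(coordK fr (@subset_refl _ U) (phi U (e j))).
  by apply: eq_bigr => i _; rewrite mres_id mxE.
exists (fun (g1 : 'I_r -> 'I_m) (g2 : 'I_r -> 'I_n) => if [ffun a => g1 a] == [ffun a => g a]
  then \prod_b cE (s b) (g2 b) else 0).
rewrite rres_id exchange_big /=.
pose C := \matrix_(b, l) cE (s b) l; pose B := \matrix_(l, a) cF (phi U (e l)) (g a).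
rewrite /minor (_ : \matrix_(_, _) _ = C *m B); last first.
  apply/matrixP=> b a; rewrite !mxE -{1}(coordK fe (@subset_refl _ U) (s b)).
  rewrite omor_lincomb /lincomb coord_sum; apply: eq_bigr => l _.
  by rewrite coordZ mres_id !mxE.
rewrite det_mulmx_expand; apply: eq_bigr => g2 _.
rewrite (bigD1 [ffun a => g a]) //= [X in _ = _ + X]big1 => [|g1 ng]; last first.
  rewrite (_ : [ffun a => g1 a] = g1) ?(negPf ng) ?mul0r //.
  by apply/ffunP=> a; rewrite ffunE.
rewrite addr0 (_ : [ffun a => _] == _ = true); last first.
  by apply/eqP/ffunP=> a; rewrite !ffunE.
congr (_ * _); first by apply: eq_bigr => b _; rewrite mxE.
rewrite -det_tr; congr (\det _); apply/matrixP=> a b.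
by rewrite !mxE ffunE.
Qed.

(** Near x an element of the minors ideal is expressed in some frames, unrelated to
   those at hand; this is why the conclusion speaks of the minors of all sections in
   a frame f that cannot be chosen. *)
Lemma minors_ideal_local U (a : O U) x : minors_ideal phi r a -> oset U x ->
  exists (V : opens S) (h : V `<=` U) m (f : 'I_m -> F V) (fr : frame f), oset V x /\
    forall W : set (O V), ideal W ->
      (forall g (s : 'I_r -> E V),
         W (minor fr (@subset_refl _ V) g (fun b => phi V (s b)))) ->
      W (rres O h a).
Proof.
move=> Ia /Ia[V [h [m [n [e [f [A [Vx fe ff fA [c ea]]]]]]]]].
exists V, h, m, f, ff; split=> // W hW Wm; rewrite ea.
apply: ideal_sum => // g; apply: ideal_sum => // g'; apply: idealMl => //.
have := Wm g (fun b => e (g' b)); rewrite /minor -det_tr.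
congr (W (\det _)); apply/matrixP=> i j; rewrite !mxE fA.
rewrite (_ : \sum_(i0 < m) _ = lincomb f (@subset_refl _ V) (fun l => A l (g' j))).
  by rewrite coord_lincomb.
by apply: eq_bigr => l _; rewrite mres_id.
Qed.

Lemma ext_zero_minor U m (f : 'I_m -> F U) (fr : frame f) (s : 'I_r -> E U) g :
  ext_zero r phi -> minor fr (@subset_refl _ U) g (fun b => phi U (s b)) = 0.
Proof.
move=> phi0; apply: (sheaf_separated (ring_sheafP O)) => x Ux.
have [V [h [Vx e]]] := phi0 U (wedge s) x Ux; exists V, h; split=> //.
rewrite rmorph0 -(minor_res fr (@subset_refl _ U) h h); apply: minor_wedge.
rewrite -e ext_map_wedge; last by move=> a t u; rewrite linearP.
by rewrite ext_map_wedge // => a t u; rewrite raddfD /= mresZ.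
Qed.

End MinorsIdeal.
End Minors.

(** * Exterior powers and fibers *)

Section PresentedModules.
Variables (R : comPzRingType) (G : Type) (Rel : seq (R * {classic G}) -> Prop).

Lemma pres_scale_gen a (g : G) :
  a *: pres_gen Rel g = \pi_(pres Rel) [:: (a, g : {classic G})].
Proof. by rewrite -[LHS]/(pres_scal _ _) pres_scalE /= mulr1. Qed.

Lemma pres_cons a (g : G) u :
  \pi_(pres Rel) ((a, g : {classic G}) :: u) = a *: pres_gen Rel g + \pi_(pres Rel) u.
Proof. by rewrite pres_scale_gen -[RHS]/(pres_add _ _) pres_addE. Qed.

Lemma pres_ind (P : pres Rel -> Prop) : P 0 ->
  (forall a g p, P p -> P (a *: pres_gen Rel g + p)) -> forall p, P p.
Proof.
move=> P0 PS p; rewrite -(reprK p); elim: (repr p) => [|[a g] u IH]; first exact: P0.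
by rewrite pres_cons; exact: PS.
Qed.

Lemma pres_gen_rel (u : seq (R * {classic G})) : Rel u ->
  \sum_(x <- u) x.1 *: pres_gen Rel x.2 = 0.
Proof.
move=> hu; transitivity (\pi_(pres Rel) u); last first.
  by apply/eqP/pres_eqP; exact: pres_rel.
by elim: u {hu} => [|[a g] u IH]; rewrite ?big_nil // big_cons IH pres_cons.
Qed.

End PresentedModules.

Section Wedges.

Lemma wedge_linear (R : comPzRingType) q (M : lmodType R) (v : 'I_q -> M) i a x y :
  wedge (upd v i (a *: x + y)) = a *: wedge (upd v i x) + wedge (upd v i y).
Proof.
have := pres_gen_rel (ext_linear v i a x y).
rewrite !big_cons big_nil addr0 /= scale1r !scaleNr scale1r -opprD => /eqP.
by rewrite subr_eq0 => /eqP.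
Qed.

Lemma wedge_alternate (R : comPzRingType) q (M : lmodType R) (v : 'I_q -> M) i j :
  i != j -> v i = v j -> wedge v = 0.
Proof.
move=> ij vij; have := pres_gen_rel (ext_alternate ij vij).
by rewrite big_seq1 /= scale1r.
Qed.

(** Vectors in the span of fewer vectors satisfy a linear relation. *)
Lemma wedge_lowrank (K : fieldType) q p (M : lmodType K) (v : 'I_q -> M)
    (u : 'I_p -> M) (C : 'M[K]_(q, p)) : (p < q)%N ->
  (forall b, v b = \sum_a C b a *: u a) -> wedge v = 0.
Proof.
move=> lt_pq vE; have /rowV0Pn[d /sub_kermxP dC nz_d] : kermx C != 0.
  by rewrite -mxrank_eq0 mxrank_ker subn_eq0 -ltnNge (leq_ltn_trans (rank_leq_col C)).
have /eqP/rowP/existsNP[b0 db0] : d != 0 := nz_d; rewrite mxE in db0.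
have dv0 : \sum_b d 0 b *: v b = 0.
  under eq_bigr => b _ do rewrite vE scaler_sumr.
  rewrite exchange_big big1 // => a _ /=.
  under eq_bigr => b _ do rewrite scalerA.
  rewrite -scaler_suml; have /rowP/(_ a) := dC; rewrite !mxE => ->.
  by rewrite scale0r.
have {}db0 : d 0 b0 != 0 by apply/eqP.
have vb0 : v b0 = \sum_(b | b != b0) (- (d 0 b0)^-1 * d 0 b) *: v b.
  apply: (scalerI db0); rewrite scaler_sumr.
  under [RHS]eq_bigr => b _ do rewrite scalerA mulrA mulrN mulfV // mulN1r scaleNr.
  move/eqP: dv0; rewrite (bigD1 b0) //= addr_eq0 => /eqP ->.
  by rewrite sumrN.
have wsum (I : seq 'I_q) (P : pred 'I_q) c : (forall b, P b -> b != b0) ->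
    wedge (upd v b0 (\sum_(b <- I | P b) c b *: v b)) = 0.
  move=> Pb0; apply: (big_ind (fun x => wedge (upd v b0 x) = 0)).
  - have := wedge_linear v b0 (-1) 0 0; rewrite scaler0 addr0 scaleN1r.
    by rewrite addNr.
  - by move=> x y x0 y0; rewrite -[x]scale1r wedge_linear x0 y0 scaler0 addr0.
  - move=> b /Pb0 bb0; rewrite -[c b *: v b]addr0 wedge_linear.
    rewrite (wedge_alternate (i := b0) (j := b)) 1?eq_sym // /upd ?eqxx ?(negPf bb0) //.
    have := wedge_linear v b0 (-1) 0 0; rewrite scaler0 addr0 scaleN1r addNr.
    by rewrite scaler0 add0r.
have := wsum (index_enum _) _ (fun b => - (d 0 b0)^-1 * d 0 b) (fun b h => h).
rewrite -vb0 => <-; congr wedge.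
by apply/funext=> j; rewrite /upd; case: eqP => // ->.
Qed.

End Wedges.

Section Fibers.
Variables (k : fieldType) (S : scheme k) (s : geometric_point S).
Local Notation O := (str S).
Implicit Types (E F : omodule S) (U V W : opens S).

Lemma geval_nonunit U (xU : oset U (gpt s)) (a : O U) :
  ~ invertible_at (gpt s) a -> geval xU a = 0.
Proof.
move=> na; apply/eqP/negPn/negP => nz; apply: na; exact: geval_local nz.
Qed.

Lemma fiber_valueP E U (xU : oset U (gpt s)) a (t u : E U) :
  fiber_value (Germ xU (a *: t + u)) =
  geval xU a *: fiber_value (Germ xU t) + fiber_value (Germ xU u).
Proof.
have := pres_gen_rel (fiber_linear xU a t u).
rewrite !big_cons big_nil addr0 /= scale1r !scaleNr scale1r -opprD => /eqP.
by rewrite subr_eq0 => /eqP.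
Qed.

Lemma fiber_value_res E U V (h : V `<=` U) (xU : oset U (gpt s)) (xV : oset V (gpt s))
    (t : E U) : fiber_value (Germ xV (mres E h t)) = fiber_value (Germ xU t).
Proof.
have := pres_gen_rel (fiber_germ h xU xV t).
by rewrite !big_cons big_nil addr0 /= scale1r scaleN1r => /eqP; rewrite subr_eq0 => /eqP.
Qed.

Lemma fiber_value0 E U (xU : oset U (gpt s)) : fiber_value (Germ xU (0 : E U)) = 0.
Proof.
have := fiber_valueP xU (-1) (0 : E U) 0.
by rewrite scaler0 addr0 rmorphN1 scaleN1r addNr.
Qed.

Lemma fiber_value_lincomb E n U V (e : 'I_n -> E U) (h : V `<=` U)
    (xU : oset U (gpt s)) (xV : oset V (gpt s)) a :
  fiber_value (Germ xV (lincomb e h a)) =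
  \sum_i geval xV (a i) *: fiber_value (Germ xU (e i)).
Proof.
apply: (big_ind2 (fun t p => fiber_value (Germ xV t) = p)).
- exact: fiber_value0.
- by move=> t p u q <- <-; rewrite -[t]scale1r fiber_valueP rmorph1 !scale1r.
- move=> i _; rewrite -[_ *: mres _ _ _]addr0 fiber_valueP fiber_value0 addr0.
  by rewrite (fiber_value_res h xU).
Qed.

Lemma fiber_ind E (P : fiber E s -> Prop) : P 0 ->
  (forall c g p, P p -> P (c *: fiber_value g + p)) -> forall p, P p.
Proof. exact: pres_ind. Qed.

Lemma fiber_mapP E F (f : omor E F) c (p q : fiber E s) :
  fiber_map f s (c *: p + q) = c *: fiber_map f s p + fiber_map f s q.
Proof.
pose w (t : germ E s) := fiber_value (Germ (gmem t) (f _ (gsec t))).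
have H u : fiber_rel u -> fsum (@idfun (gfield s) : {rmorphism _ -> _}) w u = 0.
  case=> [U xU a t v|U V h xU xV t]; rewrite /fsum !big_cons big_nil addr0 /= /w /=.
    by rewrite linearP fiber_valueP scale1r !scaleNr scale1r -opprD; exact: subrr.
  by rewrite ofun_res (fiber_value_res h xU) scale1r scaleN1r subrr.
by rewrite [LHS](pres_liftD H) (pres_liftZ H).
Qed.

Lemma fiber_map0 E F (f : omor E F) : fiber_map f s 0 = 0.
Proof.
have := fiber_mapP f (-1) 0 0.
by rewrite scaler0 addr0 scaleN1r addNr.
Qed.

Lemma fiber_ext_zero_span E F (f : omor E F) q p (u : 'I_p -> fiber F s) :
  (p < q)%N ->
  (forall g, exists c : 'I_p -> gfield s, fiber_map f s (fiber_value g) = \sum_a c a *: u a) ->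
  fiber_ext_zero q f s.
Proof.
move=> lt_pq span.
have spanv v : exists c : 'I_p -> gfield s, fiber_map f s v = \sum_a c a *: u a.
  elim/fiber_ind: v => [|c g v [d dv]].
    by exists (fun=> 0); rewrite fiber_map0 big1 // => a _; rewrite scale0r.
  have [d' dg] := span g; exists (fun a => c * d' a + d a).
  rewrite fiber_mapP dv dg scaler_sumr -big_split /=.
  by apply: eq_bigr => a _; rewrite scalerDl scalerA.
pose w (v : 'I_q -> fiber E s) := wedge (fiber_map f s \o v).
have H t : ext_rel t -> fsum (@idfun (gfield s) : {rmorphism _ -> _}) w t = 0.
  exact: (ext_map_rel (sigma := idfun) (fiber_mapP f)).
rewrite /fiber_ext_zero => t; rewrite /ext_map -/w; elim/pres_ind: t => [|c v t IH].
  have := pres_liftD H 0 0; rewrite addr0 => /eqP.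
  by rewrite -[X in X == _]addr0 (inj_eq (addrI _)) => /eqP <-.
rewrite (pres_liftD H) (pres_liftZ H) IH addr0 (pres_liftE H).
have [C vC] := choice (fun b => spanv (v b)).
rewrite /w (@wedge_lowrank _ _ _ _ _ u (\matrix_(b, a) C b a) lt_pq) ?scaler0 // => b.
by rewrite /= vC; apply: eq_bigr => a _; rewrite mxE.
Qed.

Section FiberCoordinates.
Variables (E : omodule S) (n : nat) (U : opens S) (e : 'I_n -> E U) (fr : frame e).
Variable xU : oset U (gpt s).

Let xC (t : germ E s) : oset (opensI U (gopen t)) (gpt s).
Proof. by split; [exact: xU|exact: gmem]. Qed.

(** The coordinates of a germ, evaluated at s, give the linear forms on the fiber
   that are dual to the frame. *)
Let fc i (t : germ E s) : (gfield s)^o :=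
  geval (xC t) (coord fr (@opensIl _ _ _) (mres E (@opensIr _ _ _) (gsec t)) i).

Lemma fiber_frame_free (c : 'I_n -> gfield s) :
  \sum_i c i *: fiber_value (Germ xU (e i)) = 0 -> forall i, c i = 0.
Proof.
move=> c0 i.
have fcE V (h : V `<=` U) (xV : oset V (gpt s)) (t : germ E s) (hV : V `<=` gopen t) :
    fc i t = geval xV (coord fr h (mres E hV (gsec t)) i).
  have g : V `<=` opensI U (gopen t) by move=> y Vy; split; [exact: h|exact: hV].
  rewrite -[LHS](geval_res g (xC t) xV) -(coord_res fr (@opensIl _ _ _) g h).
  by rewrite (mres_comp _ g hV).
have H u : fiber_rel u -> fsum (@idfun (gfield s) : {rmorphism _ -> _}) (fc i) u = 0.
  case=> [V xV a t v|V W h xV xW t]; rewrite /fsum !big_cons big_nil addr0 /=.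
    rewrite -![_ *: fc _ _]/(_ * _).
    have xUV : oset (opensI U V) (gpt s) by [].
    have fV w := fcE _ (@opensIl _ U V) xUV (Germ xV w) (@opensIr _ U V).
    rewrite !fV /= raddfD /= mresZ coordP rmorphD rmorphM geval_res.
    by rewrite mul1r !mulNr mul1r -opprD subrr.
  have xUW : oset (opensI U W) (gpt s) by [].
  have UWV : opensI U W `<=` V by move=> y [_ /h].
  rewrite (fcE _ (@opensIl _ U W) xUW (Germ xW _) (@opensIr _ U W)).
  rewrite (fcE _ (@opensIl _ U W) xUW (Germ xV t) UWV) /= (mres_comp h _ UWV).
  by rewrite scale1r scaleN1r subrr.
have := congr1 (pres_lift (@idfun (gfield s) : {rmorphism _ -> _}) (fc i)) c0.
rewrite (big_morph _ (pres_liftD H) (_ : _ = 0)); last first.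
  by rewrite -(scale0r (0 : fiber E s)) (pres_liftZ H) scale0r.
rewrite (eq_bigr (fun j => c j * (i == j)%:R)); last first.
  move=> j _; rewrite (pres_liftZ H) (pres_liftE H) /=; congr (_ * _).
  rewrite (fcE U (@subset_refl _ _) xU (Germ xU (e j)) (@subset_refl _ _)) /=.
  by rewrite coord_frame rmorph_nat.
rewrite (bigD1 i) //= eqxx mulr1 big1 ?addr0; last first.
  by move=> j ji; rewrite eq_sym (negPf ji) mulr0.
move=> ->; by rewrite -(scale0r (0 : fiber E s)) (pres_liftZ H) scale0r.
Qed.

End FiberCoordinates.
End Fibers.

(** * Local normal form of a morphism *)

Section OrdinalCons.
Variables (T : Type) (q : nat).

Definition ord_cons (t : T) (g : 'I_q -> T) : 'I_q.+1 -> T :=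
  fun a => oapp g t (unlift ord0 a).

Lemma ord_cons0 t g : ord_cons t g ord0 = t.
Proof. by rewrite /ord_cons unlift_none. Qed.

Lemma ord_consS t g a : ord_cons t g (lift ord0 a) = g a.
Proof. by rewrite /ord_cons liftK. Qed.

Lemma ord_consP (P : 'I_q.+1 -> Prop) :
  P ord0 -> (forall a, P (lift ord0 a)) -> forall a, P a.
Proof. by move=> P0 PS a; case: (unliftP ord0 a) => [b|] ->. Qed.

Lemma ord_cons_inj t g : injective g -> (forall a, g a <> t) -> injective (ord_cons t g).
Proof.
move=> gI gt; elim/ord_consP => [|a]; elim/ord_consP => [|b] //;
  rewrite ?ord_cons0 ?ord_consS //.
- by move=> e; case: (gt b).
- by move=> e; case: (gt a).
- by move=> /gI ->.
Qed.

End OrdinalCons.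

Section TriangularMinors.
Variables (k : fieldType) (S : scheme k) (F : omodule S) (m : nat) (U : opens S).
Variables (f : 'I_m -> F U) (fr : frame f).
Local Notation cF := (coord fr (@subset_refl _ U)).

(** The first row is zero outside the first column. *)
Lemma minor_cons q i (g : 'I_q -> 'I_m) t (v : 'I_q -> F U) :
  (forall a, cF t (g a) = 0) ->
  minor fr (@subset_refl _ U) (ord_cons i g) (ord_cons t v) =
  cF t i * minor fr (@subset_refl _ U) g v.
Proof.
move=> tg; rewrite /minor (expand_det_row _ ord0) big_ord_recl big1 ?addr0.
  rewrite mxE !ord_cons0; congr (_ * _); rewrite /cofactor expr0 mul1r.
  by congr (\det _); apply/matrixP=> b a; rewrite !mxE !ord_consS.
by move=> a _; rewrite mxE ord_cons0 ord_consS tg mul0r.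
Qed.

Lemma minor_frame q (g : 'I_q -> 'I_m) : injective g ->
  minor fr (@subset_refl _ U) g (fun b => f (g b)) = 1.
Proof.
move=> gI; rewrite /minor (_ : \matrix_(_, _) _ = 1%:M) ?det1 //.
apply/matrixP=> b a; rewrite !mxE -[f _](mres_id (@subset_refl _ U)) coord_frame.
by rewrite (inj_eq gI) eq_sym.
Qed.

End TriangularMinors.

Section NormalForm.
Variables (k : fieldType) (S : scheme k) (E F : omodule S) (phi : omor E F).
Local Notation O := (str S).
Implicit Types U V W : opens S.

(** The state of the elimination after q pivots, read off from the image of phi alone:
   the sections w are the columns of the block that remains. *)
Record partial_normal_form q V m (f : 'I_m -> F V) (fr : frame f) (g : 'I_q -> 'I_m)
    n (w : 'I_n -> F V) : Prop := PartialNormalForm {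
  pnf_inj : injective g;
  pnf_coord : forall l a, coord fr (@subset_refl _ V) (w l) (g a) = 0;
  pnf_img_frame : forall a, exists s, phi V s = f (g a);
  pnf_img_rest : forall l, exists s, phi V s = w l;
  pnf_span : forall V' (h : V' `<=` V) s, exists c d,
    phi V' s = lincomb (fun a => f (g a)) h c + lincomb w h d }.

Lemma coord_frame_refl V m (f : 'I_m -> F V) (fr : frame f) i j :
  coord fr (@subset_refl _ V) (f j) i = (i == j)%:R.
Proof. by rewrite -[f j](mres_id (@subset_refl _ V)) coord_frame. Qed.

Lemma coord_frame_res_refl V V' (h : V' `<=` V) m (f : 'I_m -> F V) (fr : frame f)
    (fr' : frame (fun i => mres F h (f i))) t i :
  coord fr' (@subset_refl _ V') (mres F h t) i = rres O h (coord fr (@subset_refl _ V) t i).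
Proof.
by rewrite (coord_frame_res fr _ _ h) (coord_res fr (@subset_refl _ V)).
Qed.

Lemma pnf_res q V V' (h : V' `<=` V) m (f : 'I_m -> F V) (fr : frame f) (g : 'I_q -> 'I_m)
    n (w : 'I_n -> F V) : partial_normal_form fr g w ->
  partial_normal_form (frame_res h fr) g (fun l => mres F h (w l)).
Proof.
case=> gI wg imf imw span; split => //.
- by move=> l a; rewrite coord_frame_res_refl wg rmorph0.
- by move=> a; have [s <-] := imf a; exists (mres E h s); rewrite ofun_res.
- by move=> l; have [s <-] := imw l; exists (mres E h s); rewrite ofun_res.
- move=> V2 h2 s; have [c [d e]] := span V2 (subset_trans h2 h) s; exists c, d.
  by rewrite !(lincomb_of_res _ h h2 (subset_trans h2 h)).
Qed.

Section Pivot.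
Variables (V : opens S) (m : nat) (f : 'I_m -> F V) (fr : frame f).
Variables (i0 : 'I_m) (v : F V) (u : O V).
Local Notation cF := (coord fr (@subset_refl _ V)).
Hypothesis uv : u * cF v i0 = 1.

Let fr' := frame_replace uv.
Local Notation cF' := (coord fr' (@subset_refl _ V)).

(** In the frame where v replaces f i0, the component of t along v is cF t i0 * u. *)
Definition clear_pivot t := t - (cF t i0 * u) *: v.

Lemma coord_clear_pivot0 t : cF' (clear_pivot t) i0 = 0.
Proof.
rewrite coord_frame_replace eqxx rres_id /clear_pivot -scaleNr addrC coordP.
by rewrite mulNr -mulrA uv mulr1 addNr mul0r.
Qed.

Lemma coord_clear t i : i != i0 -> cF t i = 0 -> cF v i = 0 -> cF' (clear_pivot t) i = 0.
Proof.
move=> /negPf ii0 ti vi; rewrite coord_frame_replace ii0 mres_id vi mulr0 subr0.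
by rewrite /clear_pivot -scaleNr addrC coordP ti vi mulr0 addr0.
Qed.

Lemma lincomb_clear n (w : 'I_n -> F V) V' (h : V' `<=` V) d :
  lincomb w h d = lincomb (fun l => clear_pivot (w l)) h d +
    (\sum_l d l * rres O h (cF (w l) i0 * u)) *: mres F h v.
Proof.
rewrite /lincomb scaler_suml -big_split; apply: eq_bigr => l _ /=.
by rewrite /clear_pivot raddfB /= mresZ scalerBr scalerA subrK.
Qed.

Lemma lincomb_replace_cons q (g : 'I_q -> 'I_m) V' (h : V' `<=` V) c :
  (forall a, g a <> i0) ->
  lincomb (fun a => replace_vec f i0 v (ord_cons i0 g a)) h c =
  c ord0 *: mres F h v + lincomb (fun a => f (g a)) h (fun a => c (lift ord0 a)).
Proof.
move=> gi0; rewrite /lincomb big_ord_recl !ord_cons0 /replace_vec eqxx; congr (_ + _).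
apply: eq_bigr => a _; rewrite !ord_consS.
by have /eqP/negPf -> := gi0 a.
Qed.

Lemma pnf_pivot q (g : 'I_q -> 'I_m) n (w : 'I_n -> F V) :
  partial_normal_form fr g w -> (forall a, g a <> i0) ->
  (forall a, cF v (g a) = 0) -> (exists s, phi V s = v) ->
  partial_normal_form fr' (ord_cons i0 g) (fun l => clear_pivot (w l)).
Proof.
case=> gI wg imf imw span gi0 vg [sv sE].
have gi0b a : (g a == i0) = false by apply/eqP.
split.
- exact: ord_cons_inj.
- move=> l; elim/ord_consP => [|a]; rewrite ?ord_cons0 ?ord_consS.
    exact: coord_clear_pivot0.
  by apply: coord_clear => //; rewrite gi0b.
- elim/ord_consP => [|a]; rewrite ?ord_cons0 ?ord_consS /replace_vec ?eqxx ?gi0b //.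
  by exists sv.
- move=> l; have [s <-] := imw l; exists (s - (cF (phi V s) i0 * u) *: sv).
  by rewrite linearB linearZ /= sE.
- move=> V' h s; have [c [d ->]] := span V' h s.
  exists (ord_cons (\sum_l d l * rres O h (cF (w l) i0 * u)) c), d.
  rewrite (lincomb_clear w) lincomb_replace_cons // ord_cons0.
  rewrite (_ : lincomb (fun a => f (g a)) h _ = lincomb (fun a => f (g a)) h c); last first.
    by apply: eq_bigr => a _; rewrite ord_consS.
  by rewrite addrCA [RHS]addrC [X in _ = _ + X]addrC.
Qed.

End Pivot.

Lemma pnf_init x (hE : vector_bundle E) (hF : vector_bundle F) :
  exists V m (f : 'I_m -> F V) (fr : frame f) n (e : 'I_n -> E V) (g : 'I_0 -> 'I_m),
    [/\ oset V x, frame e & partial_normal_form fr g (fun l => phi V (e l))].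
Proof.
have [n /(_ x)[U1 [e [U1x fe]]]] := hE; have [m /(_ x)[U2 [f [U2x ff]]]] := hF.
pose V := opensI U1 U2; have h1 : V `<=` U1 := @opensIl _ _ _.
have h2 : V `<=` U2 := @opensIr _ _ _.
have g : 'I_0 -> 'I_m by case.
exists V, m, _, (frame_res h2 ff), n, (fun l => mres E h1 (e l)), g.
split; [by []|exact: frame_res h1 fe|].
split; [by case|by move=> l []|by case|by move=> l; exists (mres E h1 (e l))|].
move=> V' h s; exists (fun=> 0), (coord (frame_res h1 fe) h s).
by rewrite lincomb0 add0r -omor_lincomb coordK.
Qed.

(** When no component can serve as a pivot at a geometric point, all the sections
   w vanish there, and the image of phi has dimension q in the fiber. *)
Lemma pnf_fiber q V m (f : 'I_m -> F V) (fr : frame f) (g : 'I_q -> 'I_m)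
    n (w : 'I_n -> F V) p (s : geometric_point S) : partial_normal_form fr g w ->
  oset V (gpt s) -> (q < p)%N ->
  (forall l i, ~ invertible_at (gpt s) (coord fr (@subset_refl _ V) (w l) i)) ->
  fiber_ext_zero p phi s.
Proof.
move=> nf Vx lt_qp w0.
apply: (@fiber_ext_zero_span _ _ _ _ _ _ _ q (fun a => fiber_value (Germ Vx (f (g a))))) => //.
move=> [U xU t]; rewrite fiber_map_value /=.
have xC : oset (opensI U V) (gpt s) by [].
rewrite -(fiber_value_res (@opensIl _ U V) xU xC) -ofun_res.
have [c [d ->]] := pnf_span nf (@opensIr _ U V) (mres E (@opensIl _ U V) t).
exists (fun a => geval xC (c a)); rewrite -[lincomb _ _ c]scale1r fiber_valueP rmorph1 scale1r.
rewrite !(fiber_value_lincomb _ _ Vx) [X in _ + X]big1 ?addr0 // => l _.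
rewrite -[w l](coordK fr (@subset_refl _ V)) (fiber_value_lincomb _ _ Vx).
by rewrite big1 ?scaler0 // => i _; rewrite geval_nonunit ?scale0r.
Qed.

Lemma pnf_exists x r (hE : vector_bundle E) (hF : vector_bundle F) :
  (forall s : geometric_point S, ~ fiber_ext_zero r phi s) ->
  forall q, (q <= r)%N ->
  exists V m (f : 'I_m -> F V) (fr : frame f) (g : 'I_q -> 'I_m) n (w : 'I_n -> F V),
    oset V x /\ partial_normal_form fr g w.
Proof.
move=> hs; elim=> [|q IH] le_qr.
  have [V [m [f [fr [n [e [g [Vx _ nf]]]]]]]] := pnf_init x hE hF.
  by exists V, m, f, fr, g, n, (fun l => phi V (e l)).
have [V [m [f [fr [g [n [w [Vx nf]]]]]]]] := IH (ltnW le_qr).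
have [[l0 [i0 [V' [h [V'x [u uw]]]]]]|nw] := pselect (exists l i,
    invertible_at x (coord fr (@subset_refl _ V) (w l) i)); last first.
  have [s sx] := geometric_point_exists x; rewrite -sx in Vx nw.
  case: (hs s); apply: (pnf_fiber nf Vx le_qr) => l i il.
  by apply: nw; exists l, i.
rewrite mulrC -(coord_frame_res_refl fr (frame_res h fr)) in uw.
eexists V', m, _, (frame_replace uw), (ord_cons i0 g), n, _; split=> //.
have nf' := pnf_res h nf.
apply: (pnf_pivot uw nf'); [move=> a gi0|exact: pnf_coord nf' _|exact: pnf_img_rest nf' _].
have := invertible_at0 V'x; apply; exists V', (@subset_refl _ V'); split => //; exists u.
by rewrite rres_id -uw -gi0 (pnf_coord nf') mulr0 mul0r.
Qed.

(** The diagonal form with entries d, 1, ..., 1, 0, ..., 0, read off from the image of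
   phi alone: a frame of E in which phi is diagonal is not recorded. *)
Record normal_form r V (d : O V) m (f : 'I_m -> F V) (G : 'I_r.+1 -> 'I_m) : Prop :=
  NormalForm {
    nf_frame : frame f;
    nf_inj : injective G;
    nf_image : forall V' (h : V' `<=` V) t, (exists s, phi V' s = t) <->
      exists c, t = lincomb (fun a => f (G a)) h c /\ exists c0, c ord0 = c0 * rres O h d }.

Section LocalNormalForm.
Variables (x : S) (r : nat) (U : opens S) (d : O U).
Hypotheses (hE : vector_bundle E) (hF : vector_bundle F).
Hypothesis phi_rank : ext_zero r.+2 phi.
Hypothesis phi_fiber : forall s : geometric_point S, ~ fiber_ext_zero r phi s.
Hypothesis Ux : oset U x.
Hypothesis d_regular : forall V (h : V `<=` U) a, a * rres O h d = 0 -> a = 0.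
Hypothesis d_minors : forall V (h : V `<=` U) b,
  minors_ideal phi r.+1 b <-> exists a, b = a * rres O h d.

Lemma regular_inj V (h : V `<=` U) a b : a * rres O h d = b * rres O h d -> a = b.
Proof.
by move=> ab; apply/subr0_eq; apply: (d_regular (h := h)); rewrite mulrBl ab subrr.
Qed.

(** Otherwise the minors of size r + 1 would lie in d times the maximal ideal at x,
   while they generate the ideal of d. *)
Lemma pnf_unit V (h : V `<=` U) m (f : 'I_m -> F V) (fr : frame f) (g : 'I_r -> 'I_m)
    n (w : 'I_n -> F V) (b : 'I_n -> 'I_m -> O V) : oset V x ->
  partial_normal_form fr g w ->
  (forall l i, coord fr (@subset_refl _ V) (w l) i = b l i * rres O h d) ->
  exists l i, invertible_at x (b l i).
Proof.
move=> Vx nf wb; apply: contrapT => nb.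
have {}nb l i : ~ invertible_at x (b l i) by move=> bl; apply: nb; exists l, i.
have : minors_ideal phi r.+1 (rres O h d).
  by apply/(d_minors h); exists 1; rewrite mul1r.
move=> /minors_ideal_local/(_ Vx)[V1 [h1 [m1 [f1 [fr1 [V1x gen]]]]]].
have h1U := subset_trans h1 h.
(* W is d times the ideal of the functions that are not invertible at x. *)
pose W := [set a | exists2 a', a = a' * rres O h1U d & ~ invertible_at x a'].
have hW : ideal W.
  split.
  - by exists 0; [rewrite mul0r|exact: invertible_at0].
  - move=> _ _ [a -> na] [a' -> na']; exists (a + a'); first by rewrite mulrDl.
    by move=> /(invertible_atD V1x)[].
  - move=> c _ [a -> na]; exists (c * a); first by rewrite mulrA.
    by move=> /invertible_atM[].
have : W (rres O h1 (rres O h d)).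
  apply: gen => // g1 s.
  have /choice[c] : forall a, exists c, exists e, phi V1 (s a) =
      lincomb (fun a => f (g a)) h1 c + lincomb w h1 e.
    by move=> a; exact: pnf_span nf _ h1 (s a).
  move=> /choice[e es].
  apply: (@minor_ideal _ _ _ _ _ _ fr1 W _ _ g1 _ c
    (fun a => mres F h1 (f (g a))) hW (ltnSn r)).
  move=> a i; rewrite es -[X in _ - X]/(lincomb (fun a => f (g a)) h1 (c a)) addrAC subrr add0r.
  rewrite /lincomb coord_sum; apply: ideal_sum => // l.
  rewrite coordZ; apply: idealMl => //.
  rewrite -[w l](coordK fr (@subset_refl _ V)) (lincomb_res _ _ _ h1) /lincomb coord_sum.
  apply: ideal_sum => // i'; rewrite coordZ mulrC; apply: idealMl => //.
  exists (rres O h1 (b l i')); last by rewrite invertible_at_res.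
  by rewrite wb rmorphM (rres_comp h h1 h1U).
rewrite (rres_comp h h1 h1U) => -[a' e na']; apply: na'.
have <- : 1 = a' by apply: (regular_inj (h := h1U)); rewrite mul1r.
exact: invertible_at1.
Qed.

(** After r pivots the remaining sections are w = d b with some b invertible at x.
   With v the vector of coordinates b l0, pivoting on w l0 = d v clears all of w: d
   times a coordinate of a remainder is a minor of size r + 2 of sections of the
   image of phi. *)
Lemma normal_form_exists :
  exists V (h : V `<=` U) m (f : 'I_m -> F V) (G : 'I_r.+1 -> 'I_m),
    oset V x /\ normal_form (rres O h d) f G.
Proof.
have [V0 [m [f0 [fr0 [g [n [w0 [V0x nf0]]]]]]]] := pnf_exists x hE hF phi_fiber (leqnn r).
have [U1 [_ [_ [_ [p [e [_ [U1x fe _]]]]]]]] := pnf_init x hE hF.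
pose V := opensI V0 (opensI U U1).
have Vx : oset V x by [].
have hV0 : V `<=` V0 by move=> y [].
have h : V `<=` U by move=> y [_ []].
have hU1 : V `<=` U1 by move=> y [_ []].
have {nf0} := pnf_res hV0 nf0; move: (frame_res hV0 fr0).
move: (fun i => _) (fun l => _) => w f fr nf {f0 fr0 w0}.
have {}fe := frame_res hU1 fe; move: (fun i => _) fe => {}e fe.
(* A coordinate of w l is a minor of size r + 1, as the f (g a) are in the image. *)
have wI l i : exists b, coord fr (@subset_refl _ V) (w l) i = b * rres O h d.
  apply/(d_minors h).
  have [s sE] := choice (pnf_img_frame nf); have [t tE] := pnf_img_rest nf l.
  have := minor_in_minors_ideal phi fr (ord_cons t s) (ord_cons i g) fe.
  rewrite (_ : (fun b => _) = ord_cons (w l) (fun a => f (g a))).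
    by rewrite minor_cons ?(minor_frame _ (pnf_inj nf)) ?mulr1 // => a; exact: pnf_coord nf _ _.
  apply/funext; elim/ord_consP => [|a]; by rewrite ?ord_cons0 ?ord_consS.
have {}wI l : exists b, forall i, coord fr (@subset_refl _ V) (w l) i = b i * rres O h d.
  by have [b] := choice (wI l); exists b.
have [b bE] := choice wI.
have [l0 [i0 [V' [h' [V'x [u ub]]]]]] := pnf_unit Vx nf bE.
have h2 := subset_trans h' h.
pose b' l i := rres O h' (b l i); pose f' i := mres F h' (f i).
pose w' l := mres F h' (w l); pose d' := rres O h2 d.
pose fr' : frame f' := frame_res h' fr.
have nf' : partial_normal_form fr' g w' := pnf_res h' nf.
pose cF := coord fr' (@subset_refl _ V').
have wb l i : cF (w' l) i = b' l i * d'.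
  by rewrite /cF (coord_frame_res_refl fr) bE rmorphM (rres_comp h h' h2).
pose v := lincomb f' (@subset_refl _ V') (b' l0).
have vb i : cF v i = b' l0 i by exact: coord_lincomb.
have uv : u * cF v i0 = 1 by rewrite vb mulrC.
have wv : w' l0 = d' *: v.
  apply: (coord_inj (fr := fr') (h := @subset_refl _ V')) => i.
  by rewrite coordZ -!/(cF _ _) wb vb mulrC.
have bg a : b' l0 (g a) = 0.
  apply: (d_regular (h := h2)); rewrite -/d' -wb; exact: pnf_coord nf' _ _.
have gi0 a : g a <> i0.
  move=> ga; apply: (invertible_at0 V'x); exists V', (@subset_refl _ V'); split => //.
  by exists u; rewrite rres_id -uv vb -ga bg mulr0 mul0r.
pose fr2 := frame_replace uv.
have [s sE] := choice (pnf_img_frame nf').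
have [s0 s0E] := pnf_img_rest nf' l0.
have clear0 l : clear_pivot fr' i0 v u (w' l) = 0.
  apply: (coord_inj (fr := fr2) (h := @subset_refl _ V')) => i.
  rewrite coord0; apply: (d_regular (h := h2)); rewrite -/d'.
  have [t tE] := pnf_img_rest nf' l.
  (* As w l0 = d v, the remainder of w l is the image of a section. *)
  have t'E : phi V' (t - (b' l i0 * u) *: s0) = clear_pivot fr' i0 v u (w' l).
    rewrite linearB linearZ /= tE s0E wv scalerA /clear_pivot -/(cF _ _) wb.
    by rewrite -!mulrA [d' * u]mulrC.
  have [->|ii0] := eqVneq i i0; first by rewrite coord_clear_pivot0 mul0r.
  have := ext_zero_minor fr2 (ord_cons (t - (b' l i0 * u) *: s0) (ord_cons s0 s))
    (ord_cons i (ord_cons i0 g)) phi_rank.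
  have gi0b a : (g a == i0) = false by apply/eqP.
  have f2g a : replace_vec f' i0 v (g a) = f' (g a) by rewrite /replace_vec gi0b.
  have f2i : replace_vec f' i0 v i0 = v by rewrite /replace_vec eqxx.
  have cv i' : coord fr2 (@subset_refl _ V') v i' = (i' == i0)%:R.
    by rewrite -(coord_frame_refl fr2 i' i0) f2i.
  rewrite (_ : (fun b => _) = ord_cons (clear_pivot fr' i0 v u (w' l))
     (ord_cons (d' *: v) (fun a => replace_vec f' i0 v (g a)))); last first.
    apply/funext; elim/ord_consP => [|]; first by rewrite !ord_cons0.
    by elim/ord_consP => [|a]; rewrite !ord_consS ?ord_cons0 ?ord_consS ?s0E ?wv ?sE ?f2g.
  rewrite !minor_cons => [|a|]; last 2 first.
  - by rewrite coordZ cv gi0b mulr0.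
  - elim/ord_consP => [|a]; rewrite ?ord_cons0 ?ord_consS; first exact: coord_clear_pivot0.
    apply: coord_clear; rewrite ?gi0b //; last by rewrite -/(cF _ _) vb bg.
    exact: pnf_coord nf' _ _.
  rewrite (minor_frame _ (pnf_inj nf')) mulr1 coordZ cv eqxx mulr1.
  by [].
exists V', h2, m, (replace_vec f' i0 v), (ord_cons i0 g); split; first exact: V'x.
split; [exact: fr2|exact: ord_cons_inj (pnf_inj nf') gi0|].
move=> V2 k2 t; split=> [[z <-]|[c [-> [c0 cE]]]].
  have [c [e' ->]] := pnf_span nf' k2 z.
  exists (ord_cons (\sum_l e' l * rres O k2 (cF (w' l) i0 * u)) c).
  rewrite lincomb_replace_cons // ord_cons0; split.
    rewrite (lincomb_clear fr' i0 v u w') addrC; congr (_ + _); last first.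
      by apply: eq_bigr => a _; rewrite ord_consS.
    by rewrite /lincomb big1 ?add0r // => l _; rewrite clear0 raddf0 scaler0.
  exists (\sum_l e' l * rres O k2 (b' l i0 * u)).
  rewrite mulr_suml; apply: eq_bigr => l _; rewrite wb -[RHS]mulrA -rmorphM.
  by rewrite -!mulrA [u * _]mulrC.
exists (c0 *: mres E k2 s0 + lincomb s k2 (fun a => c (lift ord0 a))).
rewrite linearP /= omor_lincomb lincomb_replace_cons // ofun_res s0E wv cE mresZ scalerA.
by congr (_ + _); apply: eq_bigr => a _; rewrite sE.
Qed.

End LocalNormalForm.
End NormalForm.

(** * Fiberwise monomorphisms *)

Section SubFrames.
Variables (k : fieldType) (S : scheme k) (F : omodule S) (m : nat) (U : opens S).
Variables (f : 'I_m -> F U) (fr : frame f) (q : nat) (G : 'I_q -> 'I_m).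
Hypothesis G_inj : injective G.
Local Notation O := (str S).
Implicit Types V : opens S.

Lemma sum_over_image (T : nmodType) (X : 'I_m -> T) :
  (forall i, (forall a, G a <> i) -> X i = 0) -> \sum_i X i = \sum_a X (G a).
Proof.
move=> X0; rewrite (bigID (mem (imset G (mem predT)))) /= [X in _ + X]big1 ?addr0; last first.
  by move=> i /negP ni; apply: X0 => a e; apply: ni; rewrite -e imset_f.
rewrite big_imset /=; last by move=> a b _ _ /G_inj.
by [].
Qed.

Lemma coord_subframe V (h : V `<=` U) c a :
  coord fr h (lincomb (fun a => f (G a)) h c) (G a) = c a.
Proof.
rewrite /lincomb coord_sum (bigD1 a) //= coordZ coord_frame eqxx mulr1.
rewrite big1 ?addr0 // => b /negPf ba.
by rewrite coordZ coord_frame (inj_eq G_inj) eq_sym ba mulr0.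
Qed.

Lemma coord_subframe_out V (h : V `<=` U) c i : (forall a, G a <> i) ->
  coord fr h (lincomb (fun a => f (G a)) h c) i = 0.
Proof.
move=> Gi; rewrite /lincomb coord_sum big1 // => b _.
by rewrite coordZ coord_frame eq_sym; have /eqP/negPf -> := Gi b; rewrite mulr0.
Qed.

Lemma lincomb_subframe V (h : V `<=` U) t :
  (forall i, (forall a, G a <> i) -> coord fr h t i = 0) ->
  t = lincomb (fun a => f (G a)) h (fun a => coord fr h t (G a)).
Proof.
move=> t0; rewrite -{1}(coordK fr h t) /lincomb; apply: sum_over_image => i Gi.
by rewrite t0 // scale0r.
Qed.

End SubFrames.

Section FiberFrames.
Variables (k : fieldType) (S : scheme k) (s : geometric_point S).
Variables (E : omodule S) (n : nat) (U : opens S) (e : 'I_n -> E U) (fr : frame e).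
Variable xU : oset U (gpt s).

Lemma fiber_frame_span (p : fiber E s) :
  exists c : 'I_n -> gfield s, p = \sum_i c i *: fiber_value (Germ xU (e i)).
Proof.
elim/fiber_ind: p => [|c [V xV t] p [d ->]].
  by exists (fun=> 0); rewrite big1 // => i _; rewrite scale0r.
have xC : oset (opensI U V) (gpt s) by [].
rewrite -(fiber_value_res (@opensIr _ U V) xV xC).
rewrite -(coordK fr (@opensIl _ U V) (mres E _ t)) (fiber_value_lincomb _ _ xU).
eexists (fun i => c * _ + d i); rewrite scaler_sumr -big_split; apply: eq_bigr => i _ /=.
by rewrite scalerDl -scalerA.
Qed.

End FiberFrames.

Section FiberwiseMono.
Variables (k : fieldType) (S : scheme k) (M F : omodule S) (j : omor M F).
Local Notation O := (str S).
Implicit Types U V W : opens S.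

Lemma fiber_map_sum (s : geometric_point S) n (c : 'I_n -> gfield s) (p : 'I_n -> fiber M s) :
  fiber_map j s (\sum_i c i *: p i) = \sum_i c i *: fiber_map j s (p i).
Proof.
apply: (big_ind2 (fun p q => fiber_map j s p = q)).
- exact: fiber_map0.
- by move=> p1 q1 p2 q2 <- <-; rewrite -[p1]scale1r fiber_mapP !scale1r.
- by move=> i _; rewrite -[_ *: p i]addr0 fiber_mapP fiber_map0 addr0.
Qed.

Lemma fiberwise_mono_of_frames (s : geometric_point S) U m n (h : 'I_n -> M U)
    (f : 'I_m -> F U) (G : 'I_n -> 'I_m) : oset U (gpt s) ->
  frame h -> frame f -> injective G -> (forall a, j U (h a) = f (G a)) ->
  injective (fiber_map j s).
Proof.
move=> xU fh ff GI jh p q pq; apply/eqP; rewrite -subr_eq0.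
have {pq} : fiber_map j s (p - q) = 0.
  by rewrite -scaleN1r addrC fiber_mapP scaleN1r pq addNr.
move: (p - q) => {p q} z; have [c ->] := fiber_frame_span fh xU z.
rewrite fiber_map_sum => z0; apply/eqP; rewrite big1 // => a _.
pose d i := \sum_a c a * (i == G a)%:R.
suff /(fiber_frame_free ff (xU := xU))/(_ (G a)) :
    \sum_i d i *: fiber_value (Germ xU (f i)) = 0.
  rewrite /d (bigD1 a) //= eqxx mulr1 big1 ?addr0; first by move=> ->; rewrite scale0r.
  by move=> b /negPf ba; rewrite (inj_eq GI) eq_sym ba mulr0.
rewrite -[RHS]z0 /d; under eq_bigr => i _ do rewrite scaler_suml.
rewrite exchange_big; apply: eq_bigr => b _ /=; rewrite (bigD1 (G b)) //= eqxx mulr1.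
rewrite big1 ?addr0; first by rewrite fiber_map_value /= jh.
by move=> i /negPf ib; rewrite ib mulr0 scale0r.
Qed.

(** Otherwise the value of j (h a0) at s would be a combination of the values of the
   f (G a), hence, as j is injective there, that of h a0 a combination of those of
   the h (c a). *)
Lemma fiberwise_mono_pivot (s : geometric_point S) U m n (h : 'I_n -> M U)
    (f : 'I_m -> F U) (fr : frame f) q (c : 'I_q -> 'I_n) (G : 'I_q -> 'I_m) a0 :
  oset U (gpt s) -> frame h -> injective G -> injective (fiber_map j s) ->
  (forall a, j U (h (c a)) = f (G a)) -> (forall a, c a <> a0) ->
  exists i0, (forall a, G a <> i0) /\
    invertible_at (gpt s) (coord fr (@subset_refl _ U) (j U (h a0)) i0).
Proof.
move=> xU fh GI jI jh ca0; apply: contrapT => ni.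
have {}ni i : (forall a, G a <> i) ->
    ~ invertible_at (gpt s) (coord fr (@subset_refl _ U) (j U (h a0)) i).
  by move=> Gi ii; apply: ni; exists i.
pose gam a := geval xU (coord fr (@subset_refl _ U) (j U (h a0)) (G a)).
have vE : fiber_value (Germ xU (j U (h a0))) =
    \sum_a gam a *: fiber_value (Germ xU (f (G a))).
  rewrite -{1}[j U (h a0)](coordK fr (@subset_refl _ U)) (fiber_value_lincomb _ _ xU).
  by apply: sum_over_image => // i Gi; rewrite geval_nonunit ?scale0r //; exact: ni.
have rel : fiber_value (Germ xU (h a0)) - \sum_a gam a *: fiber_value (Germ xU (h (c a))) = 0.
  apply: jI; rewrite fiber_map0 -scaleN1r addrC fiber_mapP fiber_map_value /= vE.
  rewrite fiber_map_sum; under eq_bigr do rewrite fiber_map_value /= jh.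
  by rewrite scaleN1r addNr.
pose d i := (i == a0)%:R - \sum_a gam a * (i == c a)%:R.
have /(fiber_frame_free fh (xU := xU))/(_ a0)/eqP :
    \sum_i d i *: fiber_value (Germ xU (h i)) = 0.
  rewrite -[RHS]rel /d; under eq_bigr do rewrite scalerBl; rewrite sumrB; congr (_ - _).
    rewrite (bigD1 a0) //= eqxx scale1r big1 ?addr0 // => i /negPf->.
    by rewrite scale0r.
  under eq_bigr do rewrite scaler_suml.
  rewrite exchange_big; apply: eq_bigr => b _ /=; rewrite (bigD1 (c b)) //= eqxx mulr1.
  by rewrite big1 ?addr0 // => i /negPf ->; rewrite mulr0 scale0r.
rewrite /d eqxx big1 ?subr0 ?oner_eq0 // => a _.
by rewrite eq_sym; have /eqP/negPf -> := ca0 a; rewrite mulr0.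
Qed.

(** The images of a frame of M replace, one at a time, vectors of a frame of F. *)
Lemma fiberwise_mono_frames x n : locally_free n M -> vector_bundle F ->
  fiberwise_mono j ->
  exists V m (h : 'I_n -> M V) (f : 'I_m -> F V) (G : 'I_n -> 'I_m),
    [/\ oset V x, frame h, frame f, injective G & forall a, j V (h a) = f (G a)].
Proof.
move=> freeM [m freeF] jI.
have [s sx] := geometric_point_exists x; rewrite -{}sx {x}.
suff H q : (q <= n)%N -> exists V (h : 'I_n -> M V) (f : 'I_m -> F V)
    (c : 'I_q -> 'I_n) (G : 'I_q -> 'I_m), [/\ oset V (gpt s), frame h & frame f] /\
    [/\ injective c, injective G & forall a, j V (h (c a)) = f (G a)].
  have [V [h [f [c [G [[Vx fh ff] [cI GI jh]]]]]]] := H n (leqnn n).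
  exists V, m, h, f, (fun a => G (invF cI a)); split => //.
    by move=> a b /GI/(congr1 c); rewrite !f_invF.
  by move=> a; rewrite -jh f_invF.
elim: q => [|q IH] le_qn.
  have [U1 [h [U1x fh]]] := freeM (gpt s); have [U2 [f [U2x ff]]] := freeF (gpt s).
  pose h1 := @opensIl _ U1 U2; pose h2 := @opensIr _ U1 U2.
  have c : 'I_0 -> 'I_n by case.
  have G : 'I_0 -> 'I_m by case.
  exists (opensI U1 U2), (fun a => mres M h1 (h a)), (fun i => mres F h2 (f i)), c, G.
  by split; split; [by []|exact: frame_res|exact: frame_res|case|case|case].
have [V [h [f [c [G [[Vx fh ff] [cI GI jh]]]]]]] := IH (ltnW le_qn).
have [a0 ca0] : exists a0, forall a, c a <> a0.
  apply: contrapT => nc.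
  have cs b : exists a, c a = b.
    by apply: contrapT => H; apply: nc; exists b => a e; apply: H; exists a.
  have [d dc] := choice cs.
  by have := leq_card _ (can_inj dc); rewrite !card_ord leqNgt le_qn.
have [i0 [Gi0 [V' [p [V'x [u uj]]]]]] := fiberwise_mono_pivot ff Vx fh GI (jI s) jh ca0.
rewrite mulrC -(coord_frame_res_refl ff (frame_res p ff)) -ofun_res in uj.
exists V', (fun a => mres M p (h a)),
  (replace_vec (fun i => mres F p (f i)) i0 (j V' (mres M p (h a0)))),
  (ord_cons a0 c), (ord_cons i0 G).
split; split; [exact: V'x|exact: frame_res|exact: frame_replace uj|
  exact: ord_cons_inj|exact: ord_cons_inj|].
elim/ord_consP => [|a]; rewrite ?ord_cons0 ?ord_consS /replace_vec ?eqxx //.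
by have /eqP/negPf -> := Gi0 a; rewrite ofun_res jh.
Qed.

End FiberwiseMono.

(** * Subsheaves and images *)

Section Submodules.
Variables (R : comPzRingType) (M : lmodType R).

Record submodule := Submodule {
  submodule_set :> M -> Prop;
  submodule0 : submodule_set 0;
  submoduleP : forall a s t, submodule_set s -> submodule_set t ->
    submodule_set (a *: s + t) }.

Variable P : submodule.

Definition submodule_pred : {pred M} := fun x => `[< P x >].

Fact submodule_pred_closed : submod_closed submodule_pred.
Proof.
split=> [|a u v]; first exact/asboolP/submodule0.
by move=> /asboolP Pu /asboolP Pv; exact/asboolP/submoduleP.
Qed.
HB.instance Definition _ :=
  GRing.isSubmodClosed.Build R M submodule_pred submodule_pred_closed.

Record submodule_type := SubmoduleType {
  submodule_val : M; submodule_valP : submodule_val \in submodule_pred }.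
HB.instance Definition _ := [isSub for submodule_val].
HB.instance Definition _ := [Choice of submodule_type by <:].
HB.instance Definition _ := [SubChoice_isSubLmodule of submodule_type by <:].

Definition to_submodule x (Px : P x) : submodule_type :=
  @SubmoduleType x (introT (asboolP _) Px).

Lemma submodule_mem (x : submodule_type) : P (val x).
Proof. exact/asboolP/submodule_valP. Qed.

End Submodules.

Section Subsheaves.
Variables (k : fieldType) (S : scheme k).
Local Notation O := (str S).
Implicit Types U V W : opens S.

Record subsheaf (F : omodule S) := Subsheaf {
  sub_mem :> forall U, submodule (F U);
  sub_mem_res : forall U V (h : V `<=` U) s, sub_mem U s -> sub_mem V (mres F h s);
  sub_mem_local : forall U s, (forall x, oset U x ->
    exists V (h : V `<=` U), oset V x /\ sub_mem V (mres F h s)) -> sub_mem U s }.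

Section SubsheafModule.
Variables (F : omodule S) (P : subsheaf F).

Definition sub_sec U : lmodType (O U) := submodule_type (P U).

Definition sub_res_fun U V (h : V `<=` U) (s : sub_sec U) : sub_sec V :=
  to_submodule (sub_mem_res h (submodule_mem s)).

Fact sub_res_zmod U V (h : V `<=` U) : zmod_morphism (sub_res_fun h).
Proof. by move=> s t; apply: val_inj; exact: raddfB. Qed.
HB.instance Definition _ U V (h : V `<=` U) :=
  GRing.isZmodMorphism.Build _ _ (sub_res_fun h) (sub_res_zmod h).

Definition sub_res U V (h : V `<=` U) : {additive sub_sec U -> sub_sec V} :=
  sub_res_fun h.

Fact sub_resZ U V (h : V `<=` U) a (s : sub_sec U) :
  sub_res h (a *: s) = rres O h a *: sub_res h s.
Proof. by apply: val_inj; exact: mresZ. Qed.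

Fact sub_sheafP : is_sheaf sub_res.
Proof.
have FP := omodule_sheafP F; split.
- by move=> U h s; apply: val_inj; exact: mres_id.
- by move=> U V W h g hg s; apply: val_inj; exact: mres_comp.
- move=> U s t st; apply: val_inj; apply: (sheaf_separated FP) => x /st[V [h [Vx e]]].
  by exists V, h; split=> //; exact: (congr1 val e).
- move=> U I V h s cov compat.
  have [|t te] := sheaf_glue FP h (s := fun i => val (s i)) cov.
    by move=> i j W hi hj; exact: (congr1 val (compat i j W hi hj)).
  have Pt : P U t.
    apply: sub_mem_local => x /cov[i Vx]; exists (V i), (h i); split=> //.
    by rewrite te; exact: submodule_mem.
  by exists (to_submodule Pt) => i; apply: val_inj; exact: te.
Qed.

Definition sub_omodule : omodule S := OModule sub_resZ sub_sheafP.

Definition sub_incl_fun U : sub_omodule U -> F U := val.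
Fact sub_incl_linear U : linear (@sub_incl_fun U).
Proof. by []. Qed.
HB.instance Definition _ U :=
  GRing.isLinear.Build _ _ _ _ (@sub_incl_fun U) (@sub_incl_linear U).
Definition sub_incl : omor sub_omodule F.
Proof. by apply: (@OMor _ _ _ _ (fun U => @sub_incl_fun U : {linear _ -> _})). Defined.

Lemma sub_incl_mem U (s : sub_omodule U) : P U (sub_incl U s).
Proof. exact: submodule_mem. Qed.

Lemma sub_incl_mono : omono sub_incl.
Proof. by move=> U; exact: val_inj. Qed.

Section Corestriction.
Variables (E : omodule S) (f : omor E F) (fP : forall U s, P U (f U s)).

Definition corestrict_fun U (s : E U) : sub_omodule U := to_submodule (fP s).
Fact corestrict_linear U : linear (@corestrict_fun U).
Proof. by move=> a s t; apply: val_inj; exact: linearP. Qed.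
HB.instance Definition _ U :=
  GRing.isLinear.Build _ _ _ _ (@corestrict_fun U) (@corestrict_linear U).
Definition corestrict : omor E sub_omodule.
Proof.
apply: (@OMor _ _ _ _ (fun U => @corestrict_fun U : {linear _ -> _})).
by move=> U V h s; apply: val_inj; exact: ofun_res.
Defined.

End Corestriction.

Lemma lincomb_sub_incl n U (e : 'I_n -> sub_omodule U) V (h : V `<=` U) c :
  sub_incl V (lincomb e h c) = lincomb (fun a => sub_incl U (e a)) h c.
Proof. exact: omor_lincomb. Qed.

Lemma sub_frame n U (e : 'I_n -> F U) (eP : forall a, P U (e a)) :
  (forall V (h : V `<=` U) c c', lincomb e h c = lincomb e h c' -> c =1 c') ->
  (forall V (h : V `<=` U) t, P V t -> exists c, t = lincomb e h c) ->
  frame (fun a => to_submodule (eP a) : sub_omodule U).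
Proof.
move=> free span; apply/frameP => V h s; split; last first.
  by move=> c c' /(congr1 (sub_incl V)); rewrite !lincomb_sub_incl; exact: free.
have [c sc] := span V h _ (sub_incl_mem s); exists c.
by apply: sub_incl_mono; rewrite lincomb_sub_incl.
Qed.

End SubsheafModule.

Section ImageSheaf.
Variables (E F : omodule S) (f : omor E F).

Fact in_image0 U : @in_image _ _ _ _ f U 0.
Proof. by move=> x Ux; exists U, (@subset_refl _ U), 0; rewrite !raddf0. Qed.

Fact in_imageP U a (s t : F U) : in_image f s -> in_image f t -> in_image f (a *: s + t).
Proof.
move=> fs ft x Ux; have [V [h [s' [Vx s'E]]]] := fs x Ux.
have [W [g [t' [Wx t'E]]]] := ft x Ux.
pose hg := subset_trans (@opensIl _ V W) h.
exists (opensI V W), hg,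
  (rres O hg a *: mres E (@opensIl _ V W) s' + mres E (@opensIr _ V W) t').
split=> //; rewrite linearP !ofun_res s'E t'E raddfD /= mresZ.
by rewrite !(mres_comp _ _ hg).
Qed.

Lemma in_image_res U V (h : V `<=` U) t : in_image f t -> in_image f (mres F h t).
Proof.
move=> ft x Vx; have [W [g [s [Wx sE]]]] := ft x (h x Vx).
exists (opensI V W), (@opensIl _ V W), (mres E (@opensIr _ V W) s); split=> //.
rewrite ofun_res sE (mres_comp h _ (subset_trans (@opensIl _ V W) h)).
exact: mres_comp.
Qed.

Lemma in_image_local U t : (forall x, oset U x ->
  exists V (h : V `<=` U), oset V x /\ in_image f (mres F h t)) -> in_image f t.
Proof.
move=> loc x Ux; have [V [h [Vx ft]]] := loc x Ux.
have [W [g [s [Wx sE]]]] := ft x Vx; exists W, (subset_trans g h), s; split=> //.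
by rewrite sE; exact: mres_comp.
Qed.

Lemma in_image_ofun U s : in_image f (f U s).
Proof. by move=> x Ux; exists U, (@subset_refl _ U), s; rewrite !mres_id. Qed.

Definition image_sheaf : subsheaf F :=
  @Subsheaf F (fun U => Submodule (@in_image0 U) (@in_imageP U)) in_image_res in_image_local.

End ImageSheaf.

(** By injectivity the local preimages agree on overlaps, so that they glue. *)
Lemma omono_image (E F : omodule S) (f : omor E F) U (t : F U) :
  omono f -> in_image f t -> exists s, f U s = t.
Proof.
move=> fI ft.
pose I := {V : opens S & {h : V `<=` U & {s : E V | f V s = mres F h t}}}.
have [||s sE] := @sheaf_glue _ _ _ (omodule_sheafP E) U I (fun i => projT1 i)
  (fun i => projT1 (projT2 i)) (fun i => sval (projT2 (projT2 i))).
- by move=> x /ft[V [h [s [Vx e]]]]; exists (existT _ V (existT _ h (exist _ s e))).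
- move=> [V [h [s e]]] [V' [h' [s' e']]] W hi hj /=; apply: fI.
  rewrite !ofun_res e e' (mres_comp _ _ (subset_trans hi h)).
  by rewrite (mres_comp _ _ (subset_trans hi h)).
exists s; apply: (sheaf_separated (omodule_sheafP F)) => x /ft[V [h [s' [Vx e]]]].
exists V, h; split=> //; rewrite -ofun_res -e.
by congr (f V _); exact: (sE (existT _ V (existT _ h (exist _ s' e)))).
Qed.

Lemma omono_lift (M N F : omodule S) (j : omor M F) (f : omor N F) : omono j ->
  (forall U s, in_image j (f U s)) ->
  exists g : omor N M, forall U s, j U (g U s) = f U s.
Proof.
move=> jI fj; pose g U s := sval (cid (omono_image jI (fj U s))).
have gE U s : j U (g U s) = f U s := svalP (cid (omono_image jI (fj U s))).
have gL U : linear (g U) by move=> a s t; apply: (jI U); rewrite linearP !gE linearP.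
pose gl U : {linear N U -> M U} := HB.pack (g U) (GRing.isLinear.Build _ _ _ _ (g U) (gL U)).
have gR U V (h : V `<=` U) s : gl V (mres N h s) = mres M h (gl U s).
  by apply: (jI V); rewrite /= gE !ofun_res gE.
by exists (OMor gR).
Qed.

Lemma omono_lift_iso (M N F : omodule S) (j : omor M F) (f : omor N F) (g : omor N M) :
  omono j -> omono f -> (forall U s, j U (g U s) = f U s) ->
  (forall U s, in_image f (j U s)) -> oiso g.
Proof.
move=> jI fI gE jf; have [g' g'E] := omono_lift fI jf.
by exists g'; split=> U s; [apply: fI; rewrite g'E gE|apply: jI; rewrite gE g'E].
Qed.

End Subsheaves.

(** * A cokernel as a line bundle on D *)

Section ProductSheaf.
Variables (k : fieldType) (D : scheme k) (I : Type) (Z : I -> opens D).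
Local Notation O := (str D).
Implicit Types U V W : opens D.

Definition prod_fun W := prod_ring (fun a => O (opensI W (Z a))).
HB.instance Definition _ W := GRing.ComPzRing.on (prod_fun W).

Definition prod_diag W (b : O W) : prod_fun W := fun a => rres O (@opensIl _ W (Z a)) b.
Fact prod_diag_zmod W : zmod_morphism (@prod_diag W).
Proof. by move=> b c; apply: functional_extensionality_dep => a; exact: rmorphB. Qed.
Fact prod_diag_monoid W : monoid_morphism (@prod_diag W).
Proof.
split; first by apply: functional_extensionality_dep => a; exact: rmorph1.
by move=> b c; apply: functional_extensionality_dep => a; exact: rmorphM.
Qed.
HB.instance Definition _ W :=
  GRing.isZmodMorphism.Build _ _ (@prod_diag W) (@prod_diag_zmod W).
HB.instance Definition _ W :=
  GRing.isMonoidMorphism.Build _ _ (@prod_diag W) (@prod_diag_monoid W).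

(** O(W) acts through its diagonal embedding into the product of rings, which is a
   module over itself. *)
Definition prod_sec W : lmodType (O W) :=
  restr_scalars (@prod_diag W : {rmorphism _ -> _}) ((prod_fun W)^o).

Lemma opensIS U V W : V `<=` U -> opensI V W `<=` opensI U W.
Proof. by move=> h y [/h]. Qed.

Definition prod_res_fun U V (h : V `<=` U) (c : prod_sec U) : prod_sec V :=
  fun a => rres O (opensIS (W := Z a) h) ((c : prod_fun U) a).
Fact prod_res_zmod U V (h : V `<=` U) : zmod_morphism (prod_res_fun h).
Proof. by move=> b c; apply: functional_extensionality_dep => a; exact: rmorphB. Qed.
HB.instance Definition _ U V (h : V `<=` U) :=
  GRing.isZmodMorphism.Build _ _ (prod_res_fun h) (prod_res_zmod h).
Definition prod_res U V (h : V `<=` U) : {additive prod_sec U -> prod_sec V} :=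
  prod_res_fun h.

Fact prod_resZ U V (h : V `<=` U) b (c : prod_sec U) :
  prod_res h (b *: c) = rres O h b *: prod_res h c.
Proof.
apply: functional_extensionality_dep => a.
rewrite -[LHS]/(rres O _ (rres O _ b * _)) rmorphM; congr (_ * _).
have hV := subset_trans (@opensIl _ V (Z a)) h.
exact: etrans (rres_comp _ _ hV _) (esym (rres_comp _ _ hV _)).
Qed.

Fact prod_sheafP : is_sheaf prod_res.
Proof.
have OP := ring_sheafP O; split.
- by move=> U h c; apply: functional_extensionality_dep => a; exact: rres_id.
- by move=> U V W h g hg c; apply: functional_extensionality_dep => a; exact: rres_comp.
- move=> U c c' cc'; apply: functional_extensionality_dep => a.
  apply: (sheaf_separated OP) => x [/cc'[V [h [Vx e]]] Zx].
  exists (opensI V (Z a)), (opensIS h); split=> //.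
  exact: (congr1 (fun c : prod_fun V => c a) e).
- move=> U J V h c cov compat.
  have H a : exists t : O (opensI U (Z a)), forall j,
      rres O (opensIS (h j)) t = (c j : prod_fun (V j)) a.
    apply: (sheaf_glue OP (fun j => opensIS (W := Z a) (h j))
      (s := fun j => (c j : prod_fun (V j)) a)).
      by move=> x [/cov[j Vx] Zx]; exists j.
    move=> j l W hj hl; pose VV := opensI (V j) (V l).
    have hW : W `<=` opensI VV (Z a).
      by move=> y Wy; split; [split; [case: (hj y Wy)|case: (hl y Wy)]|case: (hj y Wy)].
    have := congr1 (fun c : prod_fun VV => rres O hW (c a))
      (compat j l VV (@opensIl _ _ _) (@opensIr _ _ _)).
    by rewrite /= !(rres_comp _ _ hj, rres_comp _ _ hl).
  exists (fun a => sval (cid (H a))) => j; apply: functional_extensionality_dep => a.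
  exact: (svalP (cid (H a)) j).
Qed.

Definition prod_omodule : omodule D := OModule prod_resZ prod_sheafP.
End ProductSheaf.

Section Cokernel.
Variables (k : fieldType) (S D : scheme k) (i : smorphism D S).
Hypothesis i_closed : closed_immersion i.
Variables (E F : omodule S) (mid : omor E F) (r : nat).
Local Notation OD := (str D).
Local Notation pre := (preim_open (smap_cont i)).
Local Notation pre_sub := (preim_sub (smap_cont i)).

(** The complement of i (~ W) is open because i is closed; it contains all the points
   outside of D. *)
Lemma closed_immersion_open (W : opens D) :
  exists U : opens S, (forall y, oset U (i y) <-> oset W y) /\
    forall x, (forall y, i y <> x) -> oset U x.
Proof.
have cl : closed (i @` (~` oset W)).
  by apply: (clim_closed i_closed); rewrite closedC; exact: oset_open.
have op : open (~` (i @` (~` oset W))) by rewrite openC.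
exists (Opens op); split=> [y|x nx] /=; last by case=> y _ /nx.
split=> [ny|Wy].
  by apply: contrapT => nWy; apply: ny; exists y.
by move=> [z nWz /(clim_inj i_closed) zy]; apply: nWz; rewrite zy.
Qed.

Lemma closed_immersion_lift (W : opens D) (b : OD W) y : oset W y ->
  exists (V : opens S) (a : str S V), oset V (i y) /\
    forall (N : opens D) (hW : N `<=` W) (hV : N `<=` pre V),
      rres OD hW b = rres OD hV (comap i V a).
Proof.
move=> Wy; have [U [UW _]] := closed_immersion_open W.
have hU : pre U `<=` W by move=> z /UW.
have [V [h [a [Vy e]]]] := clim_epi i_closed (rres OD hU b) ((UW y).2 Wy).
exists V, a; split=> // N hW hV; rewrite e (rres_comp _ _ (subset_trans (pre_sub h) hU)).
by rewrite (rres_comp _ _ hW).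
Qed.

(** The component along the first vector of such a frame, restricted to D, identifies
   the cokernel of mid with the structure sheaf of D. *)
Record adapted_frame := AdaptedFrame {
  ad_open : opens S;
  ad_vec : 'I_r.+1 -> F ad_open;
  ad_frame : frame ad_vec;
  ad_image : forall (V : opens S) (h : V `<=` ad_open) t,
    in_image mid t <-> comap i V (coord ad_frame h t ord0) = 0 }.

Arguments ad_frame : clear implicits.
Implicit Types (A B : adapted_frame) (U V : opens S) (N W : opens D).

(** The class of t in the cokernel, under the identification given by A. *)
Definition residue A V (h : V `<=` ad_open A) (t : F V) : OD (pre V) :=
  comap i V (coord (ad_frame A) h t ord0).

Lemma residueP A V (h : V `<=` ad_open A) a s t :
  residue h (a *: s + t) = comap i V a * residue h s + residue h t.
Proof. by rewrite /residue coordP rmorphD rmorphM. Qed.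

Lemma residue_res A V V' (h : V `<=` ad_open A) (g : V' `<=` V) (hg : V' `<=` ad_open A) t :
  residue hg (mres F g t) = rres OD (pre_sub g) (residue h t).
Proof. by rewrite /residue (coord_res _ h) comap_res. Qed.

Lemma residue_vec A a : residue (@subset_refl _ (ad_open A)) (ad_vec A a) = (a == ord0)%:R.
Proof. by rewrite /residue coord_frame_refl rmorph_nat eq_sym. Qed.

(** The other vectors of A are in the image of mid, so that their residues in B are 0. *)
Lemma residue_change A B V (hA : V `<=` ad_open A) (hB : V `<=` ad_open B) t :
  residue hB t = residue hA t * residue hB (mres F hA (ad_vec A ord0)).
Proof.
rewrite -{1}(coordK (ad_frame A) hA t) /lincomb {1}/residue coord_sum rmorph_sum.
rewrite (bigD1 ord0) //= coordZ rmorphM big1 ?addr0 // => a /negPf a0.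
rewrite coordZ rmorphM (_ : comap i V (coord _ hB _ _) = 0) ?mulr0 //.
by apply/ad_image/(ad_image hA); rewrite coord_frame eq_sym a0 rmorph0.
Qed.

Let Z A : opens D := pre (ad_open A).

(** The restrictions of c and t are compared on all N and V that are small enough, not
   only on the largest ones, so that nested intersections need not be identified. *)
Definition represents W (c : prod_fun Z W) U (t : F U) :=
  forall A V (hU : V `<=` U) (hA : V `<=` ad_open A) N (hW : N `<=` opensI W (Z A))
    (hV : N `<=` pre V), rres OD hW (c A) = rres OD hV (residue hA (mres F hU t)).

Lemma represents_inj W c c' U (t : F U) : W `<=` pre U ->
  represents c t -> represents c' t -> c = c' :> prod_fun Z W.
Proof.
move=> WU ct c't; apply: functional_extensionality_dep => A.
have hV : opensI W (Z A) `<=` pre (opensI U (ad_open A)).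
  by move=> y [/WU Uy Zy].
have H c0 := fun H : @represents W c0 U t =>
  H A _ (@opensIl _ _ _) (@opensIr _ _ _) _ (@subset_refl _ _) hV.
by have := H _ ct; rewrite -(H _ c't) !rres_id.
Qed.

Lemma represents_res W W' (h : W' `<=` W) c U U' (g : U' `<=` U) (t : F U) :
  @represents W c U t -> @represents W' (prod_res Z h c) U' (mres F g t).
Proof.
move=> ct A V hU hA N hW hV; rewrite (mres_comp _ _ (subset_trans hU g)).
by rewrite -(ct A V _ hA N (subset_trans hW (opensIS h)) hV); exact: rres_comp.
Qed.

Lemma representsP W b (c c' : prod_omodule Z W) U (t t' : F U) (a : str S U) :
  (forall N (hW : N `<=` W) (hU : N `<=` pre U),
     rres OD hW b = rres OD hU (comap i U a)) ->
  represents c t -> represents c' t' -> represents (b *: c + c') (a *: t + t').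
Proof.
move=> ba ct c't A V hU hA N hW hV.
rewrite -[X in rres OD hW X]/(rres OD (@opensIl _ W (Z A)) b *
  (c : prod_fun Z W) A + (c' : prod_fun Z W) A).
rewrite rmorphD rmorphM (ct _ _ hU hA _ _ hV) (c't _ _ hU hA _ _ hV).
rewrite raddfD /= mresZ residueP rmorphD rmorphM; congr (_ * _ + _).
rewrite (rres_comp _ _ (subset_trans hW (@opensIl _ W (Z A)))).
rewrite (ba N _ (subset_trans hV (pre_sub hU))) comap_res.
by rewrite (rres_comp _ _ (subset_trans hV (pre_sub hU))).
Qed.

(** A class in the cokernel is determined by its residues in all the adapted frames,
   and is therefore encoded as the family of these functions on D; in this way the
   action of the structure sheaf of D is inherited from a product. *)
Definition coker_mem W (c : prod_omodule Z W) := forall y, oset W y ->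
  exists U (t : F U), oset U (i y) /\ represents c t.

Fact coker_mem0 W : coker_mem (0 : prod_omodule Z W).
Proof.
move=> y Wy; exists (full_open S), 0; split=> // A V hU hA N hW hV.
by rewrite raddf0 /residue coord0 !rmorph0.
Qed.

Fact coker_memP W b (c c' : prod_omodule Z W) :
  coker_mem c -> coker_mem c' -> coker_mem (b *: c + c').
Proof.
move=> cc cc' y Wy; have [U [t [Uy ct]]] := cc y Wy; have [U' [t' [Uy' ct']]] := cc' y Wy.
have [V [a [Vy ba]]] := closed_immersion_lift b Wy.
pose X := opensI V (opensI U U').
have hV : X `<=` V by move=> z [].
have hU : X `<=` U by move=> z [_ []].
have hU' : X `<=` U' by move=> z [_ []].
exists X, (rres (str S) hV a *: mres F hU t + mres F hU' t'); split=> //.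
apply: representsP.
- move=> N hW hX; rewrite (ba N hW (subset_trans hX (pre_sub hV))) comap_res.
  by rewrite (rres_comp _ _ (subset_trans hX (pre_sub hV))).
- move=> A V' h1 h2 N h3 h4; rewrite (mres_comp _ _ (subset_trans h1 hU)).
  exact: ct.
- move=> A V' h1 h2 N h3 h4; rewrite (mres_comp _ _ (subset_trans h1 hU')).
  exact: ct'.
Qed.

Fact coker_mem_res W W' (h : W' `<=` W) (c : prod_omodule Z W) :
  coker_mem c -> coker_mem (mres (prod_omodule Z) h c).
Proof.
move=> cc y /h Wy; have [U [t [Uy ct]]] := cc y Wy; exists U, t; split=> //.
by rewrite -(mres_id (@subset_refl _ U) t); exact: represents_res.
Qed.

Fact coker_mem_local W (c : prod_omodule Z W) :
  (forall y, oset W y -> exists W' (h : W' `<=` W), oset W' y /\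
     coker_mem (mres (prod_omodule Z) h c)) -> coker_mem c.
Proof.
move=> loc y Wy; have [W' [h [W'y cc]]] := loc y Wy.
have [U [t [Uy ct]]] := cc y W'y; have [X [XW' _]] := closed_immersion_open W'.
exists (opensI U X), (mres F (@opensIl _ U X) t); split.
  by split=> //; apply/XW'.
move=> A V hU hA N hW hV; rewrite (mres_comp _ _ (subset_trans hU (@opensIl _ U X))).
have hN : N `<=` opensI W' (Z A).
  by move=> z Nz; split; [apply/XW'; case: (hU _ (hV z Nz))|case: (hW z Nz)].
rewrite -(ct A V _ hA N hN hV); symmetry; exact: rres_comp.
Qed.

Definition coker_subsheaf : subsheaf (prod_omodule Z) :=
  @Subsheaf _ _ (prod_omodule Z) (fun W => Submodule (@coker_mem0 W) (@coker_memP W))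
    coker_mem_res coker_mem_local.

Definition coker_module : omodule D := sub_omodule coker_subsheaf.

Let valE W (c : coker_module W) : prod_fun Z W := val c.

Lemma coker_module_mem W (c : coker_module W) : coker_mem (valE c).
Proof. exact: (@submodule_mem _ _ (coker_subsheaf W) c). Qed.

Lemma preim_opensI U V : opensI (pre U) (pre V) `<=` pre (opensI U V).
Proof. by []. Qed.

Definition coker_fun U (t : F U) : prod_omodule Z (pre U) := fun A =>
  rres OD (@preim_opensI U (ad_open A))
    (residue (@opensIr _ U (ad_open A)) (mres F (@opensIl _ U (ad_open A)) t)).

Lemma coker_fun_represents U (t : F U) : represents (coker_fun t) t.
Proof.
move=> A V hU hA N hW hV; rewrite /coker_fun.
have hC : V `<=` opensI U (ad_open A) by move=> y Vy; split; [exact: hU|exact: hA].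
rewrite (rres_comp _ _ (subset_trans hV (pre_sub hC))).
rewrite -(rres_comp (pre_sub hC) hV) -(residue_res _ hC hA).
by rewrite (mres_comp _ _ hU).
Qed.

Fact coker_fun_mem U (t : F U) : coker_mem (coker_fun t).
Proof. by move=> y Uy; exists U, t; split=> //; exact: coker_fun_represents. Qed.

Definition to_coker U (t : F U) : pushforward i coker_module U :=
  @to_submodule _ _ (coker_subsheaf (pre U)) (coker_fun t) (coker_fun_mem t).

Fact to_coker_linear U : linear (@to_coker U).
Proof.
move=> a s t; apply: val_inj; apply: (@represents_inj _ _ _ U (a *: s + t)) => //.
  exact: coker_fun_represents.
apply: (@representsP _ (comap i U a) (coker_fun s) (coker_fun t)).
- by move=> N hW hU; exact: rres_irr.
- exact: coker_fun_represents.
- exact: coker_fun_represents.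
Qed.
HB.instance Definition _ U :=
  GRing.isLinear.Build _ _ _ _ (@to_coker U) (@to_coker_linear U).

Definition coker_mor : omor F (pushforward i coker_module).
Proof.
apply: (@OMor _ _ _ _ (fun U => @to_coker U : {linear _ -> _})) => U V h s.
apply: val_inj; apply: (@represents_inj _ _ _ V (mres F h s)) => //.
  exact: coker_fun_represents.
apply: represents_res; exact: coker_fun_represents.
Defined.

Hypothesis enough : forall x, exists A, oset (ad_open A) x.

Lemma coker_mor_eq0 U (t : F U) : coker_mor U t = 0 <-> in_image mid t.
Proof.
split=> [t0 x Ux|t0].
  have [A Ax] := enough x; pose V := opensI U (ad_open A).
  have tV : in_image mid (mres F (@opensIl _ U (ad_open A)) t).
    apply/(ad_image (@opensIr _ U (ad_open A))); rewrite -/(residue _ _).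
    have hV : pre V `<=` opensI (pre U) (Z A) by [].
    have := coker_fun_represents t (@opensIl _ _ _) (@opensIr _ U (ad_open A))
      hV (@subset_refl _ _).
    have /(congr1 (fun c : coker_module (pre U) => valE c A)) := t0.
    by rewrite /valE /= => ->; rewrite rmorph0 rres_id.
  have [W [h [s [Wx e]]]] := tV x (conj Ux Ax).
  exists W, (subset_trans h (@opensIl _ _ _)), s; split=> //.
  by rewrite e; exact: mres_comp.
apply: val_inj; apply: (@represents_inj _ _ _ U t) => //.
  exact: coker_fun_represents.
move=> A V hU hA N hW hV; rewrite [LHS]rmorph0 (_ : residue _ _ = 0) ?rmorph0 //.
by apply/(ad_image hA); exact: in_image_res.
Qed.

(** At a point of D a section lifts by construction; outside of D the target is zero. *)
Lemma coker_mor_epi : oepi coker_mor.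
Proof.
move=> U c x Ux; have [[y xy]|nx] := pselect (exists y, i y = x).
  rewrite -xy in Ux.
  have cm : coker_mem (valE (c : coker_module (pre U))) := coker_module_mem c.
  have [U' [t [U'y ct]]] := cm y Ux.
  pose V := opensI U U'; rewrite -xy.
  exists V, (@opensIl _ U U'), (mres F (@opensIr _ U U') t); split; first by [].
  apply: val_inj; apply: (@represents_inj _ _ _ V (mres F (@opensIr _ U U') t)) => //.
    exact: coker_fun_represents.
  exact: represents_res ct.
have [X [X0 Xx]] := closed_immersion_open (Opens (@open0 D)).
exists (opensI U X), (@opensIl _ U X), 0; split.
  by split=> //; apply: Xx => y yx; apply: nx; exists y.
apply: val_inj; apply: functional_extensionality_dep => A.
by apply: (sheaf_separated (ring_sheafP OD)) => z [[_ /X0]].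
Qed.

(** The class of the first vector of an adapted frame A has residue 1 in A, so the
   coefficient of a section along it must be the residue of that section in A. *)
Lemma coker_line_bundle : locally_free 1 coker_module.
Proof.
move=> y; have [A Ay] := enough (i y).
pose sg : coker_module (Z A) := to_coker (ad_vec A ord0).
exists (Z A), (fun=> sg); split; first exact: Ay.
have sgE W (h : W `<=` Z A) b : lincomb (fun _ : 'I_1 => sg) h b =
    b ord0 *: mres coker_module h sg.
  by rewrite /lincomb big_ord1.
have sg_rep := coker_fun_represents (ad_vec A ord0).
apply/frameP => W h s; have hC : W `<=` opensI W (Z A).
  by move=> z Wz; split=> //; exact: h.
have cA (t : coker_module W) b (hb : t = b *: mres coker_module h sg) :
    rres OD hC (valE t A) = b.
  rewrite hb -[LHS]/(rres OD hC (rres OD (@opensIl _ W (Z A)) b *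
    rres OD (opensIS (W := Z A) h) (coker_fun (ad_vec A ord0) A))).
  rewrite rmorphM (rres_comp _ _ (@subset_refl _ W)) rres_id.
  have hW : W `<=` opensI (Z A) (Z A) by move=> z Wz; split; exact: (h z Wz).
  rewrite (rres_comp _ _ hW).
  rewrite (sg_rep A (ad_open A) (@subset_refl _ _) (@subset_refl _ _) W hW h).
  by rewrite mres_id residue_vec rmorph1 mulr1.
split; last first.
  move=> a b; rewrite !sgE => e j; rewrite (ord1 j).
  exact: etrans (esym (cA _ (a ord0) erefl)) (cA _ _ e).
exists (fun=> rres OD hC (valE s A)); rewrite sgE.
apply: (sheaf_separated (omodule_sheafP coker_module)) => z Wz.
have sm : coker_mem (valE s) := coker_module_mem s.
have [U [t [Uz st]]] := sm z Wz.
pose V := opensI U (ad_open A); pose W' := opensI W (pre V).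
have Wz' : oset W' z by split=> //; split=> //; exact: (h z Wz).
exists W', (@opensIl _ _ _); split=> //.
apply: val_inj; apply: functional_extensionality_dep => B.
pose V2 := opensI V (ad_open B).
have VU : V2 `<=` U by move=> v [[]].
have VA : V2 `<=` ad_open A by move=> v [[]].
have VB : V2 `<=` ad_open B by move=> v [].
pose N := opensI W' (Z B); have NV : N `<=` pre V2 by move=> v [[]].
have NB : N `<=` opensI W (Z B) by move=> v [[]].
have NA : N `<=` opensI W (Z A) by move=> v [[Wv _] _]; split => //; exact: (h v Wv).
have NZ : N `<=` opensI (Z A) (Z B) by move=> v [[Wv _] Bv]; split=> //; exact: (h v Wv).
have NW : N `<=` W by move=> v [[]].
rewrite -[LHS]/(rres OD _ (valE s B)) (rres_irr _ NB) (st B V2 VU VB N NB NV).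
rewrite (residue_change VA VB) rmorphM -(st A V2 VU VA N NA NV).
rewrite -[RHS]/(rres OD _ (rres OD _ (rres OD hC (valE s A)) *
  rres OD (opensIS h) (coker_fun (ad_vec A ord0) B))) rmorphM.
rewrite -(sg_rep B V2 VA VB N NZ NV); congr (_ * _).
  by rewrite !(rres_comp _ _ NW) (rres_comp _ _ NA).
by rewrite (rres_comp _ _ NZ).
Qed.

Lemma cokernel_line_bundle : exists (C : omodule S) (q : omor F C),
  is_cokernel mid q /\ line_bundle_on i C.
Proof.
exists (pushforward i coker_module), coker_mor; split.
  by split; [exact: coker_mor_epi|exact: coker_mor_eq0].
exists coker_module; split; first exact: coker_line_bundle.
have idL U : linear (@idfun (pushforward i coker_module U)) by [].
pose idm : omor (pushforward i coker_module) (pushforward i coker_module) :=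
  @OMor _ _ _ _ (fun U => HB.pack idfun (GRing.isLinear.Build _ _ _ _ idfun (idL U)))
    (fun _ _ _ _ => erefl).
by exists idm, idm.
Qed.

End Cokernel.

(** * The factorization and its uniqueness *)

Section FiberwiseMonoConsequences.
Variables (k : fieldType) (S : scheme k) (M F : omodule S) (j : omor M F) (n : nat).
Hypotheses (freeM : locally_free n M) (freeF : vector_bundle F) (jI : fiberwise_mono j).
Implicit Types U V : opens S.

Lemma fiberwise_mono_omono : omono j.
Proof.
move=> U s t st; apply: (sheaf_separated (omodule_sheafP M)) => x Ux.
have [V [m [h [f [G [Vx fh ff GI jh]]]]]] := fiberwise_mono_frames x freeM freeF jI.
exists (opensI U V), (@opensIl _ U V); split=> //.
apply: (coord_inj (fr := fh) (h := @opensIr _ U V)) => a.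
have jc z : coord ff (@opensIr _ U V) (j _ z) (G a) = coord fh (@opensIr _ U V) z a.
  rewrite -{1}(coordK fh (@opensIr _ U V) z) omor_lincomb.
  under eq_fun do rewrite jh; exact: coord_subframe.
by rewrite -!jc !ofun_res st.
Qed.

(** Locally the image of j is cut out by the vanishing of some coordinates, and d is
   regular. *)
Lemma fiberwise_mono_regular_div U (d : str S U) (t : F U) :
  (forall V (h : V `<=` U) a, a * rres (str S) h d = 0 -> a = 0) ->
  in_image j (d *: t) -> in_image j t.
Proof.
move=> d_reg dt x Ux.
have [V [m [h [f [G [Vx fh ff GI jh]]]]]] := fiberwise_mono_frames x freeM freeF jI.
have [W [g [s [Wx e]]]] := dt x Ux.
pose V' := opensI W V; have hU := subset_trans (@opensIl _ W V) g.
pose hV := @opensIr _ W V.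
have jE c : j V' (lincomb h hV c) = lincomb (fun a => f (G a)) hV c.
  by rewrite omor_lincomb; apply: eq_bigr => a _; rewrite jh.
exists V', hU, (lincomb h hV (fun a => coord ff hV (mres F hU t) (G a))); split=> //.
rewrite jE -lincomb_subframe // => i Gi; apply: (d_reg _ hU).
rewrite mulrC -(coordZ ff hV) -mresZ -(mres_comp g (@opensIl _ W V) hU) -e -ofun_res.
by rewrite -(coordK fh hV (mres M _ s)) jE coord_subframe_out.
Qed.

End FiberwiseMonoConsequences.

Section Saturation.
Variables (k : fieldType) (S D : scheme k) (i : smorphism D S).
Variables (F : omodule S) (P : subsheaf F).
Implicit Types U V W : opens S.

Lemma clim_ideal_local U (b : str S U) : (forall x, oset U x ->
    exists V (h : V `<=` U), oset V x /\ clim_ideal i (rres (str S) h b)) -> clim_ideal i b.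
Proof.
move=> loc; apply: (sheaf_separated (ring_sheafP (str D))) => y Uy.
have [V [h [Vy e]]] := loc _ Uy.
exists (preim_open (smap_cont i) V), (preim_sub (smap_cont i) h).
by split=> //; rewrite rmorph0 -comap_res.
Qed.

Lemma clim_ideal_res U V (h : V `<=` U) (b : str S U) :
  clim_ideal i b -> clim_ideal i (rres (str S) h b).
Proof. by rewrite /clim_ideal /= comap_res => ->; rewrite rmorph0. Qed.

(** The colon of P by the ideal of D. For P the image of phi this is the subsheaf F_1
   of the factorization. *)
Definition saturation_mem U (t : F U) := forall V (h : V `<=` U) (a : str S V),
  clim_ideal i a -> P V (a *: mres F h t).

Fact saturation0 U : @saturation_mem U 0.
Proof. by move=> V h a _; rewrite raddf0 scaler0; exact: submodule0. Qed.

Fact saturationP U a (s t : F U) :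
  saturation_mem s -> saturation_mem t -> saturation_mem (a *: s + t).
Proof.
move=> Ps Pt V h b Ib; rewrite raddfD /= mresZ scalerDr scalerA mulrC -scalerA.
by apply: submoduleP; [exact: Ps|exact: Pt].
Qed.

Fact saturation_res U V (h : V `<=` U) (t : F U) :
  saturation_mem t -> saturation_mem (mres F h t).
Proof.
by move=> Pt W g a Ia; rewrite (mres_comp _ _ (subset_trans g h)); exact: Pt.
Qed.

Fact saturation_local U (t : F U) : (forall x, oset U x ->
    exists V (h : V `<=` U), oset V x /\ saturation_mem (mres F h t)) -> saturation_mem t.
Proof.
move=> loc V h a Ia; apply: sub_mem_local => x Vx.
have [W [g [Wx Pt]]] := loc x (h x Vx).
exists (opensI V W), (@opensIl _ V W); split=> //; rewrite mresZ.
rewrite (mres_comp _ _ (subset_trans (@opensIl _ V W) h)).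
rewrite -(mres_comp g (@opensIr _ V W)); apply: Pt; exact: clim_ideal_res.
Qed.

Definition saturation : subsheaf F := @Subsheaf _ _ F
  (fun U => Submodule (@saturation0 U) (@saturationP U)) saturation_res saturation_local.

Lemma sub_saturation U (t : F U) : P U t -> saturation U t.
Proof.
move=> Pt V h a _; rewrite -[_ *: _]addr0; apply: submoduleP; last exact: submodule0.
exact: sub_mem_res.
Qed.

End Saturation.

Definition omor_comp (k : fieldType) (S : scheme k) (E F G : omodule S)
  (g : omor F G) (f : omor E F) : omor E G.
Proof.
apply: (@OMor _ _ _ _ (fun U => g U \o f U : {linear _ -> _})).
by move=> U V h s; rewrite /= !ofun_res.
Defined.

Section Factorization.
Variables (k : fieldType) (S : scheme k) (E F : omodule S) (phi : omor E F).
Variables (r : nat) (D : scheme k) (i : smorphism D S).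
Hypotheses (hE : vector_bundle E) (hF : vector_bundle F).
Hypothesis phi_rank : ext_zero r.+2 phi.
Hypothesis i_closed : closed_immersion i.
Hypothesis i_minors : forall U, @clim_ideal k D S i U = @minors_ideal k S E F phi r.+1 U.
Hypothesis i_cartier : effective_cartier i.
Hypothesis phi_fiber : forall s : geometric_point S, ~ fiber_ext_zero r phi s.
Local Notation O := (str S).
Implicit Types U V W : opens S.

Definition phi_image := image_sheaf phi.
Definition saturated_image := saturation i phi_image.

Definition local_equation V (d : O V) := forall V' (h : V' `<=` V),
  (forall a, a * rres O h d = 0 -> a = 0) /\
  forall b, clim_ideal i b <-> exists a, b = a * rres O h d.

Lemma local_normal_form x :
  exists V (d : O V) m (f : 'I_m -> F V) (G : 'I_r.+1 -> 'I_m),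
    [/\ oset V x, local_equation d & normal_form phi d f G].
Proof.
have [U [d [Ux dP]]] := i_cartier x.
have [V [h [m [f [G [Vx nf]]]]]] := normal_form_exists hE hF phi_rank phi_fiber Ux
  (fun V h => (dP V h).1)
  (fun V h b => eq_ind _ (fun I => I b <-> _) ((dP V h).2 b) _ (i_minors V)).
exists V, (rres O h d), m, f, G; split=> // V' h'.
by rewrite (rres_comp h h' (subset_trans h' h)); exact: dP.
Qed.

Section LocalDescription.
Variables (V : opens S) (d : O V) (m : nat) (f : 'I_m -> F V) (G : 'I_r.+1 -> 'I_m).
Hypotheses (dP : local_equation d) (nf : normal_form phi d f G).

Let fr := nf_frame nf.
Let GI := nf_inj nf.

(** The normal form describes the images of sections; as both conditions on the
   coordinates of t are local, it also describes the sections that are images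
   locally. *)
Lemma in_image_local_form V' (h : V' `<=` V) t : in_image phi t <->
  exists c, t = lincomb (fun a => f (G a)) h c /\ clim_ideal i (c ord0).
Proof.
split=> [ft|[c [tc]]]; last first.
  move=> /((dP h).2 (c ord0)) c0; have [s <-] : exists s, phi V' s = t.
    by apply/(nf_image nf h); exists c.
  exact: in_image_ofun.
exists (fun a => coord fr h t (G a)); split.
  apply: lincomb_subframe => // l Gl; apply: (sheaf_separated (ring_sheafP O)) => x Vx.
  have [W [g [s [Wx e]]]] := ft x Vx; exists W, g; split=> //.
  have hg := subset_trans g h; rewrite rmorph0 -(coord_res fr h g hg) -e.
  have [c [-> _]] := (nf_image nf hg (phi W s)).1 (ex_intro _ s erefl).
  exact: coord_subframe_out.
apply: clim_ideal_local => x Vx; have [W [g [s [Wx e]]]] := ft x Vx.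
exists W, g; split=> //; have hg := subset_trans g h.
rewrite -(coord_res fr h g hg) -e.
have [c [-> c0]] := (nf_image nf hg (phi W s)).1 (ex_intro _ s erefl).
by rewrite coord_subframe //; apply/((dP hg).2 _).
Qed.

(** The equation d of D is regular, so t has the vanishing coordinates of d t. *)
Lemma saturated_image_local_form V' (h : V' `<=` V) t : saturated_image V' t <->
  exists c, t = lincomb (fun a => f (G a)) h c.
Proof.
split=> [st|[c ->] W g a Ia]; last first.
  rewrite (lincomb_res _ _ _ (subset_trans g h)).
  apply/(in_image_local_form (subset_trans g h)); exists (fun l => a * rres O g (c l)).
  split; last by rewrite /clim_ideal /= rmorphM Ia mul0r.
  by rewrite /lincomb scaler_sumr; apply: eq_bigr => l _; rewrite scalerA.
exists (fun a => coord fr h t (G a)); apply: lincomb_subframe => // l Gl.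
have Id : clim_ideal i (rres O h d) by apply/((dP h).2 _); exists 1; rewrite mul1r.
apply: (dP h).1; have := st V' (@subset_refl _ V') _ Id; rewrite mres_id.
move=> /(in_image_local_form h)[c [e _]].
by rewrite mulrC -(coordZ fr h) e coord_subframe_out.
Qed.

Lemma saturated_image_vec a : saturated_image V (f (G a)).
Proof.
apply/(saturated_image_local_form (@subset_refl _ V)); exists (fun b => (b == a)%:R).
by rewrite lincomb1 mres_id.
Qed.

Lemma saturated_image_frame :
  frame (fun a => to_submodule (saturated_image_vec a) : sub_omodule saturated_image V).
Proof.
apply: sub_frame => [V' h c c' e a|V' h t /(saturated_image_local_form h)//].
by rewrite -(coord_subframe fr GI h c a) e coord_subframe.
Qed.

Lemma image_vec a : phi_image V ((if a == ord0 then d else 1) *: f (G a)).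
Proof.
apply/(in_image_local_form (@subset_refl _ V)).
exists (fun b => (b == a)%:R * if b == ord0 then d else 1); split.
  rewrite /lincomb (bigD1 a) //= eqxx mul1r mres_id big1 ?addr0 // => b /negPf ->.
  by rewrite mul0r scale0r.
apply/((dP (@subset_refl _ V)).2 _); exists (ord0 == a)%:R.
by rewrite eqxx rres_id.
Qed.

Lemma image_frame : frame (fun a => to_submodule (image_vec a) : sub_omodule phi_image V).
Proof.
have lc V' (h : V' `<=` V) c :
    lincomb (fun a => (if a == ord0 then d else 1) *: f (G a)) h c =
    lincomb (fun a => f (G a)) h (fun a => c a * rres O h (if a == ord0 then d else 1)).
  by apply: eq_bigr => a _; rewrite mresZ scalerA.
apply: sub_frame => [V' h c c'|V' h t /(in_image_local_form h)[c [-> /((dP h).2 _)[c0 c0E]]]].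
  rewrite !lc => e a.
  have := coord_subframe fr GI h (fun a => c a * rres O h (if a == ord0 then d else 1)) a.
  rewrite e coord_subframe //; case: eqP => [->|_]; last by rewrite rmorph1 !mulr1.
  move=> /eqP; rewrite -subr_eq0 -mulrBl => /eqP/(dP h).1/eqP.
  by rewrite subr_eq0 => /eqP.
exists (fun a => if a == ord0 then c0 else c a); rewrite lc; apply: eq_bigr => a _.
by case: eqP => [->|_]; rewrite ?c0E // rmorph1 mulr1.
Qed.

End LocalDescription.

Definition image_proj : omor E (sub_omodule phi_image) :=
  @corestrict _ _ _ phi_image _ phi (fun U s => @in_image_ofun _ _ _ _ phi U s).

Definition image_mid : omor (sub_omodule phi_image) (sub_omodule saturated_image) :=
  @corestrict _ _ _ saturated_image _ (sub_incl phi_image)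
    (fun U s => @sub_saturation _ _ _ i _ phi_image _ _ (sub_incl_mem s)).

Lemma image_mid_mono : omono image_mid.
Proof. by move=> U s t /(congr1 val) e; apply: val_inj; exact: e. Qed.

Lemma in_image_mid U (t : sub_omodule saturated_image U) :
  in_image image_mid t <-> in_image phi (sub_incl saturated_image U t).
Proof.
split=> [mt|ft].
  apply: in_image_local => x /mt[V [h [s [Vx e]]]]; exists V, h; split=> //.
  rewrite -ofun_res -e; exact: (sub_incl_mem s).
suff -> : t = image_mid U (@to_submodule _ _ (phi_image U) _ ft) by exact: in_image_ofun.
exact: val_inj.
Qed.

Lemma image_adapted x : exists A : adapted_frame i image_mid r, oset (ad_open A) x.
Proof.
have [V [d [m [f [G [Vx dP nf]]]]]] := local_normal_form x.
pose e a : sub_omodule saturated_image V := to_submodule (saturated_image_vec dP nf a).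
have fe : frame e := saturated_image_frame dP nf.
suff H V' (h : V' `<=` V) t :
    in_image image_mid t <-> comap i V' (coord fe h t ord0) = 0.
  by exists (AdaptedFrame H).
rewrite in_image_mid (in_image_local_form dP nf h) -{1}(coordK fe h t) lincomb_sub_incl.
split=> [[c [tc c0]]|t0]; last by exists (coord fe h t).
rewrite (_ : coord fe h t ord0 = c ord0) //.
rewrite -(coord_subframe (nf_frame nf) (nf_inj nf) h c) -tc coord_subframe //.
exact: nf_inj nf.
Qed.

Definition image_factorization : factorization phi r.+1 i.
Proof.
apply: (@Factorization _ _ _ _ _ phi r.+1 i (sub_omodule phi_image) (sub_omodule saturated_image)
  image_proj image_mid (sub_incl saturated_image)).
- by [].
- move=> x; have [V [d [m [f [G [Vx dP nf]]]]]] := local_normal_form x.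
  exists V, (fun a => to_submodule (image_vec dP nf a)); split=> //.
  exact: image_frame.
- move=> x; have [V [d [m [f [G [Vx dP nf]]]]]] := local_normal_form x.
  exists V, (fun a => to_submodule (saturated_image_vec dP nf a)); split=> //.
  exact: saturated_image_frame.
- move=> U t x Ux; have ft : in_image phi (sub_incl phi_image U t) := sub_incl_mem t.
  have [V [h [s [Vx e]]]] := ft x Ux.
  by exists V, h, s; split=> //; apply: val_inj; exact: e.
- move=> s; have [V [d [m [f [G [Vx dP nf]]]]]] := local_normal_form (gpt s).
  exact: (fiberwise_mono_of_frames Vx (saturated_image_frame dP nf) (nf_frame nf) (nf_inj nf)).
- exact: image_mid_mono.
- exact: (cokernel_line_bundle i_closed image_adapted).
Defined.

Section Uniqueness.
Variable Y : factorization phi r.+1 i.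

Let incl_mono : omono (fac_incl Y).
Proof.
exact: (fiberwise_mono_omono (fac_F1_free Y) hF (@fac_incl_mono _ _ _ _ _ _ _ _ Y)).
Qed.

Let incl_mid := omor_comp (fac_incl Y) (fac_mid Y).

Let incl_mid_mono : omono incl_mid.
Proof. by move=> U s t /incl_mono/(fac_mid_mono (f := Y)). Qed.

(** The projection of E onto the first term is locally surjective. *)
Lemma fac_in_image U (t : F U) : in_image incl_mid t <-> in_image phi t.
Proof.
split=> [it x Ux|ft x /ft[V [h [s [Vx e]]]]]; last first.
  by exists V, h, (fac_proj Y V s); split=> //; rewrite -e (fac_comp Y).
have [V [h [z [Vx e]]]] := it x Ux.
have [W [g [s [Wx e']]]] := fac_proj_epi z Vx.
exists W, (subset_trans g h), s; split=> //.
rewrite (fac_comp Y) e' -(mres_comp h g) -e -[incl_mid V z]/(fac_incl Y V (fac_mid Y V z)).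
by rewrite !ofun_res.
Qed.

(** The cokernel is a module over the structure sheaf of D. *)
Lemma fac_mid_ideal V (a : str S V) (y : fac_F1 Y V) :
  clim_ideal i a -> in_image (fac_mid Y) (a *: y).
Proof.
move=> Ia; have [C [q [[_ qK] [L [_ [g [g' [gK _]]]]]]]] := fac_coker Y.
apply/qK; apply: (can_inj (gK V)); rewrite linearZ /= linearZ raddf0.
by rewrite -[LHS]/(comap i V a *: (g V (q V y) : L _)) Ia scale0r.
Qed.

(** One inclusion holds because the ideal of D kills the cokernel of fac_mid, the other
   because fac_incl is locally the inclusion of a direct summand. *)
Lemma fac_in_saturated_image U (t : F U) : in_image (fac_incl Y) t <-> saturated_image U t.
Proof.
split=> [it V h a Ia|st].
  apply/fac_in_image => x Vx; have [W [g [y [Wx e]]]] := it x (h x Vx).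
  pose V' := opensI V W; have hV' := subset_trans (@opensIl _ V W) h.
  have Ia' := clim_ideal_res (@opensIl _ V W) Ia.
  have [W' [g' [z [W'x e']]]] := fac_mid_ideal (mres _ (@opensIr _ V W) y) Ia' (conj Vx Wx).
  exists W', (subset_trans g' (@opensIl _ V W)), z; split=> //.
  rewrite -[LHS]/(fac_incl Y W' (fac_mid Y W' z)) e' ofun_res linearZ ofun_res e.
  rewrite -(mres_comp (@opensIl _ V W) g') mresZ !(mres_comp _ _ hV').
  by [].
apply: in_image_local => x Ux; have [V0 [d [V0x dP]]] := i_cartier x.
pose V := opensI U V0; have hV := @opensIr _ U V0.
exists V, (@opensIl _ U V0); split=> //.
apply: (fiberwise_mono_regular_div (fac_F1_free Y) hF
  (@fac_incl_mono _ _ _ _ _ _ _ _ Y) (d := rres O hV d)).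
  by move=> W g a; rewrite (rres_comp _ _ (subset_trans g hV)); exact: (dP W _).1.
have Id : clim_ideal i (rres O hV d) by apply/(dP V hV).2; exists 1; rewrite mul1r.
have /fac_in_image dt := st V (@opensIl _ U V0) _ Id.
move=> z /dt[W [g [y [Wz e]]]]; exists W, g, (fac_mid Y W y); split=> //.
Qed.

(** The terms of the two factorizations embed into F with the same images, and the
   embeddings force the isomorphisms. *)
Lemma factorization_unique : fac_uniquely_iso image_factorization Y.
Proof.
have [alpha alphaE] := omono_lift incl_mid_mono
  (fun U s => (fac_in_image _).2 (sub_incl_mem s : in_image phi (sub_incl phi_image U s))).
have [beta betaE] := omono_lift incl_mono
  (fun U s => (fac_in_saturated_image _).2 (sub_incl_mem (s : sub_omodule saturated_image U))).
have sub_image (P : subsheaf F) U t : P U t -> in_image (sub_incl P) t.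
  by move=> Pt; rewrite -[t]/(sub_incl P U (to_submodule Pt)); exact: in_image_ofun.
exists alpha, beta; split.
  split.
  - apply: (omono_lift_iso incl_mid_mono (@sub_incl_mono _ _ _ phi_image) alphaE) => U s.
    by apply: sub_image; apply/fac_in_image; exact: in_image_ofun.
  - apply: (omono_lift_iso incl_mono (@sub_incl_mono _ _ _ saturated_image) betaE) => U s.
    by apply: sub_image; apply/fac_in_saturated_image; exact: in_image_ofun.
  - by move=> U s; apply: (@incl_mid_mono U); rewrite alphaE -[LHS]/(phi U s) (fac_comp Y).
  - by move=> U s; apply: (@incl_mono U); rewrite betaE -[RHS]/(incl_mid U (alpha U s)) alphaE.
  - exact: betaE.
move=> alpha' beta' [_ _ _ mid' incl']; split=> U s; last first.
  by apply: (@incl_mono U); rewrite incl' betaE.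
apply: (@incl_mid_mono U); rewrite alphaE.
by rewrite -[LHS]/(fac_incl Y U (fac_mid Y U (alpha' U s))) -mid' incl'.
Qed.

End Uniqueness.
End Factorization.

Theorem proposition2p8 (k : fieldType) (S : scheme k) (E F : omodule S)
    (phi : omor E F) (r : nat) (D : scheme k) (i : smorphism D S)
    (hE : vector_bundle E) (hF : vector_bundle F)
    (hr0 : (0 < r)%N) (hr : has_rank phi r)
    (hD : degeneration_scheme phi r i) (hDcartier : effective_cartier i)
    (hs : forall s : geometric_point S, ~ fiber_ext_zero r.-1 phi s) :
  exists X : factorization phi r i,
    forall Y : factorization phi r i, fac_uniquely_iso X Y.
Proof.
case: r hr0 hr hD hs => // r _ [hr _] [hcl hmin] hs.
exists (image_factorization hE hF hr hcl hmin hDcartier hs) => Y.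
exact: factorization_unique.
Qed.
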